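(* Let $N\ge 2$ and $\ell_j\in(0,\infty]$ for $j=1,\dots,N$. Suppose that the real-valued potentials $V_j\in L^1_{loc}$ on $(0,\ell_j)$ are bounded from below and that the real-valued functions $W_j\in L^1(0,\ell_j)$ for $j=1,\dots,N$. For $\epsilon>0$ put $$W_{\epsilon,j}(x):=\frac1\epsilon\,W_j\!\left(\frac{x}{\epsilon}\right),\qquad j=1,\dots,N,$$ and $V+W_\epsilon:=\{V_j+W_{\epsilon,j}\}_{j=1}^N$. Then $$H_0(V+W_\epsilon)\longrightarrow H_\alpha(V)\qquad\text{as }\epsilon\to0+$$ in the norm resolvent sense, where $\alpha=\langle W\rangle:=\sum_{j=1}^N\int_0^{\ell_j}W_j(x)\,dx$.
   Context: Consider a graph of $N$ links, the $j$-th identified with the interval $(0,\ell_j)$, all joined at the common endpoint $0$ (the vertex). The Hilbert space is $\mathcal{H}=\bigoplus_{j=1}^N L^2(0,\ell_j)$. Local integrability of $V_j$ on $(0,\ell_j)$ is understood up to the vertex $0$ (and up to $\ell_j$ if $\ell_j<\infty$), i.e. these endpoints are regular. On each link with $\ell_j<\infty$ a boundary condition $\psi_j(\ell_j)\cos\omega_j+\psi_j'(\ell_j)\sin\omega_j=0$ with a fixed real $\omega_j$ is imposed; on semiinfinite links the expression $-\frac{d^2}{dx^2}+V_j$ is in the limit-point case at infinity. If $\ell_j<\infty$, $W_j$ is extended by zero to $(\ell_j,\infty)$ when forming $W_{\epsilon,j}$. For $\alpha\in\mathbb{R}$ and a family $V=\{V_j\}$ of real potentials, $H_\alpha(V)\{\psi_j\}=\{-\psi_j''+V_j\psi_j\}$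 on the domain of all $\{\psi_j\}\in\mathcal{H}$ such that $\psi_j,\psi_j'$ are locally absolutely continuous (up to the regular endpoints), $-\psi_j''+V_j\psi_j\in L^2(0,\ell_j)$, the boundary conditions at finite $\ell_j$ hold, and at the vertex $$\psi_1(0+)=\cdots=\psi_N(0+)=:\psi,\qquad \sum_{j=1}^N\psi_j'(0+)=\alpha\psi .$$ $H_0$ denotes the case $\alpha=0$. *)

(* Defs.v *)
From HB Require Import structures.
From mathcomp Require Import all_boot all_order all_algebra.
From mathcomp Require Import complex.
From mathcomp Require Import all_classical all_reals all_analysis.

Set Implicit Arguments.
Unset Strict Implicit.
Unset Printing Implicit Defensive.
Import Order.TTheory GRing.Theory Num.Theory.
Import numFieldNormedType.Exports.

Local Open Scope classical_set_scope.
Local Open Scope ring_scope.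
Local Open Scope complex_scope.

Section ComplexFunctions.
Variable R : realType.
Implicit Types (f u g : R -> R[i]) (D : set R) (l : \bar R) (z : R[i]).

Local Notation mu := (@lebesgue_measure R).
Local Notation normc := (@ComplexField.Normc.normc R).

Definition reC f : R -> R := fun x => complex.Re (f x).
Definition imC f : R -> R := fun x => complex.Im (f x).

Definition cderivable f (x : R) : Prop :=
  derivable (reC f) x 1 /\ derivable (imC f) x 1.

(* R[i] carries no normed-module structure over R, hence the detour through
   real and imaginary parts. *)
Definition cderive f : R -> R[i] :=
  fun x => derive1 (reC f) x +i* derive1 (imC f) x.

Definition clim (F : set_system R) f : R[i] :=
  lim (reC f @ F) +i* lim (imC f @ F).

(* The epsilon-delta condition on a bounded open interval forces f to extend
   to an absolutely continuous function on [a, b]. *)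
Definition abs_continuous_oo (a b : R) f : Prop :=
  forall e : R, 0 < e -> exists2 d : R, 0 < d &
    forall (n : nat) (p q : 'I_n -> R),
      (forall i, [/\ a < p i, p i <= q i & q i < b]) ->
      trivIset setT (fun i => [set` `]p i, q i[]) ->
      \sum_(i < n) (q i - p i) < d ->
      \sum_(i < n) normc (f (q i) - f (p i)) < e.

Definition link l : set R := [set x : R | 0 < x /\ (x%:E < l)%E].

(* "Locally" is up to the endpoint 0, and up to l when l is finite. *)
Definition loc_abs_continuous l f : Prop :=
  forall c : R, 0 < c -> (c%:E <= l)%E -> abs_continuous_oo 0 c f.

Definition loc_integrable l (v : R -> R) : Prop :=
  forall c : R, 0 < c -> (c%:E <= l)%E ->
    mu.-integrable [set` `]0, c[] (EFin \o v).

Definition ess_bounded_below l (v : R -> R) : Prop :=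
  exists m : R, {ae mu, forall x, link l x -> m <= v x}.

Definition sqnormL2 D f : \bar R :=
  (\int[mu]_(x in D) (normc (f x) ^+ 2)%:E)%E.

Definition L2 D f : Prop :=
  [/\ measurable_fun D (reC f), measurable_fun D (imC f)
    & (sqnormL2 D f < +oo)%E].

(* u, u' are locally absolutely continuous and - u'' + v u = g a.e.  Absolute
   continuity of u' already gives u'' a.e.; derivability is repeated only
   because derive1 is total. *)
Definition schrodinger_eq l (v : R -> R) u g : Prop :=
  [/\ forall x, link l x -> cderivable u x,
      loc_abs_continuous l u,
      loc_abs_continuous l (cderive u)
    & {ae mu, forall x, link l x ->
        cderivable (cderive u) x /\
        - cderive (cderive u) x + (v x)%:C * u x = g x}].

(* The limit-point case is the failure of the limit-circle case, in which for
   every z all solutions are square integrable near +oo. *)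
Definition limit_circle_case (v : R -> R) : Prop :=
  forall z u, schrodinger_eq +oo%E v u (fun x => z * u x) ->
    exists c : R, 0 < c /\ L2 [set` `]c, +oo[] u.

Definition limit_point_case (v : R -> R) : Prop := ~ limit_circle_case v.

(* Extension of w by zero outside the link, then scaling. *)
Definition scaled l (w : R -> R) (eps : R) : R -> R :=
  fun x => eps^-1 * (w \_ (link l)) (x / eps).

End ComplexFunctions.

(* Elements of the Hilbert space are represented by families of functions, of
   which only the values on the links, up to a.e. equality, are relevant. *)
Section StarGraph.
Variables (R : realType) (N : nat) (l : 'I_N -> \bar R).

Definition graph_fun := 'I_N -> R -> R[i].
Implicit Types (psi phi f g : graph_fun) (z : R[i]).

Definition inH f : Prop := forall j, L2 (link (l j)) (f j).

Definition hnorm f : \bar R :=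
  sqrte (\sum_(j < N) sqnormL2 (link (l j)) (f j))%E.

(* An operator is given by its graph: T psi g means that psi is the regular
   representative of an element of the domain and that T maps it to (the class
   of) g. *)
Definition operator := graph_fun -> graph_fun -> Prop.

Definition boundary_condition (omega : 'I_N -> R) psi : Prop :=
  forall j (b : R), l j = b%:E ->
    clim b^'- (psi j) * (cos (omega j))%:C
    + clim b^'- (cderive (psi j)) * (sin (omega j))%:C = 0.

Definition vertex_condition (alpha : R) psi : Prop :=
  exists psi0 : R[i],
    (forall j, clim 0^'+ (psi j) = psi0) /\
    \sum_(j < N) clim 0^'+ (cderive (psi j)) = alpha%:C * psi0.

Definition star_hamiltonian (omega : 'I_N -> R) (alpha : R)
    (V : 'I_N -> R -> R) : operator :=
  fun psi g =>
    [/\ inH psi, inH g,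
        forall j, schrodinger_eq (l j) (V j) (psi j) (g j),
        boundary_condition omega psi
      & vertex_condition alpha psi].

(* Graph of the resolvent: (T - z) psi = f. *)
Definition resolvent (T : operator) z : operator :=
  fun f psi => T psi (fun j x => f j x + z * psi j x).

(* T - z maps onto the whole space and has a bounded inverse; the bound gives
   injectivity, T being linear. *)
Definition resolvent_set (T : operator) z : Prop :=
  (forall f, inH f -> exists psi, resolvent T z f psi) /\
  exists C : R, forall f psi, inH f -> resolvent T z f psi ->
    (hnorm psi <= C%:E * hnorm f)%E.

(* Operator norm of S - T, for everywhere defined S and T. *)
Definition opnorm_diff (S T : operator) : \bar R :=
  ereal_sup [set r | exists f phi psi,
    [/\ inH f, (hnorm f <= 1)%E, S f phi, T f psi
      & r = hnorm (fun j x => phi j x - psi j x)]].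

Definition norm_resolvent_cvg (A : R -> operator) (B : operator) : Prop :=
  forall z, complex.Im z != 0 ->
    [/\ forall eps : R, 0 < eps -> resolvent_set (A eps) z,
        resolvent_set B z
      & opnorm_diff (resolvent (A eps) z) (resolvent B z)
          @[eps --> (0 : R)^'+] --> (0 : \bar R)%E].

End StarGraph.

(* Main.v *)
(** Fix a non-real z and f with |f| <= 1, and let phi and psi be the images of
    f under the resolvents at z of the Hamiltonians with potential V + W_eps
    (vertex parameter 0) and V (vertex parameter alpha).

    The L^1 norm of W_eps is bounded independently of eps, so testing the
    equation against phi, and absorbing W_eps by the trace inequality
    |phi(x)|^2 <= C |phi| |phi|_{H^1}, bounds phi and phi' in L^2, and phi in
    the sup norm, uniformly in eps and f; the same holds for psi.  The
    difference D = phi - psi solves the equation of the limit operator with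
    source - W_eps phi, and pairing it with D gives
      Im z |D|^2 = Im (- alpha phi(0) conj(D(0)) + sum_j int W_eps phi conj(D)).
    Both phi and D have Hoelder exponent 1/2, with uniform constants, and W_eps
    concentrates at the vertex with total mass tending to alpha, hence the
    right-hand side tends to 0 uniformly in f.

    Surjectivity of H - z: a square integrable solution on an infinite link is a
    limit of solutions on (0, n) with a boundary condition at n (Weyl's
    argument), and these are glued at the vertex.  All integrations by parts on
    an infinite link carry the weight 1 - x / n on (0, n), whose vanishing at n
    replaces information on the behaviour at infinity. *)
Require Import Defs.
From HB Require Import structures.
From mathcomp Require Import all_boot all_order all_algebra.
From mathcomp Require Import complex ring lra.
From mathcomp Require Import all_classical all_reals all_analysis.
From mathcomp Require Import measurable_realfun.

Set Implicit Arguments.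
Unset Strict Implicit.
Unset Printing Implicit Defensive.
Import Order.TTheory GRing.Theory Num.Theory.
Import numFieldNormedType.Exports.

Local Open Scope classical_set_scope.
Local Open Scope ring_scope.

(** * Absolutely continuous functions with vanishing derivative *)

Section AbsolutelyContinuous.
Variable R : realType.
Implicit Types (f g : R -> R) (a b x y : R).
Local Notation mu := (@lebesgue_measure R).

(** Elements of the domain are given by absolute continuity and an equation holding almost
    everywhere, while every estimate is an integration by parts. Everything is therefore transferred
    to primitives of locally integrable functions on the closed half-line, the coefficients being
    extended by zero beyond a finite link. The vertex then is the point 0, and integrals over (0, b)
    serve finite and infinite links alike. The obstacle on an infinite link is that u' is not known
    beforehand to be square integrable. The lower bound on the potential controls u' against the
    squared weight, with a constant independent of n; after that, the slope 1 / n of the weight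
    costs only O(1 / n) in the identity for the imaginary part. The smallness comes from a cut at x
    = rho^2. Below it, Hoelder continuity bounds the oscillation of phi conj(D) by a multiple of
    rho; beyond it, W_eps retains only the mass of W beyond rho^2 / eps. *)

Definition ac_oo a b f : Prop :=
  forall e : R, 0 < e -> exists2 d : R, 0 < d &
    forall (n : nat) (p q : 'I_n -> R),
      (forall i, [/\ a < p i, p i <= q i & q i < b]) ->
      trivIset setT (fun i => [set` `]p i, q i[]) ->
      \sum_(i < n) (q i - p i) < d ->
      \sum_(i < n) `|f (q i) - f (p i)| < e.

(** The step concerns an interval [t0, t1] tagged by s, as in a gauge argument. At the supremum of
    the points satisfying P it leads from a point just left of it to points on its right, which is
    possible only if the supremum is y. *)
Lemma real_induction (P : R -> Prop) x y : x <= y -> P x ->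
  (forall s, x <= s <= y -> exists2 r : R, 0 < r &
    forall t0 t1, x <= t0 -> t1 <= y -> s - r < t0 -> t0 <= s -> s <= t1 ->
      t1 < s + r -> P t0 -> P t1) ->
  P y.
Proof.
move=> xy Px step.
pose S := [set t | x <= t <= y /\ P t].
have supS : has_sup S.
  split; first by exists x; split; rewrite ?lexx.
  by exists y => t -[/andP[]].
have xS : x <= sup S by apply: (ub_le_sup supS.2); split; rewrite ?lexx.
have Sy : sup S <= y by apply: (ge_sup supS.1) => t -[/andP[]].
have [|r r0 H] := step (sup S); first by rewrite xS.
have [t0 [/andP[xt0 t0y] Pt0] rt0] := sup_adherent r0 supS.
have t0s : t0 <= sup S by apply: (ub_le_sup supS.2); split; rewrite ?xt0.
have Pt t1 : sup S <= t1 -> t1 < sup S + r -> t1 <= y -> P t1.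
  by move=> st1 t1r t1y; apply: (H t0).
move: Sy; rewrite le_eqVlt => /predU1P[sy|sy].
  by apply: Pt => //; rewrite ?sy// ltrDl.
pose t1 := Num.min y (sup S + r / 2).
have st1 : sup S < t1 by rewrite lt_min sy ltrDl divr_gt0.
have t1y : t1 <= y by rewrite ge_min lexx.
have : t1 <= sup S.
  apply: (ub_le_sup supS.2); split; first by rewrite t1y (le_trans xS) ?ltW.
  apply: Pt => //; first exact: ltW.
  by rewrite gt_min; apply/orP; right; lra.
by rewrite leNgt st1.
Qed.

(** Real induction produces its intervals one after the other, hence an ordered list. Lying in [U]
    replaces the bound on the total length. *)
Lemma ac_oo_seq a b f e (d : R) :
  (forall (n : nat) (p q : 'I_n -> R),
      (forall i, [/\ a < p i, p i <= q i & q i < b]) ->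
      trivIset setT (fun i => [set` `]p i, q i[]) ->
      \sum_(i < n) (q i - p i) < d ->
      \sum_(i < n) `|f (q i) - f (p i)| < e) ->
  forall U : set R, measurable U -> (mu U < d%:E)%E ->
  forall s : seq (R * R),
    {in s, forall u, [/\ a < u.1, u.1 <= u.2, u.2 < b & `]u.1, u.2[ `<=` U]} ->
    pairwise (fun u v => u.2 <= v.1) s ->
    \sum_(u <- s) `|f u.2 - f u.1| < e.
Proof.
move=> H U mU Ud s sU sp.
rewrite (big_nth (0, 0)) big_mkord.
have triv : trivIset setT
    (fun i : 'I_(size s) => `](nth (0, 0) s i).1, (nth (0, 0) s i).2[%classic).
  have wl i j : (i < j < size s)%N -> (nth (0, 0) s i).2 <= (nth (0, 0) s j).1.
    move=> /andP[ij js].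
    by move/(pairwiseP (0, 0)): sp; apply => //; rewrite inE (ltn_trans ij).
  apply/trivIsetP => i j _ _ ij.
  apply/seteqP; split => // z /= [].
  rewrite !in_itv/= => /andP[i1 i2] /andP[j1 j2].
  case: (ltngtP i j) => [lij|lji|/val_inj eij].
  - have := wl i j; rewrite lij ltn_ord => /(_ isT); lra.
  - have := wl j i; rewrite lji ltn_ord => /(_ isT); lra.
  - by rewrite eij eqxx in ij.
apply: (H (size s) (fun i => (nth (0, 0) s i).1) (fun i => (nth (0, 0) s i).2)) => //.
  by move=> i; have [] := sU _ (mem_nth (0, 0) (ltn_ord i)).
rewrite -lte_fin; apply: le_lt_trans Ud.
have <- : mu (\big[setU/set0]_(i < size s) `](nth (0, 0) s i).1, (nth (0, 0) s i).2[%classic)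
    = (\sum_(i < size s) ((nth (0, 0) s i).2 - (nth (0, 0) s i).1))%:E.
  rewrite measure_bigsetU_ord//= -sumEFin; apply: eq_bigr => i _.
  rewrite lebesgue_measure_itv/= lte_fin.
  have [_ le12 _ _] := sU _ (mem_nth (0, 0) (ltn_ord i)).
  case: ltP => // le21; congr _%:E; apply/eqP.
  by rewrite eq_sym subr_eq0 eq_le le12 le21.
apply: le_measure; rewrite ?inE//; first by apply: bigsetU_measurable.
rewrite -(bigcup_mkord _ (fun i => `](nth (0, 0) s i).1, (nth (0, 0) s i).2[%classic)).
move=> z [i /= si zi].
by have [_ _ _] := sU _ (mem_nth (0, 0) si); apply.
Qed.

(* The exceptional null set is covered by an open set U of small measure; by
   real induction the variation of f on [x, y] is at most e' (y - x) plus that on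
   finitely many intervals in U. *)
Lemma ac_oo_derive0_cst a b f :
  ac_oo a b f -> {ae mu, forall x, a < x < b -> is_derive x (1 : R) f 0} ->
  forall x y, a < x -> x <= y -> y < b -> f x = f y.
Proof.
move=> acf f0 x y ax xy yb; apply/eqP; rewrite -subr_eq0 -normr_le0.
rewrite distrC.
apply/ler_addgt0Pl => e e0; rewrite addr0.
(* With this value e' (y - x) + e' = e: one share for the points of zero derivative, one for the
   intervals in the open cover. *)
pose e' := e / (1 + (y - x)).
have yx1 : 0 < 1 + (y - x) by lra.
have e'0 : 0 < e' by rewrite divr_gt0.
have [d d0 /ac_oo_seq acd] := acf _ e'0.
have [N [mN N0 fN]] := f0.
have [|U [oU NU mU]] := lebesgue_regularity_outer mN _ d0; first by rewrite [X in (X < _)%E](_ : _ = 0%E).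
have {}mU : (mu U < d%:E)%E.
  rewrite -(setDUK NU) measureU//; last 2 first.
  - by apply: measurableD => //; exact: open_measurable.
  - by rewrite setDIK.
  by rewrite [X in (X + _)%E](_ : _ = 0%E) ?add0e.
have muU : measurable U by exact: open_measurable.
have {}acd := acd U muU mU.
pose P t := exists s : seq (R * R), [/\
    {in s, forall u, [/\ a < u.1, u.1 <= u.2, u.2 < b & `]u.1, u.2[ `<=` U]},
    pairwise (fun u v => u.2 <= v.1) s, {in s, forall u, u.2 <= t} &
    `|f t - f x| <= e' * (t - x) + \sum_(u <- s) `|f u.2 - f u.1|].
have [s [sU sp st]] : P y.
  apply: (@real_induction P x y) => //.
    by exists [::]; split => //; rewrite big_nil !subrr normr0 mulr0 addr0.
  move=> s /andP[xs sy].
  have [sN|sN] := pselect (N s).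
    have : nbhs s U by apply: open_nbhs_nbhs; split => //; exact: NU.
    case => r /= r0 rU; exists r => // t0 t1 xt0 t1y rt0 t0s st1 t1r.
    move=> [z [z1 z2 z3 z4]]; exists (rcons z (t0, t1)); split.
    - move=> u; rewrite mem_rcons inE => /predU1P[->|]; last exact: z1.
      split => /=; [lra|lra|lra|].
      move=> v /=; rewrite in_itv/= => v01; apply: rU => /=.
      by rewrite ltr_norml; lra.
    - rewrite pairwise_rcons z2 andbT; apply/allP => u uz /=; exact: z3.
    - move=> u; rewrite mem_rcons inE => /predU1P[->//|/z3]; lra.
    - rewrite big_rcons/=.
      have := ler_normD (f t1 - f t0) (f t0 - f x).
      rewrite (_ : f t1 - f t0 + (f t0 - f x) = f t1 - f x); last by lra.
      have : e' * (t0 - x) <= e' * (t1 - x) by rewrite ler_pM2l//; lra.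
      rewrite addrA; lra.
  have [sd s0] : is_derive s (1 : R) f 0.
    by apply: contrapT => h; apply: sN; apply: fN => /(_ ltac:(lra)).
  have : \forall h \near 0^', `|h^-1 *: (f (h + s) - f s)| <= e'.
    move/cvg_ex : sd => [k /= hk].
    have kE : k = 0.
      by rewrite -s0; apply/esym/cvg_lim => //; rewrite /derive.
    have := hk; rewrite kE => /cvgr0Pnorm_le => /(_ _ e'0).
    by apply: filterS => h; rewrite /= [h *: _]mulr1.
  case => r /= r0 hr; exists r => // t0 t1 xt0 t1y rt0 t0s st1 t1r.
  have key t : s - r < t -> t < s + r -> `|f t - f s| <= e' * `|t - s|.
    move=> tl tr; have [->|ts] := eqVneq t s; first by rewrite !subrr !normr0 mulr0.
    have ts0 : t - s != 0 by rewrite subr_eq0.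
    have := hr (t - s); rewrite /ball_/= sub0r normrN ltr_norml => /(_ ltac:(lra) ts0).
    rewrite subrK normrM normfV mulrC ler_pdivrMr//.
    by rewrite normr_gt0.
  move=> [z [z1 z2 z3 z4]]; exists z; split => //.
    by move=> u /z3; lra.
  have := key t0 rt0 ltac:(lra); have := key t1 ltac:(lra) t1r.
  rewrite (ger0_norm (_ : 0 <= t1 - s)); last lra.
  rewrite (ler0_norm (_ : t0 - s <= 0)); last lra.
  move=> k1 k2.
  have := ler_normD (f t1 - f s) (f s - f x).
  have := ler_normD (f s - f t0) (f t0 - f x).
  rewrite (distrC (f s)).
  rewrite (_ : f t1 - f s + (f s - f x) = f t1 - f x); last by lra.
  rewrite (_ : f s - f t0 + (f t0 - f x) = f s - f x); last by lra.
  lra.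
have := acd s sU sp.
have -> : e = e' * (y - x) + e' by rewrite /e'; field; lra.
lra.
Qed.

End AbsolutelyContinuous.

(** * Primitives of locally integrable functions *)

Section Primitive.
Variable R : realType.
Implicit Types (f g h F G : R -> R) (a b c x y : R).
Local Notation mu := (@lebesgue_measure R).

(* The endpoint 0 is included: it is regular on every link. *)
Definition locint g : Prop := forall b, mu.-integrable `[0, b] (EFin \o g).

Definition int0 g x : R := \int[mu]_(t in `[0, x]) g t.

Definition primitive F g : Prop :=
  locint g /\ forall x, 0 <= x -> F x = F 0 + int0 g x.

(** Continuity within [0, b] is one-sided at 0, so values at negative arguments are free and the
    value at the vertex is a limit from the right. *)
Definition contp F : Prop := forall b, {within `[0, b], continuous F}.

Lemma int0_0 g : int0 g 0 = 0.
Proof. by rewrite /int0 set_itv1 Rintegral_set1. Qed.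

Lemma integrable_oo_cc f a b :
  mu.-integrable `]a, b[ (EFin \o f) -> mu.-integrable `[a, b] (EFin \o f).
Proof.
move=> /integrableP[mf intf].
have mf' : measurable_fun `[a, b] f.
  apply/measurable_fun_itv_obnd_cbndP/measurable_fun_itv_bndo_bndcP.
  exact/measurable_EFinP.
apply/integrableP; split; first exact/measurable_EFinP.
have mn : measurable_fun `[a, b] (fun x => `|(EFin \o f) x|%E).
  by apply: measurableT_comp => //; exact/measurable_EFinP.
rewrite -integral_itv_obnd_cbnd; last first.
  by apply: measurable_funS mn => //; apply: subset_itv; rewrite bnd_simp.
rewrite -integral_itv_bndo_bndc//.
by apply: measurable_funS mn => //; apply: subset_itv; rewrite bnd_simp.
Qed.

Lemma eq_locint f g : (forall x, 0 < x -> f x = g x) -> locint f -> locint g.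
Proof.
move=> fg lf b; apply: integrable_oo_cc.
apply: (@eq_integrable _ _ R mu _ (measurable_itv _) (EFin \o f)).
  by move=> x; rewrite inE/= in_itv/= => /andP[x0 _]; rewrite fg.
by apply: integrableS (lf b) => //; apply: subset_itv; rewrite bnd_simp.
Qed.

Lemma locint_cst c : locint (cst c).
Proof.
move=> b; apply: (@continuous_compact_integrable R (cst c)).
  exact: segment_compact.
by apply: continuous_subspaceT => x; exact: cst_continuous.
Qed.

Lemma locintD f g : locint f -> locint g -> locint (fun x => f x + g x).
Proof. by move=> lf lg b; have := integrableD _ (lf b) (lg b); apply. Qed.

Lemma locintZ c f : locint f -> locint (fun x => c * f x).
Proof.
by move=> lf b; apply: (@integrableZl _ _ R mu _ (measurable_itv _) c _ (lf b)).
Qed.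

Lemma locintN f : locint f -> locint (fun x => - f x).
Proof.
move=> lf; apply: (@eq_locint (fun x => -1 * f x)); last exact: locintZ.
by move=> x _; rewrite mulN1r.
Qed.

Lemma locintB f g : locint f -> locint g -> locint (fun x => f x - g x).
Proof. by move=> lf lg; apply: locintD => //; exact: locintN. Qed.

Lemma locint_norm f : locint f -> locint (fun x => `|f x|).
Proof. by move=> lf b; exact: integrable_norm (lf b). Qed.

Lemma locint_sum (I : Type) (r : seq I) (P : pred I) (h : I -> R -> R) :
  (forall i, locint (h i)) -> locint (fun x => \sum_(i <- r | P i) h i x).
Proof.
move=> lh; elim: r => [|i r IH].
  by apply: eq_locint (locint_cst 0) => x _; rewrite big_nil.
case Pi : (P i); first by apply: eq_locint (locintD (lh i) IH) => x _; rewrite big_cons Pi.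
by apply: eq_locint IH => x _; rewrite big_cons Pi.
Qed.

Lemma contp_bounded F b : contp F ->
  exists2 M, 0 < M & forall x, 0 <= x <= b -> `|F x| <= M.
Proof.
move=> cF.
have [M [_ HM]] := compact_bounded (continuous_compact (cF b) (@segment_compact _ _ _)).
exists (`|M| + 1); first by rewrite ltr_wpDl.
move=> x xb; apply: (HM (`|M| + 1)); first by rewrite (le_lt_trans (ler_norm _))// ltrDl.
by exists x.
Qed.

Lemma contpM_locint F g : contp F -> locint g -> locint (fun x => F x * g x).
Proof.
move=> cF lg b; have [b0|b0] := ltP b 0.
  by rewrite set_itv_ge ?bnd_simp -?ltNge//; exact: integrable_set0.
apply: (@integrableMr _ _ _ mu `[0, b] _ F (EFin \o g)) => //.
- exact: subspace_continuous_measurable_fun.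
- have [M M0 HM] := contp_bounded b cF.
  exists M; split; first exact: num_real.
  by move=> y My x; rewrite /= in_itv/= => /HM xM; rewrite (le_trans xM)// ltW.
Qed.

Lemma eq_int0 f g b : (forall x, 0 < x < b -> f x = g x) -> locint f ->
  locint g -> int0 f b = int0 g b.
Proof.
move=> fg lf lg; rewrite /int0.
have [b0|b0] := ltP b 0.
  by rewrite set_itv_ge ?bnd_simp -?ltNge// !Rintegral_set0.
have H h : locint h -> \int[mu]_(t in `[0, b]) h t = \int[mu]_(t in `]0, b[) h t.
  move=> lh; rewrite -Rintegral_itv_obnd_cbnd; last first.
    by apply: integrableS (lh b) => //; apply: subset_itv; rewrite bnd_simp.
  rewrite -Rintegral_itv_bndo_bndc//.
  by apply: integrableS (lh b) => //; apply: subset_itv; rewrite bnd_simp.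
rewrite !H//; apply: eq_Rintegral => x; rewrite inE/= in_itv/=; exact: fg.
Qed.

Lemma int0D f g b : locint f -> locint g ->
  int0 (fun x => f x + g x) b = int0 f b + int0 g b.
Proof. by move=> lf lg; rewrite /int0 RintegralD. Qed.

Lemma int0Z c f b : locint f -> int0 (fun x => c * f x) b = c * int0 f b.
Proof. by move=> lf; rewrite /int0 RintegralZl. Qed.

Lemma int0N f b : locint f -> int0 (fun x => - f x) b = - int0 f b.
Proof.
move=> lf; rewrite -mulN1r -int0Z//; apply: eq_Rintegral => x _.
by rewrite mulN1r.
Qed.

Lemma int0B f g b : locint f -> locint g ->
  int0 (fun x => f x - g x) b = int0 f b - int0 g b.
Proof. by move=> lf lg; rewrite int0D ?int0N//; exact: locintN. Qed.

Lemma int0_cst c b : 0 <= b -> int0 (cst c) b = c * b.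
Proof.
move=> b0; rewrite /int0 Rintegral_cst//.
have mb : mu `[0, b] = b%:E.
  rewrite lebesgue_measure_itv/= lte_fin.
  by case: ltP => bb; [rewrite oppr0 addr0|congr _%:E; lra].
by rewrite [X in fine X](_ : _ = b%:E).
Qed.

Lemma int0_sum (I : Type) (r : seq I) (P : pred I) (h : I -> R -> R) b :
  (forall i, locint (h i)) ->
  int0 (fun x => \sum_(i <- r | P i) h i x) b = \sum_(i <- r | P i) int0 (h i) b.
Proof.
move=> lh; elim: r => [|i r IH].
  rewrite big_nil; under [LHS]eq_Rintegral do rewrite big_nil.
  by rewrite Rintegral_cst// mul0r.
rewrite big_cons; case Pi : (P i).
  by rewrite -IH -int0D//; [apply: eq_Rintegral => x _; rewrite big_cons Pi|exact: locint_sum].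
by rewrite -IH; apply: eq_Rintegral => x _; rewrite big_cons Pi.
Qed.

Lemma le_int0 f g b : locint f -> locint g ->
  (forall x, 0 < x < b -> f x <= g x) -> int0 f b <= int0 g b.
Proof.
move=> lf lg fg.
pose f' := fun x => if (0 < x < b) then f x else 0.
pose g' := fun x => if (0 < x < b) then g x else 0.
have H h : locint h -> locint (fun x => if (0 < x < b) then h x else 0).
  move=> lh c.
  have -> : EFin \o (fun x => if 0 < x < b then h x else 0) = (EFin \o h) \_ `]0, b[.
    by apply/funext => x /=; rewrite patchE mem_setE in_itv/=; case: ifP.
  apply/integrable_restrict => //; by apply: (@integrableS _ _ R mu `[0, c]) => //; exact: measurableI.
rewrite (@eq_int0 f f')//; [|by move=> x /= xb; rewrite /f' xb|exact: H].
rewrite (@eq_int0 g g')//; [|by move=> x /= xb; rewrite /g' xb|exact: H].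
rewrite /int0 le_Rintegral//; [exact: H|exact: H|].
by move=> x _; rewrite /f' /g'; case: ifP => // /fg.
Qed.

Lemma int0_ge0 f b : locint f -> (forall x, 0 < x < b -> 0 <= f x) -> 0 <= int0 f b.
Proof.
move=> lf f0.
have -> : 0 = int0 (cst 0) b by rewrite /int0 Rintegral_cst// mul0r.
by apply: le_int0 => //; exact: locint_cst.
Qed.

Lemma int0_subE g x y : locint g -> 0 <= x <= y ->
  int0 g y - int0 g x = \int[mu]_(t in `]x, y]) g t.
Proof.
move=> lg /andP[x0 xy]; rewrite /int0 Rintegral_itvB//; exact: lg.
Qed.

Lemma int0_nd g x y : locint g -> (forall t, 0 < t -> 0 <= g t) ->
  0 <= x <= y -> int0 g x <= int0 g y.
Proof.
move=> lg g0 /andP[x0 xy]; rewrite -subr_ge0 int0_subE ?x0//.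
by apply: Rintegral_ge0 => t /=; rewrite in_itv/= => /andP[xt _]; apply: g0; lra.
Qed.

Lemma le_norm_int0 g x y : locint g -> 0 <= x <= y ->
  `|int0 g y - int0 g x| <= int0 (fun t => `|g t|) y - int0 (fun t => `|g t|) x.
Proof.
move=> lg xy; rewrite !int0_subE//; last exact: locint_norm.
apply: le_normr_Rintegral => //; apply: integrableS (lg y) => //.
by apply: subset_itv => //; case/andP: xy => x0 xy; rewrite bnd_simp.
Qed.

Lemma locint_contp g : locint g -> contp (int0 g).
Proof.
move=> lg b; have [b0|b0] := ltP b 0.
  by rewrite set_itv_ge ?bnd_simp -?ltNge//; apply: continuous_subspace0.
exact: (parameterized_integral_continuous b0 (lg b)).
Qed.

Lemma eq_contp F G : (forall x, 0 <= x -> F x = G x) -> contp F -> contp G.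
Proof.
move=> FG cF b; apply: subspace_eq_continuous (cF b) => x.
rewrite mem_setE in_itv/= => /andP[x0 _]; first [exact: FG|exact/esym/FG].
Qed.

Lemma contp_cst c : contp (cst c).
Proof. by move=> b; apply: continuous_subspaceT => x; exact: cst_continuous. Qed.

Lemma contpD F G : contp F -> contp G -> contp (fun x => F x + G x).
Proof. by move=> cF cG b x; apply: cvgD; [exact: cF|exact: cG]. Qed.

Lemma primitive_contp F g : primitive F g -> contp F.
Proof.
move=> [lg Fg]; apply: (@eq_contp (fun x => F 0 + int0 g x)).
  by move=> x x0; rewrite -Fg.
by apply: contpD; [exact: contp_cst|exact: locint_contp].
Qed.

Lemma contp_locint F : contp F -> locint F.
Proof.
move=> cF; apply: eq_locint (contpM_locint cF (locint_cst 1)) => x _ /=.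
by rewrite mulr1.
Qed.

Lemma contp_continuous F x : contp F -> 0 < x -> {for x, continuous F}.
Proof.
move=> cF x0; have := cF (x + 1).
move/continuous_within_itvP => /(_ ltac:(lra))[H _ _]; apply: H.
by rewrite in_itv/=; lra.
Qed.

Lemma contp_cvg0 F : contp F -> F x @[x --> 0^'+] --> F 0.
Proof. by move=> cF; have /continuous_within_itvP := cF 1; case. Qed.

Lemma primitive_int0 g : locint g -> primitive (int0 g) g.
Proof. by move=> lg; split => // x _; rewrite int0_0 add0r. Qed.

Lemma primitive_locint F g : primitive F g -> locint F.
Proof. by move/primitive_contp/contp_locint. Qed.

Lemma locint_ae_derive g : locint g ->
  {ae mu, forall x, 0 < x -> is_derive x (1 : R) (int0 g) (g x)}.
Proof.
move=> lg.
(* The differentiation theorem is applied to the truncations of [g] to [0, n]; the countably many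
   exceptional null sets are then united. *)
have : {ae mu, forall x, forall n : nat, 0 < x < n%:R -> is_derive x (1 : R) (int0 g) (g x)}.
  apply: ae_foralln => n; pose gn := g \_ `[0, n%:R].
  have ign y : mu.-integrable `[0, y] (EFin \o gn).
    rewrite /gn -restrict_EFin; apply/integrable_restrict => //.
    by apply: (@integrableS _ _ R mu `[0, y]) => //; exact: measurableI.
  have lgn : locally_integrable setT gn by apply: integrable_locally => //; exact: measurableI.
  have := @FTC1 R gn (BLeft 0) ign lgn.
  apply: filterS; first exact: (ae_filter_ringOfSetsType mu).
  move=> x /= H /andP[x0 xn].
  have gnx : gn x = g x by rewrite /gn patchE mem_setE in_itv/= (ltW x0) (ltW xn).
  have [|dx dxE] := H; first by [].
  have D1 : is_derive x (1 : R) (int0 gn) (g x).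
    by apply: DeriveDef => //; rewrite -derive1E -gnx.
  apply: near_eq_is_derive D1.
  have : \forall y \near x, y < n%:R by exact: lt_nbhsl.
  apply: filterS => y yn; apply: eq_int0 => //.
  move=> t /andP[t0 ty]; rewrite /gn patchE mem_setE in_itv/= (ltW t0) (ltW (lt_trans ty yn))//.
apply: filterS; first exact: (ae_filter_ringOfSetsType mu).
move=> x H x0; apply: (H (Num.bound x)).
by rewrite x0/= archi_boundP// ltW.
Qed.

Lemma primitive_ae_derive F g : primitive F g ->
  {ae mu, forall x, 0 < x -> is_derive x (1 : R) F (g x)}.
Proof.
move=> [lg Fg]; have := locint_ae_derive lg.
apply: filterS; first exact: (ae_filter_ringOfSetsType mu).
move=> x H x0.
have D1 : is_derive x (1 : R) (cst (F 0) + int0 g) (g x).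
  by rewrite -[g x]add0r; apply: is_deriveD; exact: H.
apply: near_eq_is_derive D1.
have : \forall y \near x, 0 < y by exact: lt_nbhsr.
by apply: filterS => y y0; rewrite [RHS]Fg ?ltW.
Qed.

Lemma primitive_derive F g x : primitive F g -> contp g -> 0 < x ->
  is_derive x (1 : R) F (g x).
Proof.
move=> [lg Fg] cg x0.
have [||dx dxE] := @continuous_FTC1_closed R g 0 x (x + 1) _ (lg _) x0.
- by rewrite ltrDl.
- exact: contp_continuous.
have D1 : is_derive x (1 : R) (cst (F 0) + int0 g) (g x).
  rewrite -[g x]add0r; apply: is_deriveD.
  by apply: DeriveDef => //; rewrite -derive1E.
apply: near_eq_is_derive D1.
have : \forall y \near x, 0 < y by exact: lt_nbhsr.
by apply: filterS => y y0; rewrite [RHS]Fg ?ltW.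
Qed.

(** The increments of [F] sum to at most the integral of |g| over the union of the intervals, which
    is small when the union has small measure. *)
Lemma primitive_ac F g b : primitive F g -> ac_oo 0 b F.
Proof.
move=> [lg Fg] e e0; have [b0|b0] := ltP b 0.
  exists 1 => // -[|n] p q H _ _; first by rewrite big_ord0.
  by have [] := H ord0; lra.
pose gb := g \_ `[0, b].
have igb : mu.-integrable setT (EFin \o gb).
  by rewrite /gb -restrict_EFin; apply/integrable_restrict => //; rewrite setTI; exact: lg.
have [d [d0 Hd]] := integral_normr_continuous igb e0.
exists d => // n p q pq tr spq.
pose D := \big[setU/set0]_(i < n) `]p i, q i[%classic.
have mD : measurable D by exact: bigsetU_measurable.
have Dd : (mu D < d%:E)%E.
  rewrite measure_bigsetU_ord//= (eq_bigr (fun i => (q i - p i)%:E)) ?sumEFin ?lte_fin//.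
  move=> i _; rewrite lebesgue_measure_itv/= lte_fin; have [_ le12 _] := pq i.
  case: ltP => // le21; congr _%:E; apply/eqP.
  by rewrite eq_sym subr_eq0 eq_le le12 le21.
apply: le_lt_trans (Hd _ mD Dd).
have igbn : mu.-integrable setT (EFin \o (fun x => `|gb x|)) by exact: integrable_norm.
rewrite /Rintegral integral_bigsetU_EFin//=; last 3 first.
- exact: index_enum_uniq.
- by apply: sub_trivIset tr.
- by apply: measurable_funTS; exact: (measurable_int mu).
rewrite -sum_fine; last first.
  move=> i _; apply: integrable_fin_num => //.
  by apply: (@integrableS _ _ R mu setT).
apply: ler_sum => i _.
have [p0 p1 q1] := pq i.
rewrite (Fg (q i)) ?(Fg (p i)); [|lra|lra].
rewrite opprD addrACA subrr add0r int0_subE//; last lra.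
rewrite -Rintegral_itv_bndo_bndc; last first.
  by apply: integrableS (lg (q i)) => // t; rewrite /= !in_itv/= => ht; lra.
rewrite [leRHS](_ : _ = \int[mu]_(x in `]p i, q i[) `|g x|); last first.
  apply: eq_Rintegral => x; rewrite inE/= in_itv/= => xpq.
  by rewrite /gb patchE mem_setE in_itv/= ifT//; lra.
apply: le_normr_Rintegral => //.
by apply: integrableS (lg (q i)) => // t; rewrite /= !in_itv/= => ht; lra.
Qed.

Lemma ac_ooB a b F G : ac_oo a b F -> ac_oo a b G -> ac_oo a b (fun x => F x - G x).
Proof.
move=> aF aG e e0.
have e2 : 0 < e / 2 by rewrite divr_gt0.
have [d1 d10 H1] := aF _ e2; have [d2 d20 H2] := aG _ e2.
exists (Num.min d1 d2); first by rewrite lt_min d10.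
move=> n p q pq tr; rewrite lt_min => /andP[s1 s2].
have := H1 n p q pq tr s1; have := H2 n p q pq tr s2.
have : \sum_(i < n) `|F (q i) - G (q i) - (F (p i) - G (p i))| <=
  \sum_(i < n) `|F (q i) - F (p i)| + \sum_(i < n) `|G (q i) - G (p i)|.
  rewrite -big_split/=; apply: ler_sum => i _.
  rewrite (_ : _ - _ = (F (q i) - F (p i)) - (G (q i) - G (p i))); last by ring.
  exact: ler_normB.
lra.
Qed.

Lemma ac_oo_primitive b F g : locint g -> ac_oo 0 b F ->
  {ae mu, forall x, 0 < x < b -> is_derive x (1 : R) F (g x)} ->
  forall x y, 0 < x -> x <= y -> y < b -> F y - int0 g y = F x - int0 g x.
Proof.
move=> lg aF dF x y x0 xy yb; apply/esym.
apply: (@ac_oo_derive0_cst _ 0 b (fun t => F t - int0 g t)) => //.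
  by apply: ac_ooB => //; apply: primitive_ac (primitive_int0 lg).
have := locint_ae_derive lg; move: dF.
apply: filterS2; first exact: (ae_filter_ringOfSetsType mu).
move=> t H1 H2 t0b; have t0 : 0 < t by lra.
by have := is_deriveB (H1 t0b) (H2 t0); rewrite subrr.
Qed.

(** Absolute continuity on (0, b) makes F - int0 g constant at interior points only; continuity
    carries the constant to 0. *)
Lemma primitive_unique F g : locint g -> contp F -> (forall b, ac_oo 0 b F) ->
  {ae mu, forall x, 0 < x -> is_derive x (1 : R) F (g x)} -> primitive F g.
Proof.
move=> lg cF aF dF; split => // x; rewrite le_eqVlt => /predU1P[<-|x0].
  by rewrite int0_0 addr0.
have H y : 0 < y < x -> F y - int0 g y = F x - int0 g x.
  move=> yx; apply/esym; apply: (@ac_oo_primitive (x + 1)) => //; [|lra..].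
  apply: filterS dF; first exact: (ae_filter_ringOfSetsType mu).
  by move=> t Ht /andP[t0 _]; exact: Ht.
have c1 : contp (fun t => F t + - int0 g t).
  apply: contpD => //; apply: (@eq_contp (int0 (fun t => - g t))).
    by move=> t _; exact: int0N.
  exact/locint_contp/locintN.
have := contp_cvg0 c1.
have : F t + - int0 g t @[t --> 0^'+] --> F x - int0 g x.
  apply: cvg_near_cst; near=> t; apply/H.
  by apply/andP; split; near: t; [exact: nbhs_right_gt|exact: nbhs_right_lt].
move=> h1 h2.
have E : F x - int0 g x = F 0 + - int0 g 0 by exact: (cvg_unique _ h1 h2).
by rewrite int0_0 in E; lra.
Unshelve. all: by end_near. Qed.

(** This is integration by parts for absolutely continuous functions, the source of every energy
    identity below. Boundedness of both factors on [0, b] makes the product absolutely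
    continuous. *)
Lemma primitiveM F f G g : primitive F f -> primitive G g ->
  primitive (fun x => F x * G x) (fun x => F x * g x + G x * f x).
Proof.
move=> pF pG.
have cF := primitive_contp pF; have cG := primitive_contp pG.
apply: primitive_unique.
- by apply: locintD; apply: contpM_locint => //; [case: pG|case: pF].
- by move=> b x; apply: cvgM; [exact: cF|exact: cG].
- move=> b e e0.
  have [M M0 HM] := contp_bounded b cF; have [K K0 HK] := contp_bounded b cG.
  have e1 : 0 < e / (2 * (M + K)) by rewrite divr_gt0// mulr_gt0// addr_gt0.
  have [d1 d10 H1] := primitive_ac b pF e1.
  have [d2 d20 H2] := primitive_ac b pG e1.
  exists (Num.min d1 d2); first by rewrite lt_min d10.
  move=> n p q pq tr; rewrite lt_min => /andP[s1 s2].
  have := H1 n p q pq tr s1; have := H2 n p q pq tr s2.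
  set A := \sum_(i < n) _; set B := \sum_(i < n) _ => h1 h2.
  have : \sum_(i < n) `|F (q i) * G (q i) - F (p i) * G (p i)| <= M * A + K * B.
    rewrite /A /B !mulr_sumr -big_split/=; apply: ler_sum => i _.
    have [p0 p1 q1] := pq i.
    rewrite (_ : _ - _ = F (q i) * (G (q i) - G (p i)) + G (p i) * (F (q i) - F (p i))).
      rewrite (le_trans (ler_normD _ _))// !normrM lerD// ler_wpM2r//.
        by apply: HM; lra.
      by apply: HK; lra.
    by lra.
  have : M * A <= M * (e / (2 * (M + K))) by rewrite ler_pM2l// ltW.
  have : K * B < K * (e / (2 * (M + K))) by rewrite ltr_pM2l.
  have : M * (e / (2 * (M + K))) + K * (e / (2 * (M + K))) = e / 2 by field; lra.
  lra.
- have := primitive_ae_derive pF; have := primitive_ae_derive pG.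
  apply: filterS2; first exact: (ae_filter_ringOfSetsType mu).
  move=> x H1 H2 x0.
  exact: is_deriveM (H2 x0) (H1 x0).
Qed.

Lemma primitiveD F f G g : primitive F f -> primitive G g ->
  primitive (fun x => F x + G x) (fun x => f x + g x).
Proof.
move=> [lf pF] [lg pG]; split; first exact: locintD.
by move=> x x0; rewrite int0D// pF// pG//; lra.
Qed.

Lemma primitiveZ c F f : primitive F f -> primitive (fun x => c * F x) (fun x => c * f x).
Proof.
move=> [lf pF]; split; first exact: locintZ.
by move=> x x0; rewrite int0Z// pF// mulrDr.
Qed.

Lemma primitiveB F f G g : primitive F f -> primitive G g ->
  primitive (fun x => F x - G x) (fun x => f x - g x).
Proof.
move=> [lf pF] [lg pG]; split; first exact: locintB.
by move=> x x0; rewrite int0B// pF// pG//; lra.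
Qed.

Lemma primitive_cst c : primitive (cst c) (cst 0).
Proof.
split; first exact: locint_cst.
by move=> x x0; rewrite int0_cst// mul0r addr0.
Qed.

Lemma primitive_id c : primitive (fun x => c * x) (cst c).
Proof.
split; first exact: locint_cst.
by move=> x x0; rewrite int0_cst// mulr0 add0r.
Qed.

Lemma eq_primitive F f g : primitive F f -> (forall x, f x = g x) -> primitive F g.
Proof. by move=> pF fg; have -> : g = f by apply/funext => x; rewrite fg. Qed.

End Primitive.

(** * Linear systems with integrable coefficients *)

Section LinearSystem.
Variables (R : realType) (d : nat).
Implicit Types (M : 'I_d -> 'I_d -> R -> R) (F Y : 'I_d -> R -> R) (b x : R).
Local Notation mu := (@lebesgue_measure R).

Definition linear_rhs M F Y (i : 'I_d) (t : R) : R :=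
  \sum_(k < d) Y k t * M i k t + F i t.

Fixpoint picard M F (y0 : 'I_d -> R) (n : nat) : 'I_d -> R -> R :=
  if n is n'.+1 then
    fun i x => y0 i + int0 (linear_rhs M F (picard M F y0 n') i) x
  else fun i _ => y0 i.

Variables (M : 'I_d -> 'I_d -> R -> R) (F : 'I_d -> R -> R) (y0 : 'I_d -> R).
Hypothesis locintM : forall i k, locint (M i k).
Hypothesis locintF : forall i, locint (F i).

Local Notation Y := (picard M F y0).
Local Notation a := (fun t => \sum_(i < d) \sum_(k < d) `|M i k t|).

Let locint_rhs Z i : (forall k, contp (Z k)) -> locint (linear_rhs M F Z i).
Proof.
move=> cZ; apply: locintD => //; apply: locint_sum => k.
exact: contpM_locint.
Qed.

Let contp_picard n i : contp (Y n i).
Proof.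
elim: n i => [|n IH] i; first exact: contp_cst.
by apply: contpD; [exact: contp_cst|exact/locint_contp/locint_rhs].
Qed.

Let locint_a : locint a.
Proof. by do 2 apply: locint_sum => ?; exact: locint_norm. Qed.

Let a_ge0 t : 0 <= a t.
Proof. by apply: sumr_ge0 => i _; apply: sumr_ge0. Qed.

(** The coefficients are only integrable, so the Picard estimate gains its factorial from powers of
    the integral of [a] instead of powers of x. *)
Let primitive_power n :
  primitive (fun x => int0 a x ^+ n.+1) (fun x => n.+1%:R * int0 a x ^+ n * a x).
Proof.
elim: n => [|n IH].
  apply: (@eq_primitive _ _ a).
    by have := primitive_int0 locint_a; congr primitive; apply/funext => x; rewrite expr1.
  by move=> x; rewrite expr0 !mul1r.
have := primitiveM (primitive_int0 locint_a) IH.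
have -> : (fun x => int0 a x * int0 a x ^+ n.+1) = (fun x => int0 a x ^+ n.+2).
  by apply/funext => x; rewrite -exprS.
move/eq_primitive; apply => x; rewrite -[in RHS]natr1 !exprS; ring.
Qed.

(** One iteration integrates the previous bound against [a], and A^n a / n! has the primitive
    A^(n+1) / (n+1)!, where A is the integral of [a]. *)
Let picard_diff b : exists2 C, 0 <= C & forall n x, 0 <= x <= b ->
  \sum_(i < d) `|Y n.+1 i x - Y n i x| <= C * (int0 a x ^+ n / n`!%:R).
Proof.
have : exists2 C, 0 <= C & forall x, 0 <= x <= b ->
    \sum_(i < d) `|Y 1 i x - Y 0 i x| <= C.
  suff H (r : seq 'I_d) : exists2 C, 0 <= C & forall x, 0 <= x <= b ->
    \sum_(i <- r) `|Y 1 i x - Y 0 i x| <= C by exact: H.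
  elim: r => [|i r [C C0 HC]]; first by exists 0 => // x _; rewrite big_nil.
  have [K K0 HK] := contp_bounded b (contpD (@contp_picard 1%N i) (@contp_cst R (- y0 i))).
  exists (K + C); first by rewrite addr_ge0// ltW.
  by move=> x xb; rewrite big_cons lerD//; [exact: HK|exact: HC].
move=> [C C0 HC]; exists C => //; elim=> [|n IH] x xb.
  by rewrite expr0 fact0 divr1 mulr1; exact: HC.
pose D k t := Y n.+1 k t - Y n k t.
have cD k : contp (D k).
  by move=> c t; apply: cvgB; exact: contp_picard.
have lD i k : locint (fun t => D k t * M i k t) by exact: contpM_locint.
have lDn i k : locint (fun t => `|D k t| * `|M i k t|).
  by apply: eq_locint (locint_norm (lD i k)) => t _; rewrite normrM.
have step i : `|Y n.+2 i x - Y n.+1 i x| <=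
    int0 (fun t => \sum_(k < d) `|D k t| * `|M i k t|) x.
  have -> : Y n.+2 i x - Y n.+1 i x = int0 (fun t => \sum_(k < d) D k t * M i k t) x.
    rewrite [LHS](_ : _ = int0 (linear_rhs M F (Y n.+1) i) x - int0 (linear_rhs M F (Y n) i) x); last first.
      by rewrite /=; ring.
    rewrite -int0B; [|exact: locint_rhs|exact: locint_rhs].
    apply: eq_Rintegral => t _; rewrite /linear_rhs opprD addrACA subrr addr0 -sumrB.
    by apply: eq_bigr => k _; rewrite -mulrBl.
  have lS : locint (fun t => \sum_(k < d) D k t * M i k t) by exact: locint_sum.
  have := @le_norm_int0 _ _ 0 x lS.
  rewrite lexx/= !int0_0 !subr0 => /(_ ltac:(lra)) h; apply: (le_trans h).
  apply: le_int0; [exact: locint_norm|exact: locint_sum|].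
  move=> t _; apply: (le_trans (ler_norm_sum _ _ _)).
  by apply: ler_sum => k _; rewrite normrM.
apply: (@le_trans _ _ (int0 (fun t => (C / n`!%:R * int0 a t ^+ n) * a t) x)).
  apply: (le_trans (ler_sum _ (fun i _ => step i))).
  rewrite -int0_sum; last by move=> i; exact: locint_sum.
  apply: le_int0.
  - by do 2 apply: locint_sum => ?.
  - apply: (@eq_locint _ (fun t => C / n`!%:R / n.+1%:R * (n.+1%:R * int0 a t ^+ n * a t))).
      by move=> t _; rewrite !mulrA divfK// pnatr_eq0.
    by apply: locintZ; have [] := primitive_power n.
  - move=> t tx; rewrite mulr_sumr; apply: ler_sum => i _.
    rewrite mulr_sumr; apply: ler_sum => k _; apply: ler_wpM2r => //.
    have tb : 0 <= t <= b by lra.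
    apply: le_trans (_ : C * (int0 a t ^+ n / n`!%:R) <= _); last by rewrite mulrA mulrAC.
    apply: le_trans (IH t tb).
    by rewrite (bigD1 k)//= lerDl sumr_ge0.
rewrite le_eqVlt; apply/orP; left; apply/eqP.
have [lp pE] := primitive_power n.
have := pE x ltac:(lra); rewrite int0_0 expr0n/= add0r => ->.
have -> : (fun t => C / n`!%:R * int0 a t ^+ n * a t) =
    (fun t => C / n.+1`!%:R * (n.+1%:R * int0 a t ^+ n * a t)).
  apply/funext => t; rewrite factS natrM.
  have p0 : n.+1%:R != 0 :> R by rewrite pnatr_eq0.
  have q0 : n`!%:R != 0 :> R by rewrite pnatr_eq0 -lt0n fact_gt0.
  by move: p0 q0; move: (n.+1%:R : R) (n`!%:R : R) => p q p0 q0; field; rewrite p0 q0.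
by rewrite int0Z// mulrA mulrAC.
Qed.

(** The increments telescope under the exponential series. The bound is uniform in n and provides
    the dominating function for the passage to the limit. *)
Let picard_bound b : exists2 K, 0 <= K & forall n i x, 0 <= x <= b -> `|Y n i x| <= K.
Proof.
have [C C0 HC] := picard_diff b.
pose y1 := \sum_(i < d) `|y0 i|.
exists (y1 + C * expR (int0 a b)).
  by rewrite addr_ge0 ?sumr_ge0// mulr_ge0// expR_ge0.
move=> n i x xb.
have A0 : 0 <= int0 a x by exact: int0_ge0.
have Ab : int0 a x <= int0 a b by apply: int0_nd.
have -> : Y n i x = Y 0 i x + \sum_(0 <= k < n) (Y k.+1 i x - Y k i x).
  by rewrite telescope_sumr// subrKC.
rewrite (le_trans (ler_normD _ _))// lerD//.
  by rewrite /y1 (bigD1 i)//= lerDl sumr_ge0.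
apply: le_trans (ler_norm_sum _ _ _) _.
apply: (@le_trans _ _ (\sum_(0 <= k < n) C * exp_coeff (int0 a x) k)).
  apply: ler_sum => k _; apply: le_trans (HC k x xb).
  by rewrite (bigD1 i)//= lerDl sumr_ge0.
rewrite -mulr_sumr ler_wpM2l//.
apply: (@le_trans _ _ (expR (int0 a x))); last by rewrite ler_expR.
apply: (@nondecreasing_cvgn_le _ (series (exp_coeff (int0 a x)))).
  by apply: nondecreasing_series => k _ _; exact: exp_coeff_ge0.
exact: is_cvg_series_exp_coeff.
Qed.

Let picard_cvg i x : 0 <= x -> cvgn (fun n => Y n i x).
Proof.
move=> x0; have [C C0 HC] := picard_diff x.
have A0 : 0 <= int0 a x by exact: int0_ge0.
have -> : (fun n => Y n i x) = cst (Y 0 i x) \+ series (telescope (fun n => Y n i x)).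
  by apply/funext => n /=; rewrite [LHS](eq_sum_telescope (fun n => Y n i x)).
apply: is_cvgD; first exact: is_cvg_cst.
apply: normed_cvg.
apply: (@series_le_cvg _ _ (fun n => C * exp_coeff (int0 a x) n)) => [n|n|n|].
- exact: normr_ge0.
- by apply: mulr_ge0 => //; exact: exp_coeff_ge0.
- have := HC n x; rewrite x0 lexx => /(_ isT); apply: le_trans.
  by rewrite (bigD1 i)//= lerDl sumr_ge0.
- apply: is_cvg_seriesZ; exact: is_cvg_series_exp_coeff.
Qed.

(** The Picard iterates converge pointwise, and dominated convergence passes to the limit in the
    integral equation, which is all that [primitive] asks for. *)
Lemma linear_ivp : exists y : 'I_d -> R -> R, (forall i, y i 0 = y0 i) /\
  forall i, primitive (y i) (linear_rhs M F y i).
Proof.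
pose y i x := limn (fun n => Y n i x).
have yc i x : 0 <= x -> Y n i x @[n --> \oo] --> y i x by move=> x0; exact: picard_cvg.
have rc i x : 0 <= x -> linear_rhs M F (Y n) i x @[n --> \oo] --> linear_rhs M F y i x.
  move=> x0; apply: cvgD; last exact: cvg_cst.
  have H (r : seq 'I_d) : \sum_(k <- r) Y n k x * M i k x @[n --> \oo] -->
      \sum_(k <- r) y k x * M i k x.
    elim: r => [|k r IH].
      by under eq_fun do rewrite big_nil; rewrite big_nil; exact: cvg_cst.
    under eq_fun do rewrite big_cons; rewrite big_cons.
    by apply: cvgD => //; apply: cvgM; [exact: yc|exact: cvg_cst].
  exact: H.
have mr n i b : measurable_fun `[0, b] (linear_rhs M F (Y n) i).
  have /integrableP[/measurable_EFinP] : mu.-integrable `[0, b] (EFin \o linear_rhs M F (Y n) i).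
    by apply: locint_rhs => k; exact: contp_picard.
  by [].
have dom i b : mu.-integrable `[0, b] (EFin \o linear_rhs M F y i) /\
    int0 (linear_rhs M F (Y n) i) b @[n --> \oo] --> int0 (linear_rhs M F y i) b.
  have [K K0 HK] := picard_bound b.
  have lg : locint (fun t => K * (\sum_(k < d) `|M i k t|) + `|F i t|).
    apply: locintD; last exact: locint_norm.
    by apply: locintZ; apply: locint_sum => k; exact: locint_norm.
  have [] := @dominated_convergence _ _ R mu `[0, b] (measurable_itv _)
    (fun n => EFin \o linear_rhs M F (Y n) i) (EFin \o linear_rhs M F y i)
    (EFin \o (fun t => K * (\sum_(k < d) `|M i k t|) + `|F i t|)).
  - by move=> n; apply/measurable_EFinP; exact: mr.
  - apply/measurable_EFinP.
    apply: (@measurable_fun_cvg _ _ _ _ (fun n => linear_rhs M F (Y n) i)) => //.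
    by move=> x /=; rewrite in_itv/= => /andP[x0 _]; exact: rc.
  - apply: aeW => x /=; rewrite in_itv/= => /andP[x0 _].
    by apply/fine_cvgP; split; [apply: nearW|exact: rc].
  - exact: lg.
  - apply: aeW => x n /=; rewrite in_itv/= => xb; rewrite lee_fin.
    rewrite /linear_rhs (le_trans (ler_normD _ _))// lerD2r.
    rewrite mulr_sumr (le_trans (ler_norm_sum _ _ _))//; apply: ler_sum => k _.
    by rewrite normrM ler_wpM2r// HK.
  move=> h1 _ h2; split => //.
  rewrite /int0 /Rintegral; apply: fine_cvg.
  rewrite fineK; last exact: integrable_fin_num.
  exact: h2.
exists y; split.
  move=> i; apply/cvg_lim => //; rewrite -(cvg_shiftS).
  apply: cvg_near_cst; near=> n; by rewrite /= int0_0 addr0.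
move=> i; split; first by move=> b; have [] := dom i b.
move=> x x0.
have : Y n.+1 i x @[n --> \oo] --> y0 i + int0 (linear_rhs M F y i) x.
  by apply: cvgD; [exact: cvg_cst|have [] := dom i x].
have y00 : y i 0 = y0 i.
  apply/cvg_lim => //; rewrite -(cvg_shiftS).
  by apply: cvg_near_cst; near=> n; rewrite /= int0_0 addr0.
rewrite y00 (cvg_shiftS (fun n => Y n i x)) => h.
exact: (cvg_unique _ (yc i x x0) h).
Unshelve. all: by end_near. Qed.

End LinearSystem.

(** * The Schroedinger equation on one link *)

Section ComplexSchrodinger.
Variable R : realType.
Implicit Types (A B f g F : R -> R) (a b c x y : R) (l : \bar R).
Local Notation mu := (@lebesgue_measure R).

Record jet := Jet { re0 : R -> R; im0 : R -> R; re1 : R -> R; im1 : R -> R }.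

Implicit Types (u v : jet).

(* With u = re0 + i im0 and p = re1 + i im1, this is the first-order form
   u' = p, p' = (A - i B) u - (f1 + i f2). *)
Definition jet_sol A B f1 f2 u : Prop :=
  [/\ primitive (re0 u) (re1 u), primitive (im0 u) (im1 u),
      primitive (re1 u) (fun x => A x * re0 u x + B x * im0 u x - f1 x)
    & primitive (im1 u) (fun x => A x * im0 u x - B x * re0 u x - f2 x)].

Definition normsq u x : R := re0 u x ^+ 2 + im0 u x ^+ 2.

(** The complex combination u + (c1 + i c2) v in real coordinates. *)
Definition jet_addZ u c1 c2 v : jet :=
  Jet (fun x => re0 u x + (c1 * re0 v x - c2 * im0 v x))
      (fun x => im0 u x + (c1 * im0 v x + c2 * re0 v x))
      (fun x => re1 u x + (c1 * re1 v x - c2 * im1 v x))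
      (fun x => im1 u x + (c1 * im1 v x + c2 * re1 v x)).

Lemma jet_sol_addZ A B f1 f2 u c1 c2 v :
  jet_sol A B f1 f2 u -> jet_sol A B (cst 0) (cst 0) v ->
  jet_sol A B f1 f2 (jet_addZ u c1 c2 v).
Proof.
case=> u1 u2 u3 u4 [v1 v2 v3 v4]; split => /=.
- exact: primitiveD u1 (primitiveB (primitiveZ c1 v1) (primitiveZ c2 v2)).
- exact: primitiveD u2 (primitiveD (primitiveZ c1 v2) (primitiveZ c2 v1)).
- apply: eq_primitive (primitiveD u3 (primitiveB (primitiveZ c1 v3) (primitiveZ c2 v4))) _.
  by move=> x /=; ring.
- apply: eq_primitive (primitiveD u4 (primitiveD (primitiveZ c1 v4) (primitiveZ c2 v3))) _.
  by move=> x /=; ring.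
Qed.

Lemma jet_ivp A B f1 f2 a1 a2 b1 b2 :
  locint A -> locint B -> locint f1 -> locint f2 ->
  exists u, [/\ jet_sol A B f1 f2 u, re0 u 0 = a1, im0 u 0 = a2, re1 u 0 = b1
    & im1 u 0 = b2].
Proof.
move=> lA lB lf1 lf2.
(* The unknowns are ordered [re0], [im0], [re1], [im1]. *)
pose M (i k : 'I_4) : R -> R := match val i, val k with
  | 0, 2 => cst 1 | 1, 3 => cst 1 | 2, 0 => A | 2, 1 => B
  | 3, 0 => fun x => - B x | 3, 1 => A | _, _ => cst 0 end.
pose F (i : 'I_4) : R -> R := match val i with
  | 2 => fun x => - f1 x | 3 => fun x => - f2 x | _ => cst 0 end.
pose y0 (i : 'I_4) : R := match val i with
  | 0 => a1 | 1 => a2 | 2 => b1 | _ => b2 end.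
have lM i k : locint (M i k).
  rewrite /M; case: i k => [[|[|[|[|i]]]] ip] [[|[|[|[|k]]]] kp] //=;
    by [exact: locint_cst|exact: locintN].
have lF i : locint (F i).
  by rewrite /F; case: i => [[|[|[|[|i]]]] ip] //=; [exact: locint_cst..|exact: locintN|exact: locintN].
have [y [yy0 py]] := linear_ivp y0 lM lF.
pose o0 : 'I_4 := @Ordinal 4 0 isT; pose o1 : 'I_4 := @Ordinal 4 1 isT.
pose o2 : 'I_4 := @Ordinal 4 2 isT; pose o3 : 'I_4 := @Ordinal 4 3 isT.
have S (G : 'I_4 -> R) : \sum_(k < 4) G k = G o0 + G o1 + G o2 + G o3.
  rewrite !big_ord_recl big_ord0 addr0 !addrA.
  by congr (_ + _ + _ + _); congr (G _); apply: val_inj.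
exists (Jet (y o0) (y o1) (y o2) (y o3)); split; rewrite /= ?yy0//.
split => /=.
- apply: eq_primitive (py o0) _ => x; rewrite /linear_rhs S /M /F /=; ring.
- apply: eq_primitive (py o1) _ => x; rewrite /linear_rhs S /M /F /=; ring.
- apply: eq_primitive (py o2) _ => x; rewrite /linear_rhs S /M /F /=; ring.
- apply: eq_primitive (py o3) _ => x; rewrite /linear_rhs S /M /F /=; ring.
Qed.

(* wronsk u = Im (u' conj(u)). *)
Definition wronsk u x : R := im1 u x * re0 u x - re1 u x * im0 u x.

(** In the imaginary part of (u' conj(u))' the terms |u'|^2 and A |u|^2, being real, drop out; only
    B and the source remain. *)
Lemma primitive_wronsk A B f1 f2 u : jet_sol A B f1 f2 u ->
  primitive (wronsk u) (fun x => im0 u x * f1 x - re0 u x * f2 x - B x * normsq u x).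
Proof.
case=> u1 u2 u3 u4.
apply: eq_primitive (primitiveB (primitiveM u4 u1) (primitiveM u3 u2)) _.
by move=> x; rewrite /normsq; ring.
Qed.

Lemma contp_jet A B f1 f2 u : jet_sol A B f1 f2 u ->
  [/\ contp (re0 u), contp (im0 u), contp (re1 u) & contp (im1 u)].
Proof. by case=> *; split; apply: primitive_contp; eassumption. Qed.

Lemma contpM F g : contp F -> contp g -> contp (fun x => F x * g x).
Proof. by move=> cF cg b x; apply: cvgM; [exact: cF|exact: cg]. Qed.

Lemma contp_normsq A B f1 f2 u : jet_sol A B f1 f2 u -> contp (normsq u).
Proof. by move/contp_jet => [c1 c2 _ _]; apply: contpD; apply: contpM. Qed.

Lemma normsq_ge0 u x : 0 <= normsq u x.
Proof. by rewrite addr_ge0 ?sqr_ge0. Qed.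

Lemma int0_eq0 g b : contp g -> (forall x, 0 < x -> 0 <= g x) -> int0 g b <= 0 ->
  forall x, 0 < x < b -> g x = 0.
Proof.
move=> cg g0 gb x /andP[x0 xb].
have lg := contp_locint cg.
have G0 y : 0 <= y <= b -> int0 g y = 0.
  move=> /andP[y0 yb]; apply/eqP; rewrite eq_le; apply/andP; split.
    by apply: le_trans gb; apply: int0_nd => //; rewrite y0.
  by rewrite -(int0_0 g); apply: int0_nd => //; rewrite lexx.
have D1 := primitive_derive (primitive_int0 lg) cg x0.
have D2 : is_derive x (1 : R) (int0 g) 0.
  apply: near_eq_is_derive (is_derive_cst (0 : R) x 1).
  near=> y; rewrite G0//; apply/andP; split; apply: ltW; near: y.
    exact: lt_nbhsr.
  exact: lt_nbhsl.
by have := @derive_val _ _ _ _ _ _ _ D1; rewrite (@derive_val _ _ _ _ _ _ _ D2).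
Unshelve. all: by end_near. Qed.

Lemma primitive_eq0 F g b : primitive F g -> contp g -> 0 < b ->
  (forall x, 0 < x < b -> F x = 0) -> g 0 = 0.
Proof.
move=> pF cg b0 F0.
have g0 x : 0 < x < b -> g x = 0.
  move=> /andP[x0 xb].
  have D1 := primitive_derive pF cg x0.
  have D2 : is_derive x (1 : R) F 0.
    apply: near_eq_is_derive (is_derive_cst (0 : R) x 1).
    near=> y; rewrite F0//; apply/andP; split; near: y.
      exact: lt_nbhsr.
    exact: lt_nbhsl.
  by have := @derive_val _ _ _ _ _ _ _ D1; rewrite (@derive_val _ _ _ _ _ _ _ D2).
have h1 := contp_cvg0 cg.
have h2 : g x @[x --> 0^'+] --> (0 : R).
  apply: cvg_near_cst; near=> x; apply: g0.
  by apply/andP; split; near: x; [exact: nbhs_right_gt|exact: nbhs_right_lt].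
exact: (cvg_unique _ h1 h2).
Unshelve. all: by end_near. Qed.

Definition bc_re (om : R) u b := re0 u b * cos om + re1 u b * sin om.
Definition bc_im (om : R) u b := im0 u b * cos om + im1 u b * sin om.

(** The plane vectors (re0, re1) and (im0, im1) are both orthogonal to the unit vector (cos, sin),
    so their determinant vanishes. *)
Lemma wronsk_bc om u b : bc_re om u b = 0 -> bc_im om u b = 0 -> wronsk u b = 0.
Proof.
rewrite /bc_re /bc_im /wronsk => h1 h2.
have := cos2Dsin2 om; move: (cos om) (sin om) h1 h2 => c s h1 h2 cs.
rewrite -[LHS]mul1r -cs.
have -> : (c ^+ 2 + s ^+ 2) * (im1 u b * re0 u b - re1 u b * im0 u b) =
  (re0 u b * c + re1 u b * s) * (c * im1 u b - s * im0 u b) -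
  (im0 u b * c + im1 u b * s) * (c * re1 u b - s * re0 u b) by ring.
by rewrite h1 h2 !mul0r subrr.
Qed.

(** The admissible upper ends of integrals over a link. The end b = l of a finite link is included,
    where the boundary condition applies. *)
Definition upto l b : Prop := 0 < b /\ (b%:E <= l)%E.

(** In applications beta is Im z, of either sign; multiplying the identity for the imaginary part by
    [sg] treats both half-planes at once. *)
Lemma sign_witness (beta : R) : exists sg : R, sg ^+ 2 = 1 /\ sg * beta = `|beta|.
Proof.
have [b0|b0] := leP 0 beta.
  by exists 1; rewrite expr1n mul1r ger0_norm.
by exists (-1); rewrite sqrrN expr1n mulN1r ltr0_norm.
Qed.

(** Integrated form of [primitive_wronsk]: half of |beta| |u|^2 absorbs the source term by AM-GM.
    The difference of the two integrands is a sum of two squares, divided by 2 |beta|. *)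
Lemma normsq_estimate A B f1 f2 u b (beta sg : R) :
  jet_sol A B f1 f2 u -> (forall x, 0 < x < b -> B x = beta) -> 0 <= b ->
  locint (fun x => f1 x ^+ 2 + f2 x ^+ 2) ->
  beta != 0 -> sg ^+ 2 = 1 -> sg * beta = `|beta| ->
  `|beta| / 2 * int0 (normsq u) b <= sg * (wronsk u 0 - wronsk u b) +
    (2 * `|beta|)^-1 * int0 (fun x => f1 x ^+ 2 + f2 x ^+ 2) b.
Proof.
move=> su Bb b0 lf beta0 sg2 sgb.
have [lk kE] := primitive_wronsk su.
have m0 : 0 < `|beta| by rewrite normr_gt0.
have ln : locint (normsq u) := contp_locint (contp_normsq su).
have -> : sg * (wronsk u 0 - wronsk u b) = - int0 (fun x => sg * (im0 u x * f1 x - re0 u x * f2 x - B x * normsq u x)) b.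
  by rewrite int0Z// (kE b)//; ring.
rewrite -!int0Z// -int0N; last exact: locintZ.
rewrite -int0D; [|exact/locintN/locintZ|exact: locintZ].
apply: le_int0; [exact: locintZ|apply: locintD; [exact/locintN/locintZ|exact: locintZ]|].
move=> x xb; rewrite Bb//.
have -> : sg * (im0 u x * f1 x - re0 u x * f2 x - beta * normsq u x) =
   sg * (im0 u x * f1 x - re0 u x * f2 x) - `|beta| * normsq u x by rewrite -sgb; ring.
move: m0; rewrite /normsq; move: `|beta| (re0 u x) (im0 u x) (f1 x) (f2 x) => m r i g1 g2 m0.
rewrite -subr_ge0.
have -> : - (sg * (i * g1 - r * g2) - m * (r ^+ 2 + i ^+ 2)) + (2 * m)^-1 * (g1 ^+ 2 + g2 ^+ 2) -
    m / 2 * (r ^+ 2 + i ^+ 2) = (2 * m)^-1 * ((g1 - m * sg * i) ^+ 2 + (g2 + m * sg * r) ^+ 2).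
  have -> : (g1 - m * sg * i) ^+ 2 + (g2 + m * sg * r) ^+ 2 =
     g1 ^+ 2 + g2 ^+ 2 - 2 * m * sg * (i * g1 - r * g2) + m ^+ 2 * sg ^+ 2 * (r ^+ 2 + i ^+ 2) by ring.
  by rewrite sg2; field; lra.
by rewrite mulr_ge0 ?addr_ge0 ?sqr_ge0// invr_ge0; lra.
Qed.

Lemma normsq_addZ u c1 c2 v x : normsq (jet_addZ u c1 c2 v) x =
  normsq u x + (c1 ^+ 2 + c2 ^+ 2) * normsq v x
  + (c1 * (2 * (re0 u x * re0 v x + im0 u x * im0 v x))
  + c2 * (2 * (im0 u x * re0 v x - re0 u x * im0 v x))).
Proof. by rewrite /normsq /=; ring. Qed.

(** * Square integrable solutions on one link *)

Section LinkSolution.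
Variables (l : \bar R) (A B f1 f2 : R -> R) (beta c1 c2 F0 : R).
Hypotheses (l0 : (0 < l)%E) (lA : locint A) (lB : locint B)
  (lf1 : locint f1) (lf2 : locint f2)
  (Bl : forall x, 0 < x -> (x%:E < l)%E -> B x = beta) (beta0 : beta != 0)
  (lf : locint (fun x => f1 x ^+ 2 + f2 x ^+ 2))
  (fF : forall b, upto l b -> int0 (fun x => f1 x ^+ 2 + f2 x ^+ 2) b <= F0).

Let Bb b : upto l b -> forall x, 0 < x < b -> B x = beta.
Proof.
move=> [b0 bl] x /andP[x0 xb]; apply: Bl => //.
by rewrite (lt_le_trans _ bl)// lte_fin.
Qed.

Let dirichlet_pos v b : jet_sol A B (cst 0) (cst 0) v ->
  re0 v 0 = 0 -> im0 v 0 = 0 -> re1 v 0 = 1 -> upto l b -> 0 < int0 (normsq v) b.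
Proof.
move=> sv v1 v2 v3 lb; rewrite ltNge; apply/negP => v0.
have vb0 := int0_eq0 (contp_normsq sv) (fun x _ => normsq_ge0 v x) v0.
have [_ _ c3 _] := contp_jet sv.
have [p1 _ _ _] := sv.
have : re1 v 0 = 0.
  apply: (primitive_eq0 p1 c3 lb.1) => x xb.
  have := vb0 x xb; rewrite /normsq => /eqP; rewrite paddr_eq0 ?sqr_ge0//.
  by rewrite !sqrf_eq0 => /andP[/eqP].
by rewrite v3; apply/eqP; rewrite oner_eq0.
Qed.

(** Were the boundary values of [v] zero, [v] would satisfy conditions at both ends and be an
    eigenfunction of a selfadjoint problem with a non-real eigenvalue: its Wronskian term vanishes
    at 0 and b, and [normsq_estimate] contradicts [dirichlet_pos]. *)
Let bc_solvable u v b om : jet_sol A B (cst 0) (cst 0) v ->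
  re0 v 0 = 0 -> im0 v 0 = 0 -> re1 v 0 = 1 -> upto l b ->
  exists s1 s2, bc_re om (jet_addZ u s1 s2 v) b = 0 /\ bc_im om (jet_addZ u s1 s2 v) b = 0.
Proof.
move=> sv v1 v2 v3 lb.
set X := bc_re om v b; set Y := bc_im om v b.
have XY : X ^+ 2 + Y ^+ 2 != 0.
  apply/negP; rewrite paddr_eq0 ?sqr_ge0// !sqrf_eq0 => /andP[/eqP X0 /eqP Y0].
  have [sg [sg2 sgb]] := sign_witness beta.
  have b0 : 0 <= b by case: lb => /ltW.
  have l00 : locint (fun x => (cst 0 x : R) ^+ 2 + (cst 0 x : R) ^+ 2).
    by apply: eq_locint (@locint_cst R 0) => x _ /=; rewrite expr0n addr0.
  have := normsq_estimate sv (Bb lb) b0 l00 beta0 sg2 sgb.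
  rewrite (wronsk_bc X0 Y0) /wronsk v1 v2 !mulr0 subrr subrr mulr0 add0r.
  rewrite [X in (2 * _)^-1 * X](_ : _ = 0); last first.
    transitivity (int0 (cst 0) b); last by rewrite int0_cst// mul0r.
    apply: eq_int0 => //; last exact: locint_cst.
    by move=> x _ /=; rewrite expr0n addr0.
  rewrite mulr0 pmulr_rle0; last by rewrite divr_gt0// normr_gt0.
  by rewrite leNgt dirichlet_pos.
set r := bc_re om u b; set i := bc_im om u b.
(* Real and imaginary part of minus the quotient of the complex boundary values of [u] and [v]. *)
exists (- (r * X + i * Y) / (X ^+ 2 + Y ^+ 2)), ((r * Y - i * X) / (X ^+ 2 + Y ^+ 2)).
have E1 s1 s2 : bc_re om (jet_addZ u s1 s2 v) b = r + (s1 * X - s2 * Y).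
  by rewrite /r /X /Y /bc_re /bc_im /=; ring.
have E2 s1 s2 : bc_im om (jet_addZ u s1 s2 v) b = i + (s1 * Y + s2 * X).
  by rewrite /i /X /Y /bc_re /bc_im /=; ring.
by rewrite E1 E2; split; field.
Qed.

(** The substance of Weyl's nested circles. By [normsq_estimate] the squared norm of u + s v on (0,
    b) grows at most linearly in |s|; already on (0, b0) it grows quadratically, as [v] has positive
    mass there. Hence |s| is bounded independently of b. *)
Let bc_bounds u v b0 : jet_sol A B f1 f2 u -> re0 u 0 = c1 -> im0 u 0 = c2 ->
  re1 u 0 = 0 -> im1 u 0 = 0 ->
  jet_sol A B (cst 0) (cst 0) v -> re0 v 0 = 0 -> im0 v 0 = 0 -> re1 v 0 = 1 ->
  im1 v 0 = 0 -> upto l b0 ->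
  exists S X, forall s1 s2 b om, b0 <= b -> upto l b ->
    bc_re om (jet_addZ u s1 s2 v) b = 0 -> bc_im om (jet_addZ u s1 s2 v) b = 0 ->
    [/\ `|s1| <= S, `|s2| <= S & int0 (normsq (jet_addZ u s1 s2 v)) b <= X].
Proof.
move=> su u1 u2 u3 u4 sv v1 v2 v3 v4 lb0.
set T := int0 (normsq v) b0.
have T0 : 0 < T by exact: dirichlet_pos.
set U0 := int0 (normsq u) b0.
have m0 : 0 < `|beta| by rewrite normr_gt0.
pose m := `|beta|.
(* [K] is the contribution of the source to the squared norm, [Q] the bound on |s|^2 after half of T
   |s|^2 is absorbed, and [X] the resulting bound on the squared norm. Only [b0] enters, through [T]
   and [U0]. *)
pose K := F0 / m ^+ 2.
pose Q := (8 / (T * m ^+ 2) * (c1 ^+ 2 + c2 ^+ 2) + 2 * K + 2 * U0) * 2 / T.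
pose X := 2 / m * (Q + (c1 ^+ 2 + c2 ^+ 2)) + K.
exists (Q + 1), X => s1 s2 b om b0b lb h1 h2.
set w := jet_addZ u s1 s2 v.
have sw : jet_sol A B f1 f2 w by exact: jet_sol_addZ.
have b00 : 0 <= b by case: lb => /ltW.
have [sg [sg2 sgb]] := sign_witness beta.
have est := normsq_estimate sw (Bb lb) b00 lf beta0 sg2 sgb.
rewrite (wronsk_bc h1 h2) subr0 in est.
have W0 : wronsk w 0 = s2 * c1 - s1 * c2.
  by rewrite /wronsk /w /= u1 u2 u3 u4 v1 v2 v3 v4; ring.
have lw : locint (normsq w) := contp_locint (contp_normsq sw).
have lv : locint (normsq v) := contp_locint (contp_normsq sv).
have lu : locint (normsq u) := contp_locint (contp_normsq su).
have Fb := fF lb.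
set N := int0 (normsq w) b in est *.
have hN : m / 2 * N <= sg * (s2 * c1 - s1 * c2) + (2 * m)^-1 * F0.
  rewrite -W0; apply: (le_trans est); rewrite lerD2l ler_wpM2l// invr_ge0; lra.
have hT : (s1 ^+ 2 + s2 ^+ 2) * T <= 2 * N + 2 * U0.
  have wb : int0 (normsq w) b0 <= N.
    by apply: int0_nd => //; [move=> t _; exact: normsq_ge0|case: lb0; lra].
  apply: (@le_trans _ _ (2 * int0 (normsq w) b0 + 2 * U0)); last by lra.
  rewrite /T /U0 -!int0Z// -int0D; [|exact: locintZ..].
  apply: le_int0; [exact: locintZ|by apply: locintD; exact: locintZ|].
  move=> x _; rewrite /w normsq_addZ /normsq.
  move: (re0 u x) (im0 u x) (re0 v x) (im0 v x) => r i r' i'.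
  rewrite -subr_ge0.
  have -> : 2 * (r ^+ 2 + i ^+ 2 + (s1 ^+ 2 + s2 ^+ 2) * (r' ^+ 2 + i' ^+ 2) +
     (s1 * (2 * (r * r' + i * i')) + s2 * (2 * (i * r' - r * i')))) +
     2 * (r ^+ 2 + i ^+ 2) - (s1 ^+ 2 + s2 ^+ 2) * (r' ^+ 2 + i' ^+ 2) =
    (2 * r + (s1 * r' - s2 * i')) ^+ 2 + (2 * i + (s1 * i' + s2 * r')) ^+ 2 by ring.
  by rewrite addr_ge0 ?sqr_ge0.
(* AM-GM absorbs the linear term [sg * wronsk w 0] into [|s|^2 T / 2]. *)
have amgm : 2 * (2 / m) * (sg * (s2 * c1 - s1 * c2)) <=
    T / 2 * (s1 ^+ 2 + s2 ^+ 2) + 8 / (T * m ^+ 2) * (c1 ^+ 2 + c2 ^+ 2).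
  rewrite -subr_ge0.
  have -> : T / 2 * (s1 ^+ 2 + s2 ^+ 2) + 8 / (T * m ^+ 2) * (c1 ^+ 2 + c2 ^+ 2) -
     2 * (2 / m) * (sg * (s2 * c1 - s1 * c2)) =
     T / 2 * ((s2 - 4 / (m * T) * (sg * c1)) ^+ 2 + (s1 + 4 / (m * T) * (sg * c2)) ^+ 2).
    have -> : (s2 - 4 / (m * T) * (sg * c1)) ^+ 2 + (s1 + 4 / (m * T) * (sg * c2)) ^+ 2 =
      s1 ^+ 2 + s2 ^+ 2 - 8 / (m * T) * (sg * (s2 * c1 - s1 * c2)) +
      (4 / (m * T)) ^+ 2 * sg ^+ 2 * (c1 ^+ 2 + c2 ^+ 2) by ring.
    by rewrite sg2; field; rewrite !gt_eqF.
  by rewrite mulr_ge0 ?addr_ge0 ?sqr_ge0// divr_ge0// ltW.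
have hN2 : N <= 2 / m * (sg * (s2 * c1 - s1 * c2)) + K.
  rewrite -(ler_pM2l (_ : 0 < m / 2)); last by rewrite divr_gt0.
  apply: (le_trans hN); rewrite le_eqVlt; apply/orP; left; apply/eqP.
  by rewrite /K; field; rewrite gt_eqF.
have sQ : s1 ^+ 2 + s2 ^+ 2 <= Q.
  have : T / 2 * (s1 ^+ 2 + s2 ^+ 2) <= 8 / (T * m ^+ 2) * (c1 ^+ 2 + c2 ^+ 2) + 2 * K + 2 * U0 by lra.
  by rewrite /Q ler_pdivlMr//; lra.
have sq_le (s : R) : s ^+ 2 <= Q -> `|s| <= Q + 1.
  rewrite -(real_normK (num_real s)) => sQ1.
  have := sqr_ge0 (`|s| - 1); have := normr_ge0 s; nra.
have s1Q : s1 ^+ 2 <= Q by have := sqr_ge0 s2; lra.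
have s2Q : s2 ^+ 2 <= Q by have := sqr_ge0 s1; lra.
split; [exact: sq_le|exact: sq_le|].
apply: (le_trans hN2); rewrite lerD2r ler_wpM2l//; first by rewrite divr_ge0// ltW.
have := sqr_ge0 (s2 - sg * c1); have := sqr_ge0 (s1 + sg * c2).
have -> : (s2 - sg * c1) ^+ 2 = s2 ^+ 2 - 2 * (sg * (s2 * c1)) + sg ^+ 2 * c1 ^+ 2 by ring.
have -> : (s1 + sg * c2) ^+ 2 = s1 ^+ 2 + 2 * (sg * (s1 * c2)) + sg ^+ 2 * c2 ^+ 2 by ring.
rewrite sg2 mulrBr; have := sqr_ge0 c1; have := sqr_ge0 c2.
have := sqr_ge0 s1; have := sqr_ge0 s2; lra.
Qed.

(* On an infinite link the bounds on (0, n) do not depend on n, so a cluster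
   point of the coefficients of the solutions on (0, n) remains bounded. *)
Lemma link_solution om : exists u,
  [/\ jet_sol A B f1 f2 u, re0 u 0 = c1, im0 u 0 = c2,
      forall b, l = b%:E -> bc_re om u b = 0 /\ bc_im om u b = 0
    & exists X, forall b, upto l b -> int0 (normsq u) b <= X].
Proof.
have [u [su u1 u2 u3 u4]] := jet_ivp c1 c2 0 0 lA lB lf1 lf2.
have [v [sv v1 v2 v3 v4]] := jet_ivp 0 0 1 0 lA lB (@locint_cst R 0) (@locint_cst R 0).
have addZ0 s1 s2 : re0 (jet_addZ u s1 s2 v) 0 = c1 /\ im0 (jet_addZ u s1 s2 v) 0 = c2.
  by rewrite /= u1 u2 v1 v2; split; ring.
have mon w b b' : jet_sol A B f1 f2 w -> 0 <= b <= b' -> int0 (normsq w) b <= int0 (normsq w) b'.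
  move=> sw bb; apply: int0_nd => //; first exact: contp_locint (contp_normsq sw).
  by move=> t _; exact: normsq_ge0.
have [[b0 lE]|lE] : (exists b0 : R, l = b0%:E) \/ l = +oo%E.
  by case: l l0 => [b0|_|//]; [left; exists b0|right].
- have lb0 : upto l b0 by split; [move: l0; rewrite lE lte_fin|rewrite lE].
  have [s1 [s2 [h1 h2]]] := bc_solvable u om sv v1 v2 v3 lb0.
  have [S [X HX]] := bc_bounds su u1 u2 u3 u4 sv v1 v2 v3 v4 lb0.
  have [_ _ HN] := HX _ _ _ _ (lexx _) lb0 h1 h2.
  exists (jet_addZ u s1 s2 v); have [a1 a2] := addZ0 s1 s2.
  split => //; first exact: jet_sol_addZ.
    by move=> b; rewrite lE => -[<-].
  exists X => b [bp]; rewrite lE lee_fin => bb0; apply: le_trans HN.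
  by apply: mon; [exact: jet_sol_addZ|rewrite (ltW bp)].
have up (b : R) : 0 < b -> upto l b by move=> h; split => //; rewrite lE leey.
have [S [X HX]] := bc_bounds su u1 u2 u3 u4 sv v1 v2 v3 v4 (up 1 ltr01).
have /choice[s Hs] : forall n : nat, exists s : R * R, [/\ `|s.1| <= S, `|s.2| <= S &
    int0 (normsq (jet_addZ u s.1 s.2 v)) n.+1%:R <= X].
  (* The angle 0 is a Dirichlet condition at the artificial end n + 1. *)
  move=> n; have [s1 [s2 [h1 h2]]] := bc_solvable u 0 sv v1 v2 v3 (up _ (ltr0Sn _ n)).
  exists (s1, s2); apply: (HX _ _ _ 0) => //; last exact: up.
  by rewrite ler1n.
have cK : compact (`[- S, S]%classic `*` `[- S, S]%classic : set (R * R)).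
  by apply: compact_setX; exact: segment_compact.
have [|p [_ clp]] := cK (s @ \oo) _.
  by exists 0%N => // n _; have [h1 h2 _] := Hs n; split; rewrite /= in_itv/= -ler_norml.
exists (jet_addZ u p.1 p.2 v); have [a1 a2] := addZ0 p.1 p.2.
have lu : locint (normsq u) := contp_locint (contp_normsq su).
have lv : locint (normsq v) := contp_locint (contp_normsq sv).
split => //; first exact: jet_sol_addZ.
  by move=> b; rewrite lE.
exists X => b [b0 _].
have [cu1 cu2 _ _] := contp_jet su; have [cv1 cv2 _ _] := contp_jet sv.
pose g1 x := 2 * (re0 u x * re0 v x + im0 u x * im0 v x).
pose g2 x := 2 * (im0 u x * re0 v x - re0 u x * im0 v x).
have lg1 : locint g1 by apply: locintZ; apply: locintD; apply: contp_locint; exact: contpM.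
have lg2 : locint g2 by apply: locintZ; apply: locintB; apply: contp_locint; exact: contpM.
(* For fixed b the squared norm of u + s v on (0, b) is a quadratic polynomial in s. It is at most
   [X] along the sequence as soon as n exceeds b, hence also at the cluster point. *)
pose q (s : R * R) := int0 (normsq u) b + (s.1 * s.1 + s.2 * s.2) * int0 (normsq v) b
  + (s.1 * int0 g1 b + s.2 * int0 g2 b).
have qE t : int0 (normsq (jet_addZ u t.1 t.2 v)) b = q t.
  have lz c (h : R -> R) : locint h -> locint (fun x => c * h x) by exact: locintZ.
  rewrite (_ : normsq _ = (fun x => (normsq u x + (t.1 ^+ 2 + t.2 ^+ 2) * normsq v x)
      + (t.1 * g1 x + t.2 * g2 x))); last by apply/funext => x; exact: normsq_addZ.
  rewrite int0D; [|by apply: locintD => //; exact: lz|by apply: locintD; exact: lz].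
  by rewrite (int0D _ lu (lz _ _ lv)) (int0D _ (lz _ _ lg1) (lz _ _ lg2)) (int0Z _ _ lv) (int0Z _ _ lg1) (int0Z _ _ lg2).
have cq : continuous q.
  move=> t'; have c1' : (fun s : R * R => s.1) s @[s --> t'] --> t'.1 by exact: cvg_fst.
  have c2' : (fun s : R * R => s.2) s @[s --> t'] --> t'.2 by exact: cvg_snd.
  apply: cvgD; last first.
    by apply: cvgD; apply: cvgMl.
  apply: cvgD; first exact: cvg_cst.
  by apply: cvgMl; apply: cvgD; apply: cvgM.
rewrite qE leNgt; apply/negP => Xq.
have nq : nbhs p [set t | X < q t] by exact: (@cvgr_gt _ _ _ _ _ _ (cq p) _ Xq).
have [|t [/= h1 h2]] := clp [set t | q t <= X] _ _ nq; last by move: h2; rewrite ltNge h1.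
suff : \forall n \near \oo, q (s n) <= X by [].
near=> n; have [_ _ hX] := Hs n; rewrite /= -qE; apply: le_trans hX.
apply: mon; first exact: jet_sol_addZ.
rewrite (ltW b0)/= ltW//.
apply: (@le_lt_trans _ _ n%:R); last by rewrite ltr_nat.
by near: n; exact: nbhs_infty_ger.
Unshelve. all: by end_near. Qed.

End LinkSolution.

End ComplexSchrodinger.

(** * Energy estimates *)

Section WeightedEstimates.
Variable R : realType.
Implicit Types (A B f g v F : R -> R) (a b c m x y n : R) (l : \bar R) (u : jet R).
Local Notation mu := (@lebesgue_measure R).

(** The square v(x)^2 exceeds v(y)^2 by at most the integral of |2 v v'|. Averaging over y in (0, b)
    gives the term with b^-1, and AM-GM with parameter d splits the product. *)
Lemma trace_inequality v v' b (d : R) x : primitive v v' -> contp v' -> 0 < b -> 0 < d ->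
  0 <= x <= b ->
  v x ^+ 2 <= d * int0 (fun t => v' t ^+ 2) b + (d^-1 + b^-1) * int0 (fun t => v t ^+ 2) b.
Proof.
move=> pv cv' b0 d0 xb.
have cv := primitive_contp pv.
have lv2 : locint (fun t => v t ^+ 2) by apply: contp_locint; exact: contpM.
have lv'2 : locint (fun t => v' t ^+ 2) by apply: contp_locint; exact: contpM.
pose g t := v t * v' t + v t * v' t.
have pG : primitive (fun t => v t ^+ 2) g by exact: (primitiveM pv pv).
have lg : locint g by case: pG.
set J := int0 (fun t => `|g t|) b.
have lng := locint_norm lg.
have nd y z : 0 <= y <= z -> int0 (fun t => `|g t|) y <= int0 (fun t => `|g t|) z.
  by move=> yz; exact: int0_nd.
have int0p y : 0 <= y -> 0 <= int0 (fun t => `|g t|) y.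
  by move=> y0; apply: int0_ge0.
have osc y : 0 <= y <= b -> v x ^+ 2 <= v y ^+ 2 + J.
  move=> yb; have [_ E] := pG.
  rewrite (E x) ?(E y); [|lra|lra].
  have [xy|yx] := leP x y.
    have := le_norm_int0 lg (_ : 0 <= x <= y); rewrite xy andbT => /(_ ltac:(lra)).
    have := nd y b ltac:(lra); have := int0p x ltac:(lra).
    rewrite ler_norml -/J; lra.
  have := le_norm_int0 lg (_ : 0 <= y <= x); rewrite (ltW yx) andbT => /(_ ltac:(lra)).
  have := nd x b ltac:(lra); have := int0p y ltac:(lra).
  rewrite ler_norml -/J; lra.
have J_le : J <= d * int0 (fun t => v' t ^+ 2) b + d^-1 * int0 (fun t => v t ^+ 2) b.
  rewrite /J -!int0Z// -int0D; [|exact: locintZ..].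
  apply: le_int0 => //; first by apply: locintD; exact: locintZ.
  move=> t _; rewrite /g; move: (v t) (v' t) => p q.
  have d1 : 0 < d^-1 by rewrite invr_gt0.
  have dd : d * d^-1 = 1 by rewrite divff// gt_eqF.
  rewrite ler_norml; apply/andP; split; rewrite -subr_ge0.
    have -> : d * q ^+ 2 + d^-1 * p ^+ 2 = d^-1 * ((d * q + p) ^+ 2) - (p * q + p * q).
      rewrite (_ : d^-1 * (d * q + p) ^+ 2 = d * d^-1 * (d * q ^+ 2) + d * d^-1 * (2 * (p * q)) + d^-1 * p ^+ 2); last by ring.
      by rewrite dd; ring.
    by rewrite opprK subrKC mulr_ge0 ?sqr_ge0// ltW.
  have -> : d * q ^+ 2 + d^-1 * p ^+ 2 = d^-1 * ((d * q - p) ^+ 2) + (p * q + p * q).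
    rewrite (_ : d^-1 * (d * q - p) ^+ 2 = d * d^-1 * (d * q ^+ 2) - d * d^-1 * (2 * (p * q)) + d^-1 * p ^+ 2); last by ring.
    by rewrite dd; ring.
  by rewrite addrK mulr_ge0 ?sqr_ge0// ltW.
have : b * v x ^+ 2 <= int0 (fun t => v t ^+ 2) b + b * J.
  have -> : b * v x ^+ 2 = int0 (cst (v x ^+ 2)) b by rewrite int0_cst 1?ltW// mulrC.
  have -> : b * J = int0 (cst J) b by rewrite int0_cst 1?ltW// mulrC.
  rewrite -int0D//; last exact: locint_cst.
  apply: le_int0; [exact: locint_cst|by apply: locintD => //; exact: locint_cst|].
  by move=> y yb /=; apply: osc; lra.
move=> h.
apply: (@le_trans _ _ (b^-1 * int0 (fun t => v t ^+ 2) b + J)); last first.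
  by rewrite mulrDl; lra.
rewrite -(ler_pM2l b0); apply: (le_trans h).
by rewrite mulrDr mulrA divff ?gt_eqF// mul1r.
Qed.

(* energy u = Re (u' conj(u)). *)
Definition energy u x : R := re1 u x * re0 u x + im1 u x * im0 u x.
Definition dnormsq u x : R := re1 u x ^+ 2 + im1 u x ^+ 2.

Lemma primitive_energy A B f1 f2 u : jet_sol A B f1 f2 u ->
  primitive (energy u) (fun x => dnormsq u x + normsq u x * A x
    - (re0 u x * f1 x + im0 u x * f2 x)).
Proof.
case=> u1 u2 u3 u4.
apply: eq_primitive (primitiveD (primitiveM u3 u1) (primitiveM u4 u2)) _.
by move=> x; rewrite /dnormsq /normsq; ring.
Qed.

Lemma contp_dnormsq A B f1 f2 u : jet_sol A B f1 f2 u -> contp (dnormsq u).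
Proof. by move/contp_jet => [_ _ c1 c2]; apply: contpD; apply: contpM. Qed.

Lemma dnormsq_ge0 u x : 0 <= dnormsq u x.
Proof. by rewrite addr_ge0 ?sqr_ge0. Qed.

Definition ramp c x : R := 1 - c * x.

Lemma primitive_ramp c : primitive (ramp c) (cst (- c)).
Proof.
apply: eq_primitive (primitiveB (primitive_cst 1) (primitive_id c)) _.
by move=> x /=; rewrite sub0r.
Qed.

Lemma contp_ramp c : contp (ramp c).
Proof. exact: primitive_contp (primitive_ramp c). Qed.

Lemma ramp0 c : ramp c 0 = 1.
Proof. by rewrite /ramp mulr0 subr0. Qed.

Lemma ramp_bounds c b x : 0 <= c -> c * b <= 1 -> 0 <= x <= b -> 0 <= ramp c x <= 1.
Proof.
move=> c0 cb /andP[x0 xb]; rewrite /ramp.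
have : c * x <= c * b by rewrite ler_wpM2l.
by have := mulr_ge0 c0 x0; lra.
Qed.

(** The trace inequality is applied to ramp u instead of u, so that u' occurs only with its weight.
    The derivative of the weight adds c |u|, which c <= 1 puts into the term with |u|^2; the factors
    2 come from squaring a sum. *)
Lemma weighted_sup A B f1 f2 u c b (d : R) x : jet_sol A B f1 f2 u -> 0 < b -> 0 < d ->
  0 <= c <= 1 -> c * b <= 1 -> 0 <= x <= b ->
  ramp c x ^+ 2 * normsq u x <=
    2 * d * int0 (fun t => ramp c t ^+ 2 * dnormsq u t) b +
    (2 * d + d^-1 + b^-1) * int0 (normsq u) b.
Proof.
move=> su b0 d0 /andP[c0 c1] cb xb.
have [c_1 c_2 c_3 c_4] := contp_jet su.
have [p1 p2 _ _] := su.
have ce : contp (ramp c) by exact: contp_ramp.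
have q1 := primitiveM (primitive_ramp c) p1.
have q2 := primitiveM (primitive_ramp c) p2.
pose v1' t := ramp c t * re1 u t + re0 u t * - c.
pose v2' t := ramp c t * im1 u t + im0 u t * - c.
have cv1' : contp v1' by apply: contpD; apply: contpM => //; exact: contp_cst.
have cv2' : contp v2' by apply: contpD; apply: contpM => //; exact: contp_cst.
have := lerD (trace_inequality q1 cv1' b0 d0 xb) (trace_inequality q2 cv2' b0 d0 xb).
have cln := contp_normsq su.
have ln : locint (normsq u) := contp_locint cln.
have ce2 : contp (fun t => ramp c t ^+ 2) by exact: contpM.
have led : locint (fun t => ramp c t ^+ 2 * dnormsq u t).
  apply: contp_locint; apply: contpM => //; exact: contp_dnormsq su.
have lv1 : locint (fun t => v1' t ^+ 2) by apply: contp_locint; exact: contpM.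
have lv2 : locint (fun t => v2' t ^+ 2) by apply: contp_locint; exact: contpM.
have le1 : locint (fun t => (ramp c t * re0 u t) ^+ 2).
  by apply: contp_locint; apply: contpM; exact: contpM.
have le2 : locint (fun t => (ramp c t * im0 u t) ^+ 2).
  by apply: contp_locint; apply: contpM; exact: contpM.
have h1 : int0 (fun t => v1' t ^+ 2) b + int0 (fun t => v2' t ^+ 2) b <=
    2 * int0 (fun t => ramp c t ^+ 2 * dnormsq u t) b + 2 * int0 (normsq u) b.
  rewrite -int0D// -!int0Z// -int0D; [|exact: locintZ..].
  apply: le_int0; [exact: locintD|by apply: locintD; exact: locintZ|].
  move=> t tb; rewrite /v1' /v2' /dnormsq /normsq.
  move: (ramp c t) (re0 u t) (im0 u t) (re1 u t) (im1 u t) => e r i r' i'.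
  have cc : c ^+ 2 <= 1 by rewrite expr_le1.
  have := sqr_ge0 (e * r' + r * c); have := sqr_ge0 (e * i' + i * c).
  have := sqr_ge0 r; have := sqr_ge0 i => hi hr h1 h2.
  have : c ^+ 2 * (r ^+ 2 + i ^+ 2) <= 1 * (r ^+ 2 + i ^+ 2) by rewrite ler_wpM2r// addr_ge0.
  rewrite -subr_ge0 => h3; rewrite -subr_ge0.
  have -> : 2 * (e ^+ 2 * (r' ^+ 2 + i' ^+ 2)) + 2 * (r ^+ 2 + i ^+ 2) -
    ((e * r' + r * - c) ^+ 2 + (e * i' + i * - c) ^+ 2) =
    (e * r' + r * c) ^+ 2 + (e * i' + i * c) ^+ 2 + 2 * (1 * (r ^+ 2 + i ^+ 2) - c ^+ 2 * (r ^+ 2 + i ^+ 2)) by ring.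
  lra.
have h2 : int0 (fun t => (ramp c t * re0 u t) ^+ 2) b + int0 (fun t => (ramp c t * im0 u t) ^+ 2) b <=
    int0 (normsq u) b.
  rewrite -int0D//; apply: le_int0 => //; first exact: locintD.
  move=> t tb; have /andP[e0 e1] : 0 <= ramp c t <= 1 by apply: (ramp_bounds c0 cb); lra.
  rewrite !exprMn -mulrDr ler_piMl ?normsq_ge0// expr_le1//.
have d1 : 0 < d^-1 by rewrite invr_gt0.
have b1 : 0 < b^-1 by rewrite invr_gt0.
have h1' := ler_wpM2l (ltW d0) h1.
have h2' := ler_wpM2l (ltW (addr_gt0 d1 b1)) h2.
rewrite /normsq.
have -> : ramp c x ^+ 2 * (re0 u x ^+ 2 + im0 u x ^+ 2) =
  (ramp c x * re0 u x) ^+ 2 + (ramp c x * im0 u x) ^+ 2 by ring.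
move=> h; apply: (le_trans h); rewrite -/(normsq u).
move: h1' h2'; rewrite !mulrDr !mulrDl.
lra.
Qed.

(** The equation is multiplied by ramp^2 conj(u) and the real part integrated. The part [w] of the
    potential is small in no pointwise sense, so it is paid for by its integral times the weighted
    supremum [T]. A quarter of the weighted energy is lost to the slope of the weight, whence c <=
    1/4 and the factor 3/4; the other 3/4 is 1/2 from the source plus 1/4 from the slope. *)
Lemma weighted_energy A B f1 f2 w u c b m (T X F : R) : jet_sol A B f1 f2 u -> 0 < b ->
  0 <= c <= 4^-1 -> c * b <= 1 -> 0 <= m -> locint w ->
  (forall x, 0 < x -> 0 <= w x) -> (forall x, 0 < x < b -> - m - w x <= A x) ->
  locint (fun x => f1 x ^+ 2 + f2 x ^+ 2) ->
  (forall x, 0 <= x <= b -> ramp c x ^+ 2 * normsq u x <= T) ->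
  int0 (normsq u) b <= X -> int0 (fun x => f1 x ^+ 2 + f2 x ^+ 2) b <= F ->
  3 / 4 * int0 (fun x => ramp c x ^+ 2 * dnormsq u x) b <=
    ramp c b ^+ 2 * energy u b - energy u 0 + int0 w b * T + (m + 3 / 4) * X + F / 2.
Proof.
move=> su b0 c01 cb m0 lw w0 Aw lf hT hX hF.
have c0 : 0 <= c by case/andP: c01.
have ce : contp (ramp c) by exact: contp_ramp.
have ce2 : contp (fun t => ramp c t ^+ 2) by exact: contpM.
have [lE EE] := primitiveM (primitiveM (primitive_ramp c) (primitive_ramp c)) (primitive_energy su).
have ln : locint (normsq u) := contp_locint (contp_normsq su).
have led : locint (fun t => ramp c t ^+ 2 * dnormsq u t).
  apply: contp_locint; apply: contpM => //; exact: contp_dnormsq su.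
have := EE b (ltW b0); rewrite ramp0 !mul1r -/(ramp c b ^+ 2) => E1.
have {E1} : int0 (fun x => 3 / 4 * (ramp c x ^+ 2 * dnormsq u x)) b <=
    (ramp c b ^+ 2 * energy u b - energy u 0) +
    int0 (fun x => T * w x + (m + 3 / 4) * normsq u x + 1 / 2 * (f1 x ^+ 2 + f2 x ^+ 2)) b.
  rewrite E1 [energy u 0 + _]addrC addrK -int0D//; last first.
    by apply: locintD; [apply: locintD|]; exact: locintZ.
  apply: le_int0; [exact: locintZ|apply: locintD => //; apply: locintD; [apply: locintD|]; exact: locintZ|].
  move=> x xb.
  have /andP[e0 e1] : 0 <= ramp c x <= 1 by apply: (ramp_bounds c0 cb); lra.
  have Tx := hT x ltac:(lra).
  have Ax := Aw x xb.
  have wx : 0 <= w x by apply: w0; lra.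
  have nx := normsq_ge0 u x.
  have e2 : 0 <= ramp c x ^+ 2 by exact: sqr_ge0.
  have e21 : ramp c x ^+ 2 <= 1 by rewrite expr_le1.
  have i1 : ramp c x ^+ 2 * normsq u x * (- m - w x) <= ramp c x ^+ 2 * normsq u x * A x.
    by rewrite ler_wpM2l// mulr_ge0.
  have i2 : ramp c x ^+ 2 * normsq u x * w x <= T * w x by rewrite ler_wpM2r.
  have i3 : ramp c x ^+ 2 * normsq u x * m <= normsq u x * m.
    by rewrite ler_wpM2r// ler_piMl.
  have i4 : ramp c x ^+ 2 * (re0 u x * f1 x + im0 u x * f2 x) <=
      1 / 2 * normsq u x + 1 / 2 * (f1 x ^+ 2 + f2 x ^+ 2).
    have j1 : re0 u x * f1 x + im0 u x * f2 x <= 1 / 2 * normsq u x + 1 / 2 * (f1 x ^+ 2 + f2 x ^+ 2).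
      by rewrite /normsq; have := sqr_ge0 (re0 u x - f1 x); have := sqr_ge0 (im0 u x - f2 x); nra.
    have j0 : 0 <= 1 / 2 * normsq u x + 1 / 2 * (f1 x ^+ 2 + f2 x ^+ 2).
      by have := sqr_ge0 (f1 x); have := sqr_ge0 (f2 x); lra.
    apply: (le_trans (ler_wpM2l e2 j1)); exact: ler_piMl.
  (* The derivative of the weight costs [2 c ramp E], absorbed by AM-GM. *)
  have i5 : 2 * c * ramp c x * energy u x <= 1 / 4 * (ramp c x ^+ 2 * dnormsq u x) + 1 / 4 * normsq u x.
    have j1 : 2 * (ramp c x * energy u x) <= ramp c x ^+ 2 * dnormsq u x + normsq u x.
      rewrite -subr_ge0 /energy /dnormsq /normsq.
      move: (ramp c x) (re0 u x) (im0 u x) (re1 u x) (im1 u x) => e r i r' i'.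
      have -> : e ^+ 2 * (r' ^+ 2 + i' ^+ 2) + (r ^+ 2 + i ^+ 2) - 2 * (e * (r' * r + i' * i)) =
        (e * r' - r) ^+ 2 + (e * i' - i) ^+ 2 by ring.
      by rewrite addr_ge0 ?sqr_ge0.
    have j2 : 0 <= ramp c x ^+ 2 * dnormsq u x + normsq u x.
      by rewrite addr_ge0// mulr_ge0// dnormsq_ge0.
    have := ler_wpM2l c0 j1.
    have : c * (ramp c x ^+ 2 * dnormsq u x + normsq u x) <= 4^-1 * (ramp c x ^+ 2 * dnormsq u x + normsq u x).
      by rewrite ler_wpM2r//; case/andP: c01.
    lra.
  rewrite -[X in _ <= X]/(ramp c x * ramp c x * (dnormsq u x + normsq u x * A x - (re0 u x * f1 x + im0 u x * f2 x)) +
    energy u x * (ramp c x * - c + ramp c x * - c) + (T * w x + (m + 3 / 4) * normsq u x + 1 / 2 * (f1 x ^+ 2 + f2 x ^+ 2))).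
  move: i1 i2 i3 i4 i5; rewrite !expr2.
  move: (ramp c x) (normsq u x) (dnormsq u x) (energy u x) (A x) (w x) (re0 u x * f1 x + im0 u x * f2 x) => e N D En a' w' fu.
  lra.
rewrite int0D; [|by apply: locintD; exact: locintZ|exact: locintZ].
rewrite int0D; [|exact: locintZ..].
rewrite !int0Z//.
have : (m + 3 / 4) * int0 (normsq u) b <= (m + 3 / 4) * X by rewrite ler_wpM2l//; lra.
rewrite [T * _]mulrC; lra.
Qed.

(* The interval (0, cutb l n) and the weight ramp (cutc l n) on it: on an
   infinite link the weight vanishes at the cut n, on a finite one it is 1. *)
Definition cutb l n : R := if l is b%:E then b else n.
Definition cutc l n : R := if l is _%:E then 0 else n^-1.

Lemma cut_bounds l n : (0 < l)%E -> 4 <= n ->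
  [/\ upto l (cutb l n), 0 <= cutc l n <= 4^-1, cutc l n <= n^-1,
      cutc l n * cutb l n <= 1 & (cutb l n)^-1 <= (cutb l 4)^-1].
Proof.
move=> l0 n4; have n0 : 0 < n by lra.
have ni : n^-1 <= 4^-1 by rewrite lef_pV2 ?posrE//; lra.
have ni0 : 0 < n^-1 by rewrite invr_gt0.
case: l l0 => [b|_|//]; rewrite /cutb /cutc.
  rewrite lte_fin => b0; split => //; [lra|exact: ltW|by rewrite mul0r].
split => //; [by split => //; rewrite leey|lra|by rewrite mulVf ?gt_eqF].
Qed.

(** A cut beyond 2 b keeps the weight at least 1/2 on (0, b), which turns weighted bounds into plain
    ones at the cost of a factor 4; the summand 4 meets the assumption of [cut_bounds]. *)
Lemma cut_half l b x : (0 < l)%E -> upto l b -> 0 <= x <= b ->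
  b <= cutb l (4 + 2 * b) /\ 1 / 2 <= ramp (cutc l (4 + 2 * b)) x.
Proof.
move=> l0 [b0 bl] xb; case: l l0 bl => [b'|_ _|//]; rewrite /cutb /cutc /ramp.
  by rewrite lte_fin lee_fin => b'0 bb'; split => //; lra.
split; first by lra.
have n0 : 0 < 4 + 2 * b by lra.
have : (4 + 2 * b)^-1 * x <= 1 / 2 by rewrite mulrC ler_pdivrMr//; lra.
lra.
Qed.

Lemma bc_energy (om : R) : exists2 k, 0 <= k & forall u b,
  bc_re om u b = 0 -> bc_im om u b = 0 -> energy u b <= k * normsq u b.
Proof.
(* For sin om = 0 the quotient is 0 by convention, as it should be: then u(b) = 0 and the energy
   vanishes. *)
exists (`|cos om / sin om|) => // u b; rewrite /bc_re /bc_im /energy.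
have := cos2Dsin2 om; move: (cos om) (sin om) => c s cs h1 h2.
have [s0|s0] := eqVneq s 0.
  have c0 : c != 0.
    apply/eqP => c0; move: cs; rewrite s0 c0 expr0n addr0 => /esym/eqP.
    by rewrite oner_eq0.
  move: h1 h2; rewrite s0 !mulr0 !addr0 => /eqP + /eqP.
  rewrite !mulf_eq0 (negbTE c0) !orbF => /eqP -> /eqP ->.
  by rewrite !mulr0 addr0 invr0 mulr0 normr0 mul0r.
have -> : re1 u b = - (c / s) * re0 u b.
  by apply: (mulIf s0); rewrite mulrAC mulNr divfK//; lra.
have -> : im1 u b = - (c / s) * im0 u b.
  by apply: (mulIf s0); rewrite mulrAC mulNr divfK//; lra.
rewrite -!mulrA -mulrDr -!expr2 -/(normsq u b) ler_wpM2r ?normsq_ge0//.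
by rewrite -normrN ler_norm.
Qed.

(** The boundary term at b disappears through the weight on an infinite link and through the
    boundary condition on a finite one. The price is c times the integral of [wronsk u], which is
    O(1 / n) once u' is square integrable. *)
Lemma weighted_wronsk A B f1 f2 u c b (beta : R) : jet_sol A B f1 f2 u ->
  locint f1 -> locint f2 -> 0 < b ->
  (forall x, 0 < x < b -> B x = beta) -> ramp c b * wronsk u b = 0 ->
  beta * int0 (fun x => ramp c x * normsq u x) b =
    wronsk u 0 + int0 (fun x => ramp c x * (im0 u x * f1 x - re0 u x * f2 x)) b
    - c * int0 (wronsk u) b.
Proof.
move=> su lf1 lf2 b0 Bb W0.
have pW := primitive_wronsk su.
have [lE EE] := primitiveM (primitive_ramp c) pW.
have := EE b (ltW b0); rewrite W0 ramp0 mul1r => E1.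
have ce : contp (ramp c) by exact: contp_ramp.
have cn := contp_normsq su.
have cW := primitive_contp pW.
have len : locint (fun x => ramp c x * normsq u x) by apply: contp_locint; exact: contpM.
have lW := contp_locint cW.
have lk : locint (fun x => im0 u x * f1 x - re0 u x * f2 x).
  by have [c1 c2 _ _] := contp_jet su; apply: locintB; apply: contpM_locint.
have lek := contpM_locint ce lk.
have lz (k : R) (h : R -> R) : locint h -> locint (fun x => k * h x) by exact: locintZ.
pose k x := ramp c x * (im0 u x * f1 x - re0 u x * f2 x) - beta * (ramp c x * normsq u x)
    - c * wronsk u x.
have l1 := lz beta _ len; have l2 := lz c _ lW.
have lk' : locint k by apply: locintB => //; exact: locintB.
have kE : int0 k b = int0 (fun x => ramp c x * (im0 u x * f1 x - re0 u x * f2 x)) b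
    - beta * int0 (fun x => ramp c x * normsq u x) b - c * int0 (wronsk u) b.
  by rewrite (int0B _ (locintB lek l1) l2) (int0B _ lek l1) (int0Z _ _ len) (int0Z _ _ lW).
have := @eq_int0 _ _ k b _ lE lk'; rewrite kE => H.
have Hk : forall x, 0 < x < b -> ramp c x * (im0 u x * f1 x - re0 u x * f2 x - B x * normsq u x) + wronsk u x * (cst (- c)) x = k x.
  by move=> x xb; rewrite Bb// /k /=; ring.
have := H Hk; lra.
Qed.

Lemma wronsk_bound A B f1 f2 u b : jet_sol A B f1 f2 u -> 0 <= b ->
  `|int0 (wronsk u) b| <= 1 / 2 * (int0 (normsq u) b + int0 (dnormsq u) b).
Proof.
move=> su b0.
have lW := contp_locint (primitive_contp (primitive_wronsk su)).
have ln := contp_locint (contp_normsq su).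
have ld := contp_locint (contp_dnormsq su).
have := @le_norm_int0 _ _ 0 b lW; rewrite lexx b0 !int0_0 !subr0 => /(_ isT) h.
apply: (le_trans h); rewrite -int0D// -int0Z; last exact: locintD.
apply: le_int0; [exact: locint_norm|by apply: locintZ; exact: locintD|].
move=> x _; rewrite /wronsk /normsq /dnormsq ler_norml.
move: (re0 u x) (im0 u x) (re1 u x) (im1 u x) => r i r' i'.
have := sqr_ge0 (i' - r); have := sqr_ge0 (r' + i).
have := sqr_ge0 (i' + r); have := sqr_ge0 (r' - i) => *; apply/andP; split; nra.
Qed.

(** * A priori bounds on the graph *)

Section GraphEstimates.
Variables (N : nat) (l : 'I_N -> \bar R) (om : 'I_N -> R).
Hypotheses (N0 : (0 < N)%N) (l0 : forall j, (0 < l j)%E).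
Implicit Types (us : 'I_N -> jet R) (alpha : R).

Definition graph_bc us := forall j b, l j = b%:E ->
  bc_re (om j) (us j) b = 0 /\ bc_im (om j) (us j) b = 0.

Definition graph_vertex alpha us := exists c1 c2,
  [/\ forall j, re0 (us j) 0 = c1 /\ im0 (us j) 0 = c2,
      \sum_(j < N) re1 (us j) 0 = alpha * c1 & \sum_(j < N) im1 (us j) 0 = alpha * c2].

(** The order of the quantifiers matters: C is fixed before the potentials, the vertex parameter and
    the source, hence is uniform in eps and f. The links are summed because the vertex condition
    controls only the sum of their energies at 0. The supremum bound 2 d S + C1 re-enters the energy
    bound with the factor G, and a small d closes the loop: 3/4 S <= 1/4 S + G C1 + K. *)
Lemma graph_H1 m (Wn a X F : R) : 0 <= m -> 0 <= Wn -> 0 <= X -> 0 <= a ->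
  exists C, forall alpha (As Bs f1 f2 ws : 'I_N -> R -> R) us,
    `|alpha| <= a -> (forall j, jet_sol (As j) (Bs j) (f1 j) (f2 j) (us j)) ->
    graph_bc us -> graph_vertex alpha us ->
    (forall j, locint (ws j)) -> (forall j x, 0 < x -> 0 <= ws j x) ->
    (forall j b, upto (l j) b -> int0 (ws j) b <= Wn) ->
    (forall j x, 0 < x -> (x%:E < l j)%E -> - m - ws j x <= As j x) ->
    (forall j, locint (fun x => f1 j x ^+ 2 + f2 j x ^+ 2)) ->
    (forall j b, upto (l j) b -> int0 (fun x => f1 j x ^+ 2 + f2 j x ^+ 2) b <= F) ->
    (forall j b, upto (l j) b -> int0 (normsq (us j)) b <= X) ->
    forall j, (forall b, upto (l j) b -> int0 (dnormsq (us j)) b <= C) /\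
      (forall b, upto (l j) b -> forall x, 0 <= x <= b -> normsq (us j) x <= C).
Proof.
move=> m0 Wn0 X0 a0.
have /choice[kap Hkap] : forall j : 'I_N, exists k, 0 <= k /\ forall u b,
    bc_re (om j) u b = 0 -> bc_im (om j) u b = 0 -> energy u b <= k * normsq u b.
  by move=> j; have [k k0 Hk] := bc_energy (om j); exists k.
pose Kap := \sum_(j < N) kap j.
have Kap0 : 0 <= Kap by apply: sumr_ge0 => j _; case: (Hkap j).
have c4 j : 0 < cutb (l j) 4 by have [[]] := cut_bounds (l0 j) (lexx 4).
pose bi := \sum_(j < N) (cutb (l j) 4)^-1.
have bi0 : 0 <= bi by apply: sumr_ge0 => j _; rewrite invr_ge0 ltW.
pose G := Kap + a + N%:R * Wn.
have G0 : 0 <= G by rewrite !addr_ge0// mulr_ge0.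
(* Small enough for 2 d G <= 1/4; the summand 1 guards against G = 0. *)
pose d := (8 * (G + 1))^-1.
have d0 : 0 < d by rewrite invr_gt0; lra.
have dG : 2 * d * G <= 1 / 4.
  rewrite /d mulrAC ler_pdivrMr; lra.
pose C1 := (2 * d + d^-1 + bi) * X.
have C10 : 0 <= C1 by rewrite mulr_ge0// !addr_ge0// ?invr_ge0 ltW//; lra.
pose K := N%:R * ((m + 3 / 4) * X + F / 2).
pose S0 := 2 * (G * C1 + K).
(* The first term bounds the integral of |u'|^2, the second one |u|^2; the factors 4 undo a squared
   weight of at least 1/4. *)
exists (4 * `|S0| + 4 * (2 * d * `|S0| + C1)).
move=> alpha As Bs f1 f2 ws us aa su bc vx lw w0 wW Aw lf fF nX.
have main n : 4 <= n -> exists S, [/\ 0 <= S, S <= S0,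
    forall j, int0 (fun x => ramp (cutc (l j) n) x ^+ 2 * dnormsq (us j) x) (cutb (l j) n) <= S &
    forall j x, 0 <= x <= cutb (l j) n -> ramp (cutc (l j) n) x ^+ 2 * normsq (us j) x <= 2 * d * S + C1].
  move=> n4; pose c j := cutc (l j) n; pose b j := cutb (l j) n.
  pose P j := int0 (fun x => ramp (c j) x ^+ 2 * dnormsq (us j) x) (b j).
  have led j : locint (fun t => ramp (c j) t ^+ 2 * dnormsq (us j) t).
    apply: contp_locint; apply: contpM; last exact: contp_dnormsq (su j).
    by apply: contpM; exact: contp_ramp.
  have P0 j : 0 <= P j.
    by apply: int0_ge0 => // x _; rewrite mulr_ge0 ?sqr_ge0 ?dnormsq_ge0.
  pose S := \sum_(j < N) P j.
  have S00 : 0 <= S by exact: sumr_ge0.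
  have PS j : P j <= S by rewrite /S (bigD1 j)//= lerDl sumr_ge0.
  have TS j x : 0 <= x <= b j -> ramp (c j) x ^+ 2 * normsq (us j) x <= 2 * d * S + C1.
    move=> xb; have [ub /andP[cj0 cj4] cjn cbj bb] := cut_bounds (l0 j) n4.
    have bj0 : 0 < b j by case: ub.
    have cj1 : 0 <= c j <= 1 by rewrite cj0 (le_trans cj4)//; lra.
    apply: (le_trans (weighted_sup (su j) bj0 d0 cj1 cbj xb)).
    apply: lerD; first by apply: ler_wpM2l; [rewrite mulr_ge0// ltW|exact: PS].
    apply: (@le_trans _ _ ((2 * d + d^-1 + (b j)^-1) * X)).
      rewrite ler_wpM2l ?nX// !addr_ge0 ?invr_ge0 ?ltW//; lra.
    rewrite ler_wpM2r// lerD2l (le_trans bb)// /bi (bigD1 j)//= lerDl.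
    by apply: sumr_ge0 => k _; rewrite invr_ge0 ltW.
  set T := 2 * d * S + C1 in TS.
  have T0 : 0 <= T by rewrite addr_ge0// !mulr_ge0// ltW.
  have est j : 3 / 4 * P j <= kap j * T - energy (us j) 0 + Wn * T + ((m + 3 / 4) * X + F / 2).
    have [ub cj cjn cbj bb] := cut_bounds (l0 j) n4.
    have bj0 : 0 < b j by case: ub.
    have Awj x : 0 < x < b j -> - m - ws j x <= As j x.
      move=> /andP[x0 xb]; apply: Aw => //.
      by apply: lt_le_trans ub.2; rewrite lte_fin.
    have h := weighted_energy (su j) bj0 cj cbj m0 (lw j) (w0 j) Awj (lf j) (TS j) (nX j _ ub) (fF j _ ub).
    (* On a finite link the weight is 1 and the boundary condition applies; on an infinite one the
       weight vanishes at the cut. *)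
    have h1 : ramp (c j) (b j) ^+ 2 * energy (us j) (b j) <= kap j * T.
      have [k0 Hk] := Hkap j.
      have bT := TS j (b j); rewrite lexx ltW// in bT; have {}bT := bT isT.
      move: (l0 j) (bc j) bT; rewrite /c /b /cutc /cutb.
      case: (l j) => [b'|_ _ _|//].
        move=> _ /(_ b' erefl)[h1 h2] bT.
        rewrite /ramp mul0r subr0 expr1n mul1r in bT *.
        by rewrite mul1r; apply: (le_trans (Hk _ _ h1 h2)); rewrite ler_wpM2l.
      by rewrite /ramp mulVf ?subrr ?expr0n ?mul0r ?mulr_ge0// gt_eqF//; lra.
    have h2 : int0 (ws j) (b j) * T <= Wn * T by rewrite ler_wpM2r// wW.
    rewrite -/(P j) in h; lra.
  have sE : - (\sum_(j < N) energy (us j) 0) <= a * T.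
    have [c1 [c2 [vc v1 v2]]] := vx.
    have -> : \sum_(j < N) energy (us j) 0 = alpha * (c1 ^+ 2 + c2 ^+ 2).
      rewrite (eq_bigr (fun j => re1 (us j) 0 * c1 + im1 (us j) 0 * c2)); last first.
        by move=> j _; rewrite /energy; have [-> ->] := vc j.
      by rewrite big_split/= -!mulr_suml v1 v2; ring.
    pose j0 : 'I_N := Ordinal N0.
    have := TS j0 0; have [[bj0 _] _ _ _ _] := cut_bounds (l0 j0) n4.
    rewrite lexx ltW// ramp0 expr1n mul1r /normsq; have [-> ->] := vc j0 => /(_ isT) hT.
    have n0 : 0 <= c1 ^+ 2 + c2 ^+ 2 by rewrite addr_ge0 ?sqr_ge0.
    apply: (@le_trans _ _ (`|alpha| * (c1 ^+ 2 + c2 ^+ 2))).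
      by rewrite -mulNr ler_wpM2r// -normrN ler_norm.
    exact: ler_pM.
  exists S; split => //.
  have : 3 / 4 * S <= Kap * T - \sum_(j < N) energy (us j) 0 + N%:R * (Wn * T) + K.
    rewrite /S mulr_sumr; apply: (le_trans (ler_sum _ (fun j _ => est j))).
    rewrite big_split/= big_split/= big_split/= sumrN !sumr_const card_ord -mulr_suml /K.
    by rewrite -(mulr_natl (Wn * T)) -(mulr_natl ((m + 3 / 4) * X + F / 2)).
  have GT : G * T = Kap * T + a * T + N%:R * (Wn * T) by rewrite /G; ring.
  have : G * T <= 1 / 4 * S + G * C1.
    by rewrite /T mulrDr lerD2r mulrA (mulrC G) ler_wpM2r.
  rewrite /S0; lra.
have S0n : S0 <= `|S0| by exact: ler_norm.
move=> j; split => b ub.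
  have n4 : 4 <= 4 + 2 * b by case: ub; lra.
  have [S [S1 S2 S3 _]] := main _ n4.
  have [b0 _] := ub.
  have h := S3 j.
  have bb : b <= cutb (l j) (4 + 2 * b).
    by have [] := @cut_half (l j) b 0 (l0 j) ub; [rewrite lexx ltW|].
  have ld := contp_locint (contp_dnormsq (su j)).
  have led : locint (fun t => ramp (cutc (l j) (4 + 2 * b)) t ^+ 2 * dnormsq (us j) t).
    apply: contp_locint; apply: contpM; last exact: contp_dnormsq (su j).
    by apply: contpM; exact: contp_ramp.
  have h1 : int0 (dnormsq (us j)) b <= int0 (fun t => 4 * (ramp (cutc (l j) (4 + 2 * b)) t ^+ 2 * dnormsq (us j) t)) b.
    apply: le_int0 => //; first exact: locintZ.
    move=> x xb; have [|_ e2] := @cut_half (l j) b x (l0 j) ub; first by lra.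
    have e1 : 1 <= 4 * ramp (cutc (l j) (4 + 2 * b)) x ^+ 2.
      by have := ler_pM (ltac:(lra) : 0 <= 1 / 2 :> R) (ltac:(lra) : 0 <= 1 / 2 :> R) e2 e2; rewrite -expr2; lra.
    by rewrite mulrA ler_peMl// dnormsq_ge0.
  rewrite int0Z// in h1.
  have h2 : int0 (fun t => ramp (cutc (l j) (4 + 2 * b)) t ^+ 2 * dnormsq (us j) t) b <= S.
    apply: le_trans (S3 j); apply: int0_nd => //; last by rewrite ltW.
    by move=> t _; rewrite mulr_ge0 ?sqr_ge0 ?dnormsq_ge0.
  have : 0 <= 2 * d * `|S0| by rewrite !mulr_ge0// ltW.
  lra.
move=> x xb.
have n4 : 4 <= 4 + 2 * b by case: ub; lra.
have [S [S1 S2 _ S4]] := main _ n4.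
have [bb e2] := @cut_half (l j) b x (l0 j) ub xb.
have h := S4 j x ltac:(lra).
have e1 : 1 <= 4 * ramp (cutc (l j) (4 + 2 * b)) x ^+ 2.
  by have := ler_pM (ltac:(lra) : 0 <= 1 / 2 :> R) (ltac:(lra) : 0 <= 1 / 2 :> R) e2 e2; rewrite -expr2; lra.
have := ler_wpM2r (normsq_ge0 (us j) x) e1.
have : 2 * d * S <= 2 * d * `|S0| by rewrite ler_wpM2l//; lra.
have := normr_ge0 S0; lra.
Qed.

End GraphEstimates.

End WeightedEstimates.

(** * The resolvent on the graph *)

Section GraphResolvent.
Variable R : realType.
Local Notation mu := (@lebesgue_measure R).

Lemma le_of_inv (S F K n0 : R) : (forall n, n0 <= n -> S <= F + K * n^-1) -> S <= F.
Proof.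
move=> H; rewrite leNgt; apply/negP => FS.
have d0 : 0 < S - F by lra.
pose n := `|n0| + 1 + `|K| / (S - F).
have K0 : 0 <= `|K| / (S - F) by rewrite divr_ge0// ltW.
have n1 : 0 < n by rewrite /n; have := normr_ge0 n0; lra.
have n0n : n0 <= n by rewrite /n; have := ler_norm n0; lra.
have := H n n0n.
have : K * n^-1 < S - F.
  apply: (@le_lt_trans _ _ (`|K| * n^-1)); first by rewrite ler_wpM2r ?ler_norm// invr_ge0 ltW.
  rewrite ltr_pdivrMr// /n mulrDr mulrCA divff ?gt_eqF// mulr1 ltrDr mulr_gt0//.
lra.
Qed.

Variables (N : nat) (l : 'I_N -> \bar R) (om : 'I_N -> R).
Hypotheses (N0 : (0 < N)%N) (l0 : forall j, (0 < l j)%E).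
Implicit Types (us : 'I_N -> jet R).

Local Notation c n j := (cutc (l j) n).
Local Notation b n j := (cutb (l j) n).

(** On (0, b' j) the weight is at least 1 - Bm / n, where [Bm] dominates all [b' j]; then n tends to
    infinity. The ends are independent on the different links, as [sum_sup] will require. *)
Lemma weighted_limit us (Q K n0 : R) : (forall j, contp (normsq (us j))) ->
  (forall n, n0 <= n -> 4 <= n ->
     \sum_(j < N) int0 (fun x => ramp (c n j) x * normsq (us j) x) (b n j) <= Q + K * n^-1) ->
  forall b', (forall j, upto (l j) (b' j)) -> \sum_(j < N) int0 (normsq (us j)) (b' j) <= Q.
Proof.
move=> cn H b' ub.
pose Bm := \sum_(j < N) b' j.
have b'B j : b' j <= Bm.
  by rewrite /Bm (bigD1 j)//= lerDl sumr_ge0// => i _; case: (ub i) => /ltW.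
pose S := \sum_(j < N) int0 (normsq (us j)) (b' j).
apply: (@le_of_inv _ _ (K + Bm * S) (`|n0| + 4 + `|Bm|)) => n nn.
have [n0n [n4 Bn]] : n0 <= n /\ 4 <= n /\ Bm <= n.
  have := normr_ge0 n0; have := normr_ge0 Bm; have := ler_norm n0; have := ler_norm Bm.
  by move=> *; split; [|split]; lra.
have nr0 : 0 < n^-1 by rewrite invr_gt0; lra.
have := H n n0n n4.
suff : (1 - Bm * n^-1) * S <= \sum_(j < N) int0 (fun x => ramp (c n j) x * normsq (us j) x) (b n j).
  rewrite -/S; lra.
rewrite /S mulr_sumr; apply: ler_sum => j _.
have [ubn /andP[c0 c4] cn' cb _] := cut_bounds (l0 j) n4.
have [b'0 b'l] := ub j.
have bb : b' j <= b n j.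
  move: b'l; rewrite /cutb; case: (l j) => [bb|_|//]; first by rewrite lee_fin.
  by apply: le_trans Bn; exact: b'B.
have ln := contp_locint (cn j).
have len : locint (fun x => ramp (c n j) x * normsq (us j) x).
  by apply: contpM_locint => //; exact: contp_ramp.
apply: (@le_trans _ _ (int0 (fun x => ramp (c n j) x * normsq (us j) x) (b' j))); last first.
  have [_ bl] := ubn.
  have ge0 x : 0 < x < b n j -> 0 <= ramp (c n j) x * normsq (us j) x.
    move=> /andP[x0 xb]; have /andP[e0 _] : 0 <= ramp (c n j) x <= 1.
      by apply: (ramp_bounds c0 cb); rewrite !ltW.
    by rewrite mulr_ge0 ?normsq_ge0.
  rewrite -subr_ge0 int0_subE//; last by rewrite (ltW b'0).
  rewrite -Rintegral_itv_bndo_bndc; last first.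
    by apply: integrableS (len (b n j)) => // t; rewrite /= !in_itv/= => /andP[h1 h2]; rewrite (ltW h2) ltW// (lt_trans b'0).
  by apply: Rintegral_ge0 => t /=; rewrite in_itv/= => /andP[h1 h2]; apply: ge0; rewrite h2 (lt_trans b'0).
rewrite -int0Z//; apply: le_int0 => //; first exact: locintZ.
move=> x xb; apply: ler_wpM2r; first exact: normsq_ge0.
rewrite /ramp lerD2l lerN2 mulrC.
have x0 : 0 <= x by lra.
apply: ler_pM => //; by have := b'B j; lra.
Qed.

(** Sum over the links of [weighted_wronsk], with the slope terms estimated by the bounds on u and
    u' in L^2. *)
Lemma graph_im (As Bs f1 f2 : 'I_N -> R -> R) us (beta X C n : R) :
  (forall j, jet_sol (As j) (Bs j) (f1 j) (f2 j) (us j)) -> graph_bc l om us ->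
  (forall j, locint (f1 j)) -> (forall j, locint (f2 j)) ->
  (forall j x, 0 < x -> (x%:E < l j)%E -> Bs j x = beta) ->
  (forall j b, upto (l j) b -> int0 (normsq (us j)) b <= X) ->
  (forall j b, upto (l j) b -> int0 (dnormsq (us j)) b <= C) -> 4 <= n ->
  `| beta * \sum_(j < N) int0 (fun x => ramp (c n j) x * normsq (us j) x) (b n j) -
    (\sum_(j < N) wronsk (us j) 0 + \sum_(j < N)
      int0 (fun x => ramp (c n j) x * (im0 (us j) x * f1 j x - re0 (us j) x * f2 j x)) (b n j)) |
    <= N%:R * ((X + C) / 2) * n^-1.
Proof.
move=> su bc lf1 lf2 Bl nX dC n4.
rewrite mulr_sumr -big_split/= -sumrB.
apply: (le_trans (ler_norm_sum _ _ _)).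
rewrite [leRHS](_ : _ = \sum_(j < N) ((X + C) / 2 * n^-1)); last first.
  by rewrite sumr_const card_ord -[RHS]mulr_natl [RHS]mulrA.
apply: ler_sum => j _.
have [ubn /andP[c0 c4] cn cb _] := cut_bounds (l0 j) n4.
have [b0 bl] := ubn.
have Bb x : 0 < x < b n j -> Bs j x = beta.
  move=> /andP[x0 xb]; apply: Bl => //; apply: lt_le_trans bl.
  by rewrite lte_fin.
have W0 : ramp (c n j) (b n j) * wronsk (us j) (b n j) = 0.
  move: (bc j); rewrite /cutc /cutb /ramp.
  case: (l j) (l0 j) => [bb|_ _|//].
    by move=> _ /(_ bb erefl)[h1 h2]; rewrite (wronsk_bc h1 h2) mulr0.
  by rewrite mulVf ?subrr ?mul0r// gt_eqF//; lra.
have -> := weighted_wronsk (su j) (lf1 j) (lf2 j) b0 Bb W0.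
rewrite addrAC subrr add0r normrN normrM ger0_norm// mulrC.
have := wronsk_bound (su j) (ltW b0).
have := nX j _ ubn; have := dC j _ ubn; move=> h1 h2 h3.
have XC : 0 <= (X + C) / 2 by have := normr_ge0 (int0 (wronsk (us j)) (b n j)); lra.
apply: ler_pM => //; lra.
Qed.

(** * Norm bound and surjectivity for H - z *)

Section Resolvent.
Variables (As Bs ws : 'I_N -> R -> R) (alpha beta m Wn : R).
Hypotheses (lA : forall j, locint (As j)) (lB : forall j, locint (Bs j))
  (lw : forall j, locint (ws j)) (w0 : forall j x, 0 < x -> 0 <= ws j x)
  (wW : forall j b, upto (l j) b -> int0 (ws j) b <= Wn)
  (m0 : 0 <= m) (Wn0 : 0 <= Wn)
  (Aw : forall j x, 0 < x -> (x%:E < l j)%E -> - m - ws j x <= As j x)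
  (Bl : forall j x, 0 < x -> (x%:E < l j)%E -> Bs j x = beta) (beta0 : beta != 0).

Definition l2_bounded us := exists X, forall j b, upto (l j) b -> int0 (normsq (us j)) b <= X.

(** The vertex parameter is real, so the Wronskian terms at 0 add up to zero, and |u|^2 <= |f|^2 /
    (Im z)^2 remains, the usual bound for a symmetric operator. The constant from [graph_H1] may
    depend on [us] here: it multiplies 1 / n only. *)
Lemma graph_L2 (f1 f2 : 'I_N -> R -> R) us (Fs : 'I_N -> R) :
  (forall j, jet_sol (As j) (Bs j) (f1 j) (f2 j) (us j)) ->
  graph_bc l om us -> graph_vertex alpha us -> l2_bounded us ->
  (forall j, locint (f1 j)) -> (forall j, locint (f2 j)) ->
  (forall j, locint (fun x => f1 j x ^+ 2 + f2 j x ^+ 2)) ->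
  (forall j b, upto (l j) b -> int0 (fun x => f1 j x ^+ 2 + f2 j x ^+ 2) b <= Fs j) ->
  forall b', (forall j, upto (l j) (b' j)) ->
  \sum_(j < N) int0 (normsq (us j)) (b' j) <= (beta ^+ 2)^-1 * \sum_(j < N) Fs j.
Proof.
move=> su bc vx [X nX] lf1 lf2 lf fF b' ub'.
have F0 j : 0 <= Fs j.
  apply: le_trans (fF j _ (ub' j)).
  by apply: int0_ge0 => // x _; rewrite addr_ge0 ?sqr_ge0.
have nX' j b1 : upto (l j) b1 -> int0 (normsq (us j)) b1 <= `|X|.
  by move=> /nX h; apply: (le_trans h); exact: ler_norm.
have fF' j b1 : upto (l j) b1 -> int0 (fun x => f1 j x ^+ 2 + f2 j x ^+ 2) b1 <= \sum_(j < N) Fs j.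
  move=> /fF h; apply: (le_trans h); rewrite (bigD1 j)//= lerDl.
  by apply: sumr_ge0.
have [C HC] := graph_H1 om N0 l0 (\sum_(j < N) Fs j) m0 Wn0 (normr_ge0 X) (normr_ge0 alpha).
have {}HC := HC alpha As Bs f1 f2 ws us (lexx _) su bc vx lw w0 wW Aw lf fF' nX'.
have dC j b1 : upto (l j) b1 -> int0 (dnormsq (us j)) b1 <= C.
  by case: (HC j) => H _ /H.
have m1 : 0 < `|beta| by rewrite normr_gt0.
have cn j : contp (normsq (us j)) by exact: contp_normsq (su j).
apply: (@weighted_limit _ _ (2 / `|beta| * (N%:R * ((`|X| + C) / 2))) 4) => // n _ n4.
have := graph_im su bc lf1 lf2 Bl nX' dC n4.
have -> : \sum_(j < N) wronsk (us j) 0 = 0.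
  have [c1 [c2 [vc v1 v2]]] := vx.
  rewrite (eq_bigr (fun j => im1 (us j) 0 * c1 - re1 (us j) 0 * c2)); last first.
    by move=> j _; rewrite /wronsk; have [-> ->] := vc j.
  by rewrite sumrB -!mulr_suml v1 v2; ring.
rewrite add0r; set S := \sum_(j < N) int0 _ _; set G := \sum_(j < N) int0 _ _.
set E := N%:R * _ => h.
have [sg [sg2 sgb]] := sign_witness beta.
have sgn : `|sg| = 1.
  by apply/eqP; rewrite -(eqrXn2 (n:=2))// ?expr1n// real_normK ?num_real// sg2.
have h1 : `|beta| * S <= sg * G + E * n^-1.
  have : `|sg * (beta * S - G)| <= E * n^-1 by rewrite normrM sgn mul1r.
  rewrite ler_norml mulrBr mulrA sgb; lra.
have h2 : sg * G <= (2 * `|beta|)^-1 * \sum_(j < N) Fs j + `|beta| / 2 * S.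
  rewrite /G /S !mulr_sumr -big_split/=; apply: ler_sum => j _.
  have [ubn /andP[c0 c4] cn' cb _] := cut_bounds (l0 j) n4.
  have [c1 c2 _ _] := contp_jet (su j).
  have ln := contp_locint (cn j).
  have ce : contp (ramp (c n j)) by exact: contp_ramp.
  have len : locint (fun x => ramp (c n j) x * normsq (us j) x) by exact: contpM_locint.
  have leg : locint (fun x => ramp (c n j) x * (im0 (us j) x * f1 j x - re0 (us j) x * f2 j x)).
    by apply: contpM_locint => //; apply: locintB; exact: contpM_locint.
  apply: (@le_trans _ _ ((2 * `|beta|)^-1 * int0 (fun x => f1 j x ^+ 2 + f2 j x ^+ 2) (b n j) +
     `|beta| / 2 * int0 (fun x => ramp (c n j) x * normsq (us j) x) (b n j))); last first.
    by rewrite lerD2r ler_wpM2l ?fF// invr_ge0; lra.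
  rewrite -!int0Z// -int0D; [|exact: locintZ..].
  apply: le_int0; [exact: locintZ|by apply: locintD; exact: locintZ|].
  move=> x /andP[x0 xb]; have /andP[e0 e1] : 0 <= ramp (c n j) x <= 1.
    by apply: (ramp_bounds c0 cb); rewrite !ltW.
  rewrite /normsq; move: (ramp (c n j) x) (re0 (us j) x) (im0 (us j) x) (f1 j x) (f2 j x) e0 e1 => e r i g1 g2 e0 e1.
  move: sgb m1; move: `|beta| => k sgb k0.
  have q0 : 0 <= (2 * k)^-1 by rewrite invr_ge0; lra.
  have := mulr_ge0 (mulr_ge0 q0 e0) (addr_ge0 (sqr_ge0 (g1 - k * sg * i)) (sqr_ge0 (g2 + k * sg * r))).
  have -> : (2 * k)^-1 * e * ((g1 - k * sg * i) ^+ 2 + (g2 + k * sg * r) ^+ 2) =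
    e * ((2 * k)^-1 * (g1 ^+ 2 + g2 ^+ 2)) - sg * (e * (i * g1 - r * g2)) + k / 2 * (e * (r ^+ 2 + i ^+ 2)).
    have -> : (g1 - k * sg * i) ^+ 2 + (g2 + k * sg * r) ^+ 2 =
     g1 ^+ 2 + g2 ^+ 2 - 2 * k * sg * (i * g1 - r * g2) + k ^+ 2 * sg ^+ 2 * (r ^+ 2 + i ^+ 2) by ring.
    by rewrite sg2; field; lra.
  have : e * ((2 * k)^-1 * (g1 ^+ 2 + g2 ^+ 2)) <= (2 * k)^-1 * (g1 ^+ 2 + g2 ^+ 2).
    by rewrite ler_piMl// mulr_ge0// addr_ge0 ?sqr_ge0.
  lra.
have h3 : `|beta| / 2 * S <= (2 * `|beta|)^-1 * \sum_(j < N) Fs j + E * n^-1 by lra.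
rewrite -(ler_pM2l (_ : 0 < `|beta| / 2)); last by lra.
apply: (le_trans h3); rewrite le_eqVlt; apply/orP; left; apply/eqP.
rewrite -[beta ^+ 2](real_normK (num_real beta)).
by field; lra.
Qed.

(** On each link [ps] solves the equation with value 0 at the vertex and [ys] the homogeneous one
    with value 1. A multiple of [ys] common to all links keeps the values at the vertex equal, and
    the condition on the derivatives becomes one complex linear equation for the factor. *)
Lemma graph_solution (f1 f2 : 'I_N -> R -> R) :
  (forall j, locint (f1 j)) -> (forall j, locint (f2 j)) ->
  (forall j, locint (fun x => f1 j x ^+ 2 + f2 j x ^+ 2)) ->
  (exists F, forall j b, upto (l j) b -> int0 (fun x => f1 j x ^+ 2 + f2 j x ^+ 2) b <= F) ->
  exists us, [/\ forall j, jet_sol (As j) (Bs j) (f1 j) (f2 j) (us j),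
    graph_bc l om us, graph_vertex alpha us & l2_bounded us].
Proof.
move=> lf1 lf2 lf [F fF].
have l00 : locint (fun x : R => (cst 0 x : R) ^+ 2 + (cst 0 x : R) ^+ 2).
  by apply: eq_locint (@locint_cst R 0) => x _ /=; rewrite expr0n addr0.
have i00 b1 : int0 (fun x : R => (cst 0 x : R) ^+ 2 + (cst 0 x : R) ^+ 2) b1 <= 0.
  rewrite (@eq_int0 _ _ (cst 0))//; [|by move=> x _ /=; rewrite expr0n addr0|exact: locint_cst].
  by rewrite /int0 Rintegral_cst// mul0r.
have /choice[ps Hps] : forall j, exists u, [/\ jet_sol (As j) (Bs j) (f1 j) (f2 j) u, re0 u 0 = 0, im0 u 0 = 0,
      forall b, l j = b%:E -> bc_re (om j) u b = 0 /\ bc_im (om j) u b = 0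
    & exists X, forall b, upto (l j) b -> int0 (normsq u) b <= X].
  by move=> j; apply: (@link_solution _ (l j) _ _ _ _ beta _ _ F) => //; [exact: Bl|exact: fF].
have /choice[ys Hys] : forall j, exists u, [/\ jet_sol (As j) (Bs j) (cst 0) (cst 0) u, re0 u 0 = 1, im0 u 0 = 0,
      forall b, l j = b%:E -> bc_re (om j) u b = 0 /\ bc_im (om j) u b = 0
    & exists X, forall b, upto (l j) b -> int0 (normsq u) b <= X].
  by move=> j; apply: (@link_solution _ (l j) _ _ _ _ beta _ _ 0) => //; [exact: locint_cst|exact: locint_cst|exact: Bl].
pose M1 := \sum_(j < N) re1 (ys j) 0; pose M2 := \sum_(j < N) im1 (ys j) 0.
pose P1 := \sum_(j < N) re1 (ps j) 0; pose P2 := \sum_(j < N) im1 (ps j) 0.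
have bounded us : (forall j, exists X, forall b, upto (l j) b -> int0 (normsq (us j)) b <= X) -> l2_bounded us.
  move=> /choice[Xs HX]; exists (\sum_(j < N) `|Xs j|) => j b1 ub.
  apply: (le_trans (HX j b1 ub)); rewrite (bigD1 j)//=.
  by apply: (le_trans (ler_norm _)); rewrite lerDl sumr_ge0.
(* M1 + i M2 is the sum of the Weyl functions of the links. If it were equal to alpha, [ys] would be
   an eigenfunction for a non-real z, and [graph_L2] without source would force its value at the
   vertex to be 0 instead of 1. *)
have D0 : (alpha - M1) ^+ 2 + M2 ^+ 2 != 0.
  apply/negP; rewrite paddr_eq0 ?sqr_ge0// !sqrf_eq0 subr_eq0 => /andP[/eqP E1 /eqP E2].
  have sy j : jet_sol (As j) (Bs j) (cst 0) (cst 0) (ys j) by case: (Hys j).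
  have bcy : graph_bc l om ys by move=> j b1 lj; case: (Hys j) => _ _ _ H _; exact: H.
  have vy : graph_vertex alpha ys.
    exists 1, 0; rewrite mulr1 mulr0; split => //.
    by move=> j; case: (Hys j).
  have by' : l2_bounded ys by apply: bounded => j; case: (Hys j).
  have ub4 j : upto (l j) (cutb (l j) 4) by have [] := cut_bounds (l0 j) (lexx 4).
  have := graph_L2 (f1 := fun=> cst 0) (f2 := fun=> cst 0) (Fs := fun=> 0) sy bcy vy by'
     (fun=> @locint_cst R 0) (fun=> @locint_cst R 0) (fun=> l00) (fun _ b1 _ => i00 b1) ub4.
  rewrite big1_eq mulr0 => le0.
  pose j0 : 'I_N := Ordinal N0.
  have cny := contp_normsq (sy j0).
  have le0j : int0 (normsq (ys j0)) (cutb (l j0) 4) <= 0.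
    apply: le_trans le0; rewrite (bigD1 j0)//= lerDl; apply: sumr_ge0 => i _.
    apply: int0_ge0 => [|x _]; [exact: contp_locint (contp_normsq (sy i))|exact: normsq_ge0].
  have z := int0_eq0 cny (fun x _ => normsq_ge0 (ys j0) x) le0j.
  have h1 := contp_cvg0 cny.
  have h2 : normsq (ys j0) x @[x --> 0^'+] --> (0 : R).
    apply: cvg_near_cst; near=> x; apply: z.
    apply/andP; split; near: x; [exact: nbhs_right_gt|apply: nbhs_right_lt].
    by case: (ub4 j0).
  have : normsq (ys j0) 0 = 0 by exact: (cvg_unique _ h1 h2).
  rewrite /normsq; case: (Hys j0) => _ -> -> _ _.
  by rewrite expr1n expr0n addr0 => /eqP; rewrite oner_eq0.
pose D := (alpha - M1) ^+ 2 + M2 ^+ 2.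
(* c1 + i c2 is the quotient of P1 + i P2 by alpha - M1 - i M2. *)
pose c1 := ((alpha - M1) * P1 - M2 * P2) / D.
pose c2 := ((alpha - M1) * P2 + M2 * P1) / D.
exists (fun j => jet_addZ (ps j) c1 c2 (ys j)); split.
- by move=> j; apply: jet_sol_addZ; [case: (Hps j)|case: (Hys j)].
- move=> j b1 lj; case: (Hps j) => _ _ _ /(_ _ lj)[p1 p2] _.
  case: (Hys j) => _ _ _ /(_ _ lj)[y1 y2] _.
  have -> : bc_re (om j) (jet_addZ (ps j) c1 c2 (ys j)) b1 =
      bc_re (om j) (ps j) b1 + (c1 * bc_re (om j) (ys j) b1 - c2 * bc_im (om j) (ys j) b1).
    by rewrite /bc_re /bc_im /=; ring.
  have -> : bc_im (om j) (jet_addZ (ps j) c1 c2 (ys j)) b1 =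
      bc_im (om j) (ps j) b1 + (c1 * bc_im (om j) (ys j) b1 + c2 * bc_re (om j) (ys j) b1).
    by rewrite /bc_re /bc_im /=; ring.
  by rewrite p1 p2 y1 y2 !mulr0 subrr !addr0.
- exists c1, c2; split => /=.
  + move=> j; case: (Hps j) => _ -> -> _ _; case: (Hys j) => _ -> -> _ _.
    by split; ring.
  + rewrite big_split/= sumrB/= -!mulr_sumr -/M1 -/M2 -/P1 /c1 /c2 /D.
    by move: M1 M2 P1 P2 D0 {c1 c2 D} => x y p q D0; field.
  + rewrite big_split/= big_split/= -!mulr_sumr -/M1 -/M2 -/P2 /c1 /c2 /D.
    by move: M1 M2 P1 P2 D0 {c1 c2 D} => x y p q D0; field.
- apply: bounded => j; case: (Hps j) => sp _ _ _ [X HX]; case: (Hys j) => sy _ _ _ [Y HY].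
  exists (2 * X + 2 * ((c1 ^+ 2 + c2 ^+ 2) * Y)) => b1 ub.
  have lp := contp_locint (contp_normsq sp); have ly := contp_locint (contp_normsq sy).
  have K0 : 0 <= c1 ^+ 2 + c2 ^+ 2 by rewrite addr_ge0 ?sqr_ge0.
  have h1 := HX b1 ub; have h2 := ler_wpM2l K0 (HY b1 ub).
  have lpy := locintD lp (locintZ (c1 ^+ 2 + c2 ^+ 2) ly).
  apply: (@le_trans _ _ (int0 (fun x => 2 * (normsq (ps j) x + (c1 ^+ 2 + c2 ^+ 2) * normsq (ys j) x)) b1)).
    apply: le_int0; [exact: contp_locint (contp_normsq (jet_sol_addZ c1 c2 sp sy))|exact: locintZ|].
    move=> x _; rewrite normsq_addZ -subr_ge0 /normsq.
    move: (re0 (ps j) x) (im0 (ps j) x) (re0 (ys j) x) (im0 (ys j) x) => r i r' i'.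
    rewrite (_ : _ - _ = (r - (c1 * r' - c2 * i')) ^+ 2 + (i - (c1 * i' + c2 * r')) ^+ 2); last by ring.
    by rewrite addr_ge0 ?sqr_ge0.
  rewrite int0Z// int0D//; last exact: locintZ.
  by rewrite int0Z//; lra.
Unshelve. all: by end_near. Qed.

End Resolvent.

(** * The difference of the two resolvents *)

Definition jet_sub (u v : jet R) : jet R :=
  Jet (fun x => re0 u x - re0 v x) (fun x => im0 u x - im0 v x)
      (fun x => re1 u x - re1 v x) (fun x => im1 u x - im1 v x).

Lemma jet_sol_sub (A w B f1 f2 : R -> R) u v :
  jet_sol (fun x => A x + w x) B f1 f2 u -> jet_sol A B f1 f2 v ->
  jet_sol A B (fun x => - (re0 u x * w x)) (fun x => - (im0 u x * w x)) (jet_sub u v).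
Proof.
case=> u1 u2 u3 u4 [v1 v2 v3 v4]; split => /=.
- exact: primitiveB.
- exact: primitiveB.
- by apply: eq_primitive (primitiveB u3 v3) _ => x; ring.
- by apply: eq_primitive (primitiveB u4 v4) _ => x; ring.
Qed.

Lemma normsq_sub u v x : normsq (jet_sub u v) x <= 2 * normsq u x + 2 * normsq v x.
Proof.
rewrite /normsq /= -subr_ge0.
rewrite (_ : _ - _ = (re0 u x + re0 v x) ^+ 2 + (im0 u x + im0 v x) ^+ 2); last by ring.
by rewrite addr_ge0 ?sqr_ge0.
Qed.

Lemma dnormsq_sub u v x : dnormsq (jet_sub u v) x <= 2 * dnormsq u x + 2 * dnormsq v x.
Proof.
rewrite /dnormsq /= -subr_ge0.
rewrite (_ : _ - _ = (re1 u x + re1 v x) ^+ 2 + (im1 u x + im1 v x) ^+ 2); last by ring.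
by rewrite addr_ge0 ?sqr_ge0.
Qed.

(* cross u v = Im (u conj(v)). *)
Definition cross (u v : jet R) x : R := im0 u x * re0 v x - re0 u x * im0 v x.

Lemma primitive_cross A B f1 f2 u A' B' f1' f2' v :
  jet_sol A B f1 f2 u -> jet_sol A' B' f1' f2' v ->
  primitive (cross u v) (fun x => (im0 u x * re1 v x + re0 v x * im1 u x)
    - (re0 u x * im1 v x + im0 v x * re1 u x)).
Proof.
case=> u1 u2 _ _ [v1 v2 _ _].
exact: primitiveB (primitiveM u2 v1) (primitiveM u1 v2).
Qed.

Lemma cross_le u v x : `|cross u v x| <= 1 / 2 * (normsq u x + normsq v x).
Proof.
rewrite /cross /normsq ler_norml.
move: (re0 u x) (im0 u x) (re0 v x) (im0 v x) => r i r' i'.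
have := sqr_ge0 (i - r'); have := sqr_ge0 (r + i').
have := sqr_ge0 (i + r'); have := sqr_ge0 (r - i') => *; apply/andP; split; nra.
Qed.

Lemma amgm2 (k p q r s : R) : 0 < k ->
  `|p * q - r * s| <= k / 2 * (p ^+ 2 + r ^+ 2) + (2 * k)^-1 * (q ^+ 2 + s ^+ 2).
Proof.
move=> k0; have k1 : 0 < (2 * k)^-1 by rewrite invr_gt0; lra.
rewrite ler_norml; apply/andP; split; rewrite -subr_ge0.
  rewrite (_ : _ - _ = (2 * k)^-1 * ((k * p + q) ^+ 2 + (k * r - s) ^+ 2)); last by field; lra.
  by rewrite mulr_ge0 ?addr_ge0 ?sqr_ge0// ltW.
rewrite (_ : _ - _ = (2 * k)^-1 * ((k * p - q) ^+ 2 + (k * r + s) ^+ 2)); last by field; lra.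
by rewrite mulr_ge0 ?addr_ge0 ?sqr_ge0// ltW.
Qed.

(** Hoelder continuity without a square root: writing the length as at most rho^2, AM-GM with weight
    rho splits u' v into rho |u'|^2, controlled by its integral, and |v|^2 / rho, controlled by its
    supremum times rho^2. *)
Lemma cross_osc A B f1 f2 u A' B' f1' f2' v (C K rho x : R) :
  jet_sol A B f1 f2 u -> jet_sol A' B' f1' f2' v -> 0 < rho -> 0 <= x <= rho ^+ 2 ->
  int0 (dnormsq u) x <= C -> int0 (dnormsq v) x <= K ->
  (forall y, 0 <= y <= x -> normsq u y <= C) -> (forall y, 0 <= y <= x -> normsq v y <= K) ->
  `|cross u v x - cross u v 0| <= (C + K) * rho.
Proof.
move=> su sv r0 /andP[x0 xr] dC dK nC nK.
have [ls sE] := primitive_cross su sv.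
rewrite sE// [cross u v 0 + _]addrC addrK.
have := @le_norm_int0 _ _ 0 x ls; rewrite lexx x0 !int0_0 !subr0 => /(_ isT) h.
apply: (le_trans h).
have ldu := contp_locint (contp_dnormsq su); have ldv := contp_locint (contp_dnormsq sv).
have lK := @locint_cst R ((2 * rho)^-1 * (C + K)).
apply: (@le_trans _ _ (int0 (fun y => rho / 2 * (dnormsq u y + dnormsq v y) +
   cst ((2 * rho)^-1 * (C + K)) y) x)).
  apply: le_int0; [exact: locint_norm|by apply: locintD => //; apply: locintZ; exact: locintD|].
  move=> y yx.
  have k0 : 0 <= (2 * rho)^-1 by rewrite invr_ge0; lra.
  have := ler_wpM2l k0 (lerD (nC y ltac:(lra)) (nK y ltac:(lra))).
  rewrite /dnormsq /normsq /=.
  have := amgm2 (im1 u y) (re0 v y) (re1 u y) (im0 v y) r0.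
  have := amgm2 (re1 v y) (im0 u y) (im1 v y) (re0 u y) r0.
  have := ler_normD (re1 v y * im0 u y - im1 v y * re0 u y) (im1 u y * re0 v y - re1 u y * im0 v y).
  rewrite (_ : _ - _ + (_ - _) = im0 u y * re1 v y + re0 v y * im1 u y - (re0 u y * im1 v y + im0 v y * re1 u y)); last by ring.
  rewrite !mulrDr; lra.
rewrite int0D//; last by apply: locintZ; exact: locintD.
rewrite int0Z; last exact: locintD.
rewrite int0D// int0_cst//.
have CK : 0 <= C + K.
  have := nC 0; have := nK 0; rewrite lexx x0 => /(_ isT) h1 /(_ isT) h2.
  by have := normsq_ge0 u 0; have := normsq_ge0 v 0; lra.
have h1 : rho / 2 * (int0 (dnormsq u) x + int0 (dnormsq v) x) <= rho / 2 * (C + K).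
  by rewrite ler_wpM2l ?lerD//; lra.
have h2 : (2 * rho)^-1 * (C + K) * x <= (2 * rho)^-1 * (C + K) * rho ^+ 2.
  by rewrite ler_wpM2l// mulr_ge0// invr_ge0; lra.
have h3 : (2 * rho)^-1 * (C + K) * rho ^+ 2 = rho / 2 * (C + K) by field; lra.
lra.
Qed.

(** [als j] stands for the limit mass on link j, and s = Im (phi conj(D)). Subtracting its common
    vertex value s0 splits the right-hand side into the integral of (ramp s - s0) ws, treated by
    [cross_osc] up to rho^2 and by the tail bound beyond, and s0 times the mass defect. *)
Lemma graph_difference (As Bs ws f1 f2 : 'I_N -> R -> R) (phi psi : 'I_N -> jet R)
    (als : 'I_N -> R) (beta C rho Wn tau n0 : R) :
  (forall j, jet_sol (fun x => As j x + ws j x) (Bs j) (f1 j) (f2 j) (phi j)) ->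
  (forall j, jet_sol (As j) (Bs j) (f1 j) (f2 j) (psi j)) ->
  graph_bc l om phi -> graph_bc l om psi ->
  graph_vertex 0 phi -> graph_vertex (\sum_(j < N) als j) psi ->
  (forall j, locint (ws j)) ->
  (forall j x, 0 < x -> (x%:E < l j)%E -> Bs j x = beta) -> beta != 0 ->
  (forall j b, upto (l j) b -> [/\ int0 (normsq (phi j)) b <= C, int0 (dnormsq (phi j)) b <= C
     & forall x, 0 <= x <= b -> normsq (phi j) x <= C]) ->
  (forall j b, upto (l j) b -> [/\ int0 (normsq (psi j)) b <= C, int0 (dnormsq (psi j)) b <= C
     & forall x, 0 <= x <= b -> normsq (psi j) x <= C]) ->
  0 < rho -> (forall j b, upto (l j) b -> int0 (fun x => `|ws j x|) b <= Wn) ->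
  (forall j, locint (fun x => if x <= rho ^+ 2 then 0 else `|ws j x|)) ->
  (forall j b, upto (l j) b -> int0 (fun x => if x <= rho ^+ 2 then 0 else `|ws j x|) b <= tau) ->
  (forall j n, n0 <= n -> 4 <= n -> `|int0 (ws j) (b n j) - als j| <= tau) ->
  forall b', (forall j, upto (l j) (b' j)) ->
    \sum_(j < N) int0 (normsq (jet_sub (phi j) (psi j))) (b' j) <=
      `|beta|^-1 * (N%:R * (5 * C * rho * Wn + 15 / 2 * C * tau)).
Proof.
move=> sphi spsi bphi bpsi vphi vpsi lw Bl beta0 Hphi Hpsi r0 wW lt tW wal b' ub'.
have sD j := jet_sol_sub (sphi j) (spsi j).
pose D j := jet_sub (phi j) (psi j).
have bD : graph_bc l om D.
  move=> j b1 lj; have [h1 h2] := bphi j b1 lj; have [h3 h4] := bpsi j b1 lj.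
  have -> : bc_re (om j) (D j) b1 = bc_re (om j) (phi j) b1 - bc_re (om j) (psi j) b1.
    by rewrite /bc_re /=; ring.
  have -> : bc_im (om j) (D j) b1 = bc_im (om j) (phi j) b1 - bc_im (om j) (psi j) b1.
    by rewrite /bc_im /=; ring.
  by rewrite h1 h2 h3 h4 subrr.
have cD j : contp (normsq (D j)) by exact: contp_normsq (sD j).
have nDx j b1 x : upto (l j) b1 -> 0 <= x <= b1 -> normsq (D j) x <= 4 * C.
  move=> ub xb; have [_ _ h1] := Hphi j b1 ub; have [_ _ h2] := Hpsi j b1 ub.
  by have := normsq_sub (phi j) (psi j) x; have := h1 x xb; have := h2 x xb; rewrite -/(D j); lra.
have nD j b1 : upto (l j) b1 -> int0 (normsq (D j)) b1 <= 4 * C.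
  move=> ub; have [h1 _ _] := Hphi j b1 ub; have [h2 _ _] := Hpsi j b1 ub.
  have l1 := contp_locint (contp_normsq (sphi j)); have l2 := contp_locint (contp_normsq (spsi j)).
  apply: (@le_trans _ _ (int0 (fun x => 2 * normsq (phi j) x + 2 * normsq (psi j) x) b1)).
    apply: le_int0; [exact: contp_locint (cD j)|by apply: locintD; exact: locintZ|].
    by move=> x _; exact: normsq_sub.
  by rewrite (int0D _ (locintZ 2 l1) (locintZ 2 l2)) !int0Z//; lra.
have dD j b1 : upto (l j) b1 -> int0 (dnormsq (D j)) b1 <= 4 * C.
  move=> ub; have [_ h1 _] := Hphi j b1 ub; have [_ h2 _] := Hpsi j b1 ub.
  have l1 := contp_locint (contp_dnormsq (sphi j)); have l2 := contp_locint (contp_dnormsq (spsi j)).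
  apply: (@le_trans _ _ (int0 (fun x => 2 * dnormsq (phi j) x + 2 * dnormsq (psi j) x) b1)).
    apply: le_int0; [exact: contp_locint (contp_dnormsq (sD j))|by apply: locintD; exact: locintZ|].
    by move=> x _; exact: dnormsq_sub.
  by rewrite (int0D _ (locintZ 2 l1) (locintZ 2 l2)) !int0Z//; lra.
have C0 : 0 <= C.
  pose j0 : 'I_N := Ordinal N0; have [_ _ h] := Hphi j0 _ (ub' j0).
  have [b0 _] := ub' j0.
  by apply: le_trans (h 0 _); [exact: normsq_ge0|rewrite lexx ltW].
pose s j x := cross (phi j) (D j) x.
have [c1 [c2 [vc v1 v2]]] := vphi.
have [d1 [d2 [wc w1 w2]]] := vpsi.
pose s0 := c2 * (c1 - d1) - c1 * (c2 - d2).
have s00 j : s j 0 = s0.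
  by rewrite /s /cross /=; have [-> ->] := vc j; have [-> ->] := wc j.
(* The derivatives of D at the vertex sum to - alpha psi(0). As D conj(D) is real, psi(0) may be
   replaced by phi(0), so that the same quantity s appears at the vertex and under the integral. *)
have WD : \sum_(j < N) wronsk (D j) 0 = - \sum_(j < N) als j * s0.
  rewrite (eq_bigr (fun j => (im1 (phi j) 0 - im1 (psi j) 0) * (c1 - d1) -
      (re1 (phi j) 0 - re1 (psi j) 0) * (c2 - d2))); last first.
    by move=> j _; rewrite /wronsk /=; have [-> ->] := vc j; have [-> ->] := wc j.
  rewrite sumrB -!mulr_suml !sumrB v1 v2 w1 w2 /s0.
  by ring.
have sx j b1 x : upto (l j) b1 -> 0 <= x <= b1 -> `|s j x| <= 5 / 2 * C.
  move=> ub xb; apply: (le_trans (cross_le _ _ _)).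
  have [_ _ h1] := Hphi j b1 ub.
  have := nDx j b1 x ub xb; have := h1 x xb; lra.
have cs j : contp (s j) by exact: primitive_contp (primitive_cross (sphi j) (sD j)).
have m1 : 0 < `|beta| by rewrite normr_gt0.
have lf1 j : locint (fun x => - (re0 (phi j) x * ws j x)).
  by apply/locintN/contpM_locint => //; have [] := contp_jet (sphi j).
have lf2 j : locint (fun x => - (im0 (phi j) x * ws j x)).
  by apply/locintN/contpM_locint => //; have [] := contp_jet (sphi j).
(* |D|^2 <= 4 C, so |s| <= 5/2 C, and s oscillates by at most (C + 4 C) rho. The factor 15/2 is 5
   from the tail plus 5/2 from the mass defect. *)
pose Q := 5 * C * rho * Wn + 15 / 2 * C * tau.
apply: (@weighted_limit D _ (`|beta|^-1 * (N%:R * (5 / 2 * C * rho ^+ 2 * Wn) + N%:R * ((4 * C + 4 * C) / 2))) n0) => // n nn n4.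
have h := graph_im sD bD lf1 lf2 Bl nD dD n4.
rewrite -/D WD in h.
set G := \sum_(j < N) int0 (fun x => ramp (c n j) x * (im0 (D j) x * - (re0 (phi j) x * ws j x) -
   re0 (D j) x * - (im0 (phi j) x * ws j x))) (b n j) in h.
set S := \sum_(j < N) int0 (fun x => ramp (c n j) x * normsq (D j) x) (b n j) in h *.
have hG : `|G - \sum_(j < N) als j * s0| <= N%:R * (Q + 5 / 2 * C * rho ^+ 2 * Wn * n^-1).
  rewrite /G -sumrB; apply: (le_trans (ler_norm_sum _ _ _)).
  rewrite [leRHS](_ : _ = \sum_(j < N) (Q + 5 / 2 * C * rho ^+ 2 * Wn * n^-1)); last first.
    by rewrite sumr_const card_ord -[RHS]mulr_natl.
  apply: ler_sum => j _.
  have [ubn /andP[cj0 cj4] cjn cb _] := cut_bounds (l0 j) n4.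
  have [b0 bl] := ubn.
  have s0C : `|s0| <= 5 / 2 * C by rewrite -(s00 j); apply: (sx j _ 0 ubn); rewrite lexx ltW.
  have ce : contp (ramp (c n j)) by exact: contp_ramp.
  have lsw : locint (fun x => (ramp (c n j) x * s j x) * ws j x).
    by apply: contpM_locint => //; exact: contpM.
  have -> : int0 (fun x => ramp (c n j) x * (im0 (D j) x * - (re0 (phi j) x * ws j x) -
      re0 (D j) x * - (im0 (phi j) x * ws j x))) (b n j) - als j * s0 =
      int0 (fun x => (ramp (c n j) x * s j x) * ws j x - s0 * ws j x) (b n j) +
      s0 * (int0 (ws j) (b n j) - als j).
    rewrite (int0B _ lsw (locintZ s0 (lw j))) (int0Z _ _ (lw j)).
    rewrite [X in X - _](_ : _ = int0 (fun x => ramp (c n j) x * s j x * ws j x) (b n j)); last first.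
      by apply: eq_Rintegral => x _; rewrite /s /cross; ring.
    by ring.
  apply: (le_trans (ler_normD _ _)).
  have hs : `|s0 * (int0 (ws j) (b n j) - als j)| <= 5 / 2 * C * tau.
    by rewrite normrM ler_pM// wal.
  suff : `|int0 (fun x => (ramp (c n j) x * s j x) * ws j x - s0 * ws j x) (b n j)| <=
    (5 * C * rho + 5 / 2 * C * rho ^+ 2 * n^-1) * Wn + 5 * C * tau by rewrite /Q; lra.
  have lk : locint (fun x => (ramp (c n j) x * s j x) * ws j x - s0 * ws j x).
    by apply: locintB => //; exact: locintZ.
  have := @le_norm_int0 _ _ 0 (b n j) lk; rewrite lexx (ltW b0) !int0_0 !subr0 => /(_ isT) h'.
  apply: (le_trans h') => {h'}.
  have lnw := locint_norm (lw j).
  have n1 : 0 < n^-1 by rewrite invr_gt0; lra.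
  have k0 : 0 <= 5 * C * rho + 5 / 2 * C * rho ^+ 2 * n^-1.
    by rewrite addr_ge0 ?mulr_ge0// ?ltW//.
  apply: (@le_trans _ _ (int0 (fun x => (5 * C * rho + 5 / 2 * C * rho ^+ 2 * n^-1) * `|ws j x| +
      5 * C * (if x <= rho ^+ 2 then 0 else `|ws j x|)) (b n j))); last first.
    rewrite (int0D _ (locintZ _ lnw) (locintZ _ (lt j))) (int0Z _ _ lnw) (int0Z _ _ (lt j)).
    by rewrite lerD// ler_wpM2l ?wW ?tW//; lra.
  apply: le_int0; [exact: locint_norm|by apply: locintD; exact: locintZ|].
  move=> x /andP[x0 xb].
  have xb' : 0 <= x <= b n j by rewrite !ltW.
  have /andP[e0 e1] : 0 <= ramp (c n j) x <= 1 by apply: (ramp_bounds cj0 cb).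
  rewrite -mulrBl normrM.
  have sC := sx j _ x ubn xb'.
  case: ifPn => [xr|_].
    rewrite mulr0 addr0 ler_wpM2r//.
    have -> : ramp (c n j) x * s j x - s0 = (s j x - s j 0) - c n j * x * s j x.
      by rewrite s00 /ramp; ring.
    apply: (le_trans (ler_normB _ _)); apply: lerD.
      have -> : 5 * C * rho = (C + 4 * C) * rho by ring.
      have mon (v : jet R) : (forall y, 0 < y -> 0 <= dnormsq v y) -> contp (dnormsq v) ->
          int0 (dnormsq v) x <= int0 (dnormsq v) (b n j).
        by move=> v0 cv; apply: int0_nd => //; exact: contp_locint.
      have [_ hd hn] := Hphi j _ ubn.
      apply: (cross_osc (sphi j) (sD j) r0); first by rewrite ltW.
      - apply: le_trans hd; apply: mon; first by move=> y _; exact: dnormsq_ge0.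
        exact: contp_dnormsq (sphi j).
      - apply: le_trans (dD j _ ubn); apply: mon; first by move=> y _; exact: dnormsq_ge0.
        exact: contp_dnormsq (sD j).
      - by move=> y /andP[y0 yx]; apply: hn; rewrite y0 (le_trans yx)// ltW.
      - by move=> y /andP[y0 yx]; apply: (nDx j _ y ubn); rewrite y0 (le_trans yx)// ltW.
    rewrite !normrM (ger0_norm cj0) (ger0_norm (ltW x0)).
    have -> : 5 / 2 * C * rho ^+ 2 * n^-1 = n^-1 * rho ^+ 2 * (5 / 2 * C) by ring.
    by apply: ler_pM => //; [rewrite mulr_ge0// ltW|apply: ler_pM => //; exact: ltW].
  have : `|ramp (c n j) x * s j x - s0| <= 5 * C.
    apply: (le_trans (ler_normB _ _)); rewrite normrM (ger0_norm e0).
    have : ramp (c n j) x * `|s j x| <= 1 * `|s j x| by rewrite ler_wpM2r.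
    lra.
  move/(ler_wpM2r (normr_ge0 (ws j x))) => h'; apply: (le_trans h').
  by rewrite lerDr mulr_ge0.
have hS : `|beta| * S <= N%:R * (Q + 5 / 2 * C * rho ^+ 2 * Wn * n^-1) + N%:R * ((4 * C + 4 * C) / 2) * n^-1.
  have S0 : 0 <= S.
    apply: sumr_ge0 => j _.
    have [ubn /andP[cj0 cj4] cjn cb _] := cut_bounds (l0 j) n4.
    apply: int0_ge0 => [|x /andP[x0 xb]].
      by apply: contpM_locint; [exact: contp_ramp|exact: contp_locint (cD j)].
    have /andP[e0 _] : 0 <= ramp (c n j) x <= 1 by apply: (ramp_bounds cj0 cb); rewrite !ltW.
    by rewrite mulr_ge0 ?normsq_ge0.
  rewrite -[X in `|beta| * X](ger0_norm S0) -normrM.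
  have := ler_normD (beta * S - (- (\sum_(j < N) als j * s0) + G)) (G - \sum_(j < N) als j * s0).
  rewrite (_ : beta * S - (- (\sum_(j < N) als j * s0) + G) + (G - \sum_(j < N) als j * s0) = beta * S); last by ring.
  lra.
rewrite -(ler_pM2l m1); apply: (le_trans hS); rewrite le_eqVlt; apply/orP; left; apply/eqP.
rewrite /Q; by field; rewrite gt_eqF//; lra.
Qed.

End GraphResolvent.

(** * Correspondence between jets and functions on a link *)

Section Link.
Variable R : realType.
Implicit Types (f g : R -> R) (b c x : R) (l : \bar R).
Local Notation mu := (@lebesgue_measure R).
Local Notation normc := (@ComplexField.Normc.normc R).

Lemma link_fin b : link b%:E = `]0, b[%classic.
Proof. by apply/seteqP; split => x /=; rewrite /link /= in_itv/= lte_fin => /andP. Qed.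

Lemma link_pinfty : link (+oo%E : \bar R) = `]0, +oo[%classic.
Proof.
apply/seteqP; split => x /=; rewrite /link /= in_itv/= andbT; first by case.
by move=> x0; rewrite ltry.
Qed.

Lemma link_itv l : (0 < l)%E -> exists i : interval R, link l = [set` i].
Proof.
case: l => [b _|_|//]; first by exists `]0, b[; exact: link_fin.
by exists `]0, +oo[; exact: link_pinfty.
Qed.

Lemma measurable_link l : (0 < l)%E -> measurable (link l).
Proof. by move=> /link_itv[i ->]. Qed.

Lemma open_link l : (0 < l)%E -> open (link l).
Proof.
case: l => [b _|_|//]; first by rewrite link_fin; exact: interval_open.
by rewrite link_pinfty; exact: interval_open.
Qed.

Lemma upto_link l b x : upto l b -> 0 < x < b -> link l x.
Proof.
move=> [_ bl] /andP[x0 xb]; split => //.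
by apply: lt_le_trans bl; rewrite lte_fin.
Qed.

Lemma link_upto l x : link l x -> exists2 b, upto l b & 0 < x < b.
Proof.
move=> [x0]; case: l => [b|_|//].
  by rewrite lte_fin => xb; exists b; [split => //; exact: lt_trans xb|rewrite x0].
by exists (x + 1); [split; [lra|rewrite leey]|lra].
Qed.

Lemma locint_link f l : (0 < l)%E -> loc_integrable l f -> locint (f \_ (link l)).
Proof.
move=> l0 lf c.
have mL := measurable_link l0.
have [c0|c0] := leP c 0.
  apply: integrable_oo_cc; rewrite set_itv_ge ?bnd_simp -?leNgt//.
  exact: integrable_set0.
case: l l0 lf mL => [b|_|//].
  rewrite lte_fin => b0 lf mL.
  have ib : mu.-integrable setT (EFin \o (f \_ (link b%:E))).
    rewrite -restrict_EFin; apply/integrable_restrict => //; rewrite setTI link_fin.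
    exact: lf.
  by apply: (@integrableS _ _ R mu setT).
move=> lf mL; apply: integrable_oo_cc.
apply: (@eq_integrable _ _ R mu _ (measurable_itv _) (EFin \o f)).
  move=> x; rewrite inE/= in_itv/= => /andP[x0 _].
  by rewrite patchE mem_set//; split => //; rewrite ltry.
by apply: lf => //; rewrite leey.
Qed.

Lemma integrable_loc f l : (0 < l)%E -> mu.-integrable (link l) (EFin \o f) ->
  loc_integrable l f.
Proof.
move=> l0 intf c c0 cl.
apply: (@integrableS _ _ R mu (link l)) => //; first exact: measurable_link.
by move=> x /=; rewrite in_itv/=; apply: upto_link.
Qed.

Lemma int0E g b : locint g -> (int0 g b)%:E = (\int[mu]_(t in `[0%R, b]) (g t)%:E)%E.
Proof. by move=> lg; rewrite fineK//; apply: integrable_fin_num => //; exact: lg. Qed.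

Lemma int0_oo g b : locint g -> (int0 g b)%:E = (\int[mu]_(t in `]0%R, b[) (g t)%:E)%E.
Proof.
move=> lg; rewrite int0E//.
have mg : measurable_fun `[0, b] (EFin \o g) by exact: (measurable_int mu (lg b)).
rewrite -integral_itv_obnd_cbnd; last first.
  by apply: measurable_funS mg => //; apply: subset_itv; rewrite bnd_simp.
rewrite -integral_itv_bndo_bndc//.
by apply: measurable_funS mg => //; apply: subset_itv; rewrite bnd_simp.
Qed.

Lemma link_integral_le g l (X : R) : (0 < l)%E -> locint g -> (forall x, 0 <= g x) ->
  (forall b, upto l b -> int0 g b <= X) -> (\int[mu]_(x in link l) (g x)%:E <= X%:E)%E.
Proof.
move=> l0 lg g0; case: l l0 => [b|_ H|//].
  rewrite lte_fin => b0 H; rewrite link_fin -int0_oo// lee_fin; apply: H.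
  by split.
have -> : link (+oo%E : \bar R) = \bigcup_n `]0%R, n.+1%:R[%classic.
  rewrite link_pinfty; apply/seteqP; split => x /=.
    rewrite in_itv/= andbT => x0; exists (Num.bound x) => //=.
    rewrite in_itv/= x0/= (lt_trans (archi_boundP (ltW x0)))// ltr_nat.
    exact: ltnSn.
  by move=> [n _] /=; rewrite !in_itv/= => /andP[->].
have mon : {homo (fun n : nat => `]0%R, n.+1%:R[%classic : set R) : n m / (n <= m)%N >-> (n <= m)%O}.
  move=> n m nm; apply/subsetPset => x /=; rewrite !in_itv/= => /andP[-> xn]/=.
  by rewrite (lt_le_trans xn)// ler_nat.
have mf n : measurable_fun (`]0%R, n.+1%:R[%classic : set R) (fun x => (g x)%:E).
  have mg : measurable_fun (`[0%R, n.+1%:R]%classic : set R) (EFin \o g).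
    exact: (measurable_int mu (lg _)).
  by apply: measurable_funS mg => //; apply: subset_itv; rewrite bnd_simp.
have h : (\int[mu]_(x in (`]0%R, n.+1%:R[%classic : set R)) (g x)%:E)%E @[n --> \oo] -->
    (\int[mu]_(x in \bigcup_n (`]0%R, n.+1%:R[%classic : set R)) (g x)%:E)%E.
  by apply: ge0_nondecreasing_set_cvg_integral => // n x _; rewrite lee_fin.
apply: (cvge_le _ h); near=> n; rewrite -int0_oo// lee_fin.
by apply: H; split => //; rewrite leey.
Unshelve. all: by end_near. Qed.

Lemma int0_le_link g (h : R -> R) l b : (0 < l)%E -> upto l b -> locint g ->
  measurable_fun (link l) h -> (forall x, link l x -> 0 <= h x) ->
  (forall x, link l x -> g x = h x) ->
  ((int0 g b)%:E <= \int[mu]_(x in link l) (h x)%:E)%E.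
Proof.
move=> l0 ub lg mh h0 gh; rewrite int0_oo//.
have sub : `]0, b[ `<=` link l.
  by move=> x /=; rewrite in_itv/=; apply: upto_link.
have -> : (\int[mu]_(x in `]0%R, b[) (g x)%:E = \int[mu]_(x in `]0%R, b[) (h x)%:E)%E.
  by apply: eq_integral => x; rewrite inE/= => /sub/gh ->.
apply: ge0_subset_integral => //; first exact: measurable_link.
  exact/measurable_EFinP.
Qed.

Lemma normc_sq (z : R[i]) : normc z ^+ 2 = complex.Re z ^+ 2 + complex.Im z ^+ 2.
Proof. by case: z => p q; rewrite /= sqr_sqrtr// addr_ge0 ?sqr_ge0. Qed.

Lemma normc_nneg (z : R[i]) : 0 <= normc z.
Proof. by case: z => p q /=; rewrite sqrtr_ge0. Qed.

Lemma Re_le_normc (z : R[i]) : `|complex.Re z| <= normc z.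
Proof.
rewrite -(@ler_pXn2r _ 2)// ?nnegrE ?normc_nneg//.
by rewrite real_normK ?num_real// normc_sq lerDl sqr_ge0.
Qed.

Lemma Im_le_normc (z : R[i]) : `|complex.Im z| <= normc z.
Proof.
rewrite -(@ler_pXn2r _ 2)// ?nnegrE ?normc_nneg//.
by rewrite real_normK ?num_real// normc_sq lerDr sqr_ge0.
Qed.

Lemma normc_le_sum (z : R[i]) : normc z <= `|complex.Re z| + `|complex.Im z|.
Proof.
rewrite -(@ler_pXn2r _ 2)// ?nnegrE ?normc_nneg ?addr_ge0//.
rewrite normc_sq sqrrD !real_normK ?num_real// lerD2r lerDl.
by rewrite mulrn_wge0// mulr_ge0.
Qed.

(** Local integrability follows from |p| <= 1 + p^2 + q^2 on bounded intervals. *)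
Lemma L2_link l (u : R -> R[i]) : (0 < l)%E -> L2 (link l) u ->
  [/\ locint (reC u \_ (link l)), locint (imC u \_ (link l)),
      locint (fun x => (reC u \_ (link l)) x ^+ 2 + (imC u \_ (link l)) x ^+ 2) &
      forall b, upto l b ->
        ((int0 (fun x => (reC u \_ (link l)) x ^+ 2 + (imC u \_ (link l)) x ^+ 2) b)%:E
          <= sqnormL2 (link l) u)%E].
Proof.
move=> l0 [mr mi fin].
have mL := measurable_link l0.
pose h x := reC u x ^+ 2 + imC u x ^+ 2.
have hE x : normc (u x) ^+ 2 = h x by rewrite normc_sq.
have mh : measurable_fun (link l) h.
  by apply: measurable_funD; exact: measurable_funX.
have ih : mu.-integrable (link l) (EFin \o h).
  apply/integrableP; split; first exact/measurable_EFinP.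
  apply: le_lt_trans fin; rewrite /sqnormL2 le_eqVlt; apply/orP; left; apply/eqP.
  apply: eq_integral => x _ /=; rewrite ger0_norm ?hE//.
  by rewrite /h addr_ge0 ?sqr_ge0.
have loc (k : R -> R) : measurable_fun (link l) k ->
    (forall x, link l x -> `|k x| <= 1 + h x) -> loc_integrable l k.
  move=> mk kh c c0 cl.
  have sub : `]0, c[ `<=` link l by move=> x /=; rewrite in_itv/=; apply: upto_link.
  apply: (@le_integrable _ _ R mu _ (measurable_itv _) (EFin \o k) (EFin \o (fun x => 1 + h x))).
  - by apply/measurable_EFinP; apply: measurable_funS mk.
  - move=> x /sub/kh kx /=; rewrite lee_fin; apply: (le_trans kx); exact: ler_norm.
  - apply: (@integrableD _ _ R mu _ (measurable_itv _) (EFin \o cst 1) (EFin \o h)).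
      have := @locint_cst R 1 c; apply: integrableS => //.
      by apply: subset_itv; rewrite bnd_simp.
    exact: integrableS ih.
have h0 x : 0 <= h x by rewrite addr_ge0 ?sqr_ge0.
have bound (p q : R) : `|p| <= 1 + (p ^+ 2 + q ^+ 2).
  have := sqr_ge0 q; have := sqr_ge0 (`|p| - 1); rewrite -(real_normK (num_real p)).
  have := normr_ge0 p; nra.
have lh : locint (fun x => (reC u \_ (link l)) x ^+ 2 + (imC u \_ (link l)) x ^+ 2).
  have := locint_link l0 (integrable_loc l0 ih); apply: eq_locint => x _.
  by rewrite !patchE; case: ifP => // _; rewrite expr0n addr0.
split => //.
- apply: locint_link => //; apply: loc => // x _; exact: bound.
- apply: locint_link => //; apply: loc => // x _; rewrite /h [reC u x ^+ 2 + _]addrC; exact: bound.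
- move=> b ub; apply: (le_trans (int0_le_link (h := h) l0 ub lh mh _ _)) => //.
    by move=> x lx; rewrite !patchE mem_set.
  rewrite /sqnormL2 le_eqVlt; apply/orP; left; apply/eqP.
  by apply: eq_integral => x _; rewrite hE.
Qed.

End Link.

(** * Solutions in the almost everywhere sense as jets, and conversely *)

Section Representation.
Variable R : realType.
Implicit Types (f g v A B F : R -> R) (b c x : R) (l : \bar R) (z : R[i]) (u : R -> R[i]).
Local Notation mu := (@lebesgue_measure R).
Local Notation normc := (@ComplexField.Normc.normc R).

(** From the midpoint every point is reached in a bounded number of steps of length d / 2, each
    changing f by less than 1. *)
Lemma ac_oo_bounded c f : 0 < c -> ac_oo 0 c f ->
  exists M : R, forall x, 0 < x < c -> `|f x| <= M.
Proof.
move=> c0 acf; have [d d0 Hd] := acf 1 ltr01.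
have step x y : 0 < x -> x <= y -> y < c -> y - x < d -> `|f y - f x| < 1.
  move=> x0 xy yc yx.
  have := Hd 1%N (fun=> x) (fun=> y); rewrite !big_ord1; apply => //.
  by apply/trivIsetP => i j _ _; rewrite !ord1 eqxx.
have step' x y : 0 < x < c -> 0 < y < c -> `|y - x| < d -> `|f y - f x| < 1.
  move=> xc yc; have [xy|yx] := leP x y.
    by rewrite ger0_norm ?subr_ge0// => h; apply: step => //; lra.
  by rewrite distrC gtr0_norm ?subr_gt0// => h; rewrite distrC; apply: step => //; lra.
pose x0 := c / 2.
have walk (k : nat) x : 0 < x < c -> `|x - x0| <= k%:R * (d / 2) -> `|f x - f x0| <= k%:R.
  elim: k x => [|k IH] x xc.
    by rewrite mul0r normr_le0 subr_eq0 => /eqP ->; rewrite subrr normr0.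
  move=> xk.
  have [small|large] := leP `|x - x0| (d / 2).
    have h : `|f x - f x0| < 1 by apply: step' => //; [rewrite /x0; lra|lra].
    by apply: le_trans (ltW h) _; rewrite ler1n.
  have [xx|xx] := leP x0 x.
    rewrite ger0_norm ?subr_ge0// in xk large.
    have yc : 0 < x - d / 2 < c by rewrite /x0 in large; lra.
    have h1 : `|f x - f (x - d / 2)| < 1.
      by apply: step' => //; rewrite opprB addrC subrK ger0_norm; lra.
    have h2 : `|f (x - d / 2) - f x0| <= k%:R.
      by apply: IH => //; rewrite ger0_norm; rewrite -natr1 in xk; lra.
    rewrite -natr1.
    have := ler_normD (f x - f (x - d / 2)) (f (x - d / 2) - f x0).
    by rewrite addrA subrK; lra.
  rewrite ltr0_norm ?subr_lt0// in xk large.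
  have yc : 0 < x + d / 2 < c by rewrite /x0 in large; lra.
  have h1 : `|f x - f (x + d / 2)| < 1.
    by apply: step' => //; rewrite opprD addrA subrr sub0r normrN ger0_norm; lra.
  have h2 : `|f (x + d / 2) - f x0| <= k%:R.
    apply: IH => //; rewrite ler0_norm; rewrite -natr1 in xk; lra.
  rewrite -natr1.
  have := ler_normD (f x - f (x + d / 2)) (f (x + d / 2) - f x0).
  by rewrite addrA subrK; lra.
pose k := Num.bound (c / (d / 2)).
exists (k%:R + `|f x0|) => x xc.
have h : `|f x - f x0| <= k%:R.
  apply: walk => //.
  have kc : c / (d / 2) < k%:R by apply: archi_boundP; rewrite divr_ge0//; lra.
  rewrite ltr_pdivrMr in kc; last by lra.
  by rewrite ler_norml /x0; lra.
have := ler_normD (f x - f x0) (f x0); rewrite subrK; lra.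
Qed.

(** On the open link [p] has no distinguished value at 0; the integral of [h], normalised at an
    inner point [x0], supplies one. *)
Lemma extend_primitive l p h : (0 < l)%E ->
  (forall c, 0 < c -> (c%:E <= l)%E -> ac_oo 0 c p) -> locint h ->
  {ae mu, forall x, link l x -> is_derive x (1 : R) p (h x)} ->
  exists2 P, primitive P h & forall x, link l x -> p x = P x.
Proof.
move=> l0 acp lh dp.
have [x0 lx0] : exists x0, link l x0.
  case: l l0 {acp dp} => [b|_|//].
    by rewrite lte_fin => b0; exists (b / 2); split; rewrite ?lte_fin; lra.
  by exists 1; split; rewrite ?ltr01 ?ltry.
exists (fun x => p x0 - int0 h x0 + int0 h x).
  split => // x x0'; rewrite int0_0 addr0//.
move=> x lx.
have key y1 y2 : link l y1 -> link l y2 -> y1 <= y2 -> p y2 - int0 h y2 = p y1 - int0 h y1.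
  move=> l1 l2 y12; have [b [b0 bl] /andP[y20 y2b]] := link_upto l2.
  apply: (@ac_oo_primitive _ b) => //; [exact: acp|apply: filterS dp|by case: l1].
    exact: (ae_filter_ringOfSetsType mu).
  by move=> t Ht tb; apply: Ht; apply: (@upto_link _ l b).
have [xx|xx] := leP x0 x.
  by have := key x0 x lx0 lx xx; lra.
by have := key x x0 lx lx0 (ltW xx); lra.
Qed.

Definition represents l (U : jet R) u : Prop := forall x, link l x ->
  [/\ reC u x = re0 U x, imC u x = im0 U x,
      derive1 (reC u) x = re1 U x & derive1 (imC u) x = im1 U x].

Lemma abs_continuous_Re a b u : abs_continuous_oo a b u -> ac_oo a b (reC u).
Proof.
move=> acu e e0; have [d d0 Hd] := acu e e0; exists d => // n p q pq tr s.
apply: le_lt_trans (Hd n p q pq tr s); apply: ler_sum => i _.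
have -> : reC u (q i) - reC u (p i) = complex.Re (u (q i) - u (p i)).
  by rewrite /reC; case: (u (q i)) (u (p i)) => ? ? [].
exact: Re_le_normc.
Qed.

Lemma abs_continuous_Im a b u : abs_continuous_oo a b u -> ac_oo a b (imC u).
Proof.
move=> acu e e0; have [d d0 Hd] := acu e e0; exists d => // n p q pq tr s.
apply: le_lt_trans (Hd n p q pq tr s); apply: ler_sum => i _.
have -> : imC u (q i) - imC u (p i) = complex.Im (u (q i) - u (p i)).
  by rewrite /imC; case: (u (q i)) (u (p i)) => ? ? [].
exact: Im_le_normc.
Qed.

Lemma ac_oo_complex a b F g u : ac_oo a b F -> ac_oo a b g ->
  (forall x, a < x < b -> reC u x = F x /\ imC u x = g x) -> abs_continuous_oo a b u.
Proof.
move=> aF ag uE e e0.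
have e2 : 0 < e / 2 by rewrite divr_gt0.
have [d1 d10 H1] := aF _ e2; have [d2 d20 H2] := ag _ e2.
exists (Num.min d1 d2); first by rewrite lt_min d10.
move=> n p q pq tr; rewrite lt_min => /andP[s1 s2].
have := H1 n p q pq tr s1; have := H2 n p q pq tr s2.
have : \sum_(i < n) normc (u (q i) - u (p i)) <=
    \sum_(i < n) `|F (q i) - F (p i)| + \sum_(i < n) `|g (q i) - g (p i)|.
  rewrite -big_split/=; apply: ler_sum => i _.
  have [p0 p1 q1] := pq i.
  have [Fq gq] := uE (q i) ltac:(lra); have [Fp gp] := uE (p i) ltac:(lra).
  apply: (le_trans (normc_le_sum _)); rewrite -Fq -gq -Fp -gp /reC /imC.
  by case: (u (q i)) (u (p i)) => ? ? [].
lra.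
Qed.

Section Equation.
Variables (l : \bar R) (v : R -> R) (f : R -> R[i]) (z : R[i]) (A B f1 f2 : R -> R).
Hypotheses (l0 : (0 < l)%E) (lA : loc_integrable l A) (lf1 : locint f1) (lf2 : locint f2)
  (A0 : forall x, ~ link l x -> A x = 0) (B0 : forall x, ~ link l x -> B x = 0)
  (f10 : forall x, ~ link l x -> f1 x = 0) (f20 : forall x, ~ link l x -> f2 x = 0)
  (Av : {ae mu, forall x, link l x -> A x = v x - complex.Re z})
  (Bz : forall x, link l x -> B x = complex.Im z)
  (f1f : forall x, link l x -> f1 x = reC f x)
  (f2f : forall x, link l x -> f2 x = imC f x).

(** Absolute continuity makes u bounded up to the ends, so A u is integrable there. Hence u' extends
    to a primitive on the half-line, and then u to a primitive of that extension. *)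
Lemma jet_of_solution u : schrodinger_eq l v u (fun x => f x + z * u x) ->
  exists2 U, jet_sol A B f1 f2 U & represents l U u.
Proof.
move=> [du acu acdu eqn].
have du_cont x : link l x -> {for x, continuous (reC u)} /\ {for x, continuous (imC u)}.
  move=> /du[d1 d2]; split; apply: differentiable_continuous; exact/derivable1_diffP.
have lAh (k : R -> R) : {in link l, continuous k} ->
    (forall c, 0 < c -> (c%:E <= l)%E -> ac_oo 0 c k) ->
    loc_integrable l (fun x => k x * A x) /\ loc_integrable l k.
  move=> ck ack.
  have H c : 0 < c -> (c%:E <= l)%E -> measurable_fun `]0, c[ k /\ [bounded k x | x in `]0, c[%classic].
    move=> c0 cl; split.
      apply: (@measurable_funS _ _ _ _ (link l)) => //; first exact: measurable_link.
        by move=> x /=; rewrite in_itv/=; apply: upto_link.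
      by apply: open_continuous_measurable_fun => //; exact: open_link.
    have [M HM] := ac_oo_bounded c0 (ack c c0 cl).
    exists M; split; first exact: num_real.
    by move=> y My x /=; rewrite in_itv/= => /HM xM; rewrite (le_trans xM)// ltW.
  split=> c c0 cl; have [mk bk] := H c c0 cl.
    exact: (@integrableMr _ _ R mu _ (measurable_itv _) k (EFin \o A) mk bk (lA c0 cl)).
  have i1 : mu.-integrable `]0, c[ (EFin \o cst 1).
    by have := @locint_cst R 1 c; apply: integrableS => //; apply: subset_itv; rewrite bnd_simp.
  have := @integrableMr _ _ R mu _ (measurable_itv _) k (EFin \o cst 1) mk bk i1.
  by apply: (@eq_integrable _ _ R mu _ (measurable_itv _)) => x _ /=; rewrite mule1.
have cre : {in link l, continuous (reC u)} by move=> x; rewrite inE => /du_cont[].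
have cim : {in link l, continuous (imC u)} by move=> x; rewrite inE => /du_cont[].
have acre c : 0 < c -> (c%:E <= l)%E -> ac_oo 0 c (reC u).
  by move=> c0 cl; apply: abs_continuous_Re; exact: acu.
have acim c : 0 < c -> (c%:E <= l)%E -> ac_oo 0 c (imC u).
  by move=> c0 cl; apply: abs_continuous_Im; exact: acu.
have [/(locint_link l0) lAr /(locint_link l0) lr] := lAh _ cre acre.
have [/(locint_link l0) lAi /(locint_link l0) li] := lAh _ cim acim.
pose zi := complex.Im z.
pose h1 x := ((fun x => reC u x * A x) \_ (link l)) x + zi * (imC u \_ (link l)) x - f1 x.
pose h2 x := ((fun x => imC u x * A x) \_ (link l)) x - zi * (reC u \_ (link l)) x - f2 x.
have lh1 : locint h1 by apply: locintB => //; apply: locintD => //; exact: locintZ.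
have lh2 : locint h2 by apply: locintB => //; apply: locintB => //; exact: locintZ.
have dre : {ae mu, forall x, link l x -> is_derive x (1 : R) (derive1 (reC u)) (h1 x) /\
    is_derive x (1 : R) (derive1 (imC u)) (h2 x)}.
  move: eqn Av; apply: filterS2; first exact: (ae_filter_ringOfSetsType mu).
  move=> x H1 H2 lx; have [[d1 d2] E] := H1 lx; have Ax := H2 lx.
  have [e1 e2] : - derive1 (reC (cderive u)) x + v x * reC u x =
      reC f x + (complex.Re z * reC u x - complex.Im z * imC u x) /\
    - derive1 (imC (cderive u)) x + v x * imC u x =
      imC f x + (complex.Re z * imC u x + complex.Im z * reC u x).
    move: E; rewrite {1}/cderive.
    move: (derive1 (reC (cderive u)) x) (derive1 (imC (cderive u)) x) => p q.
    rewrite /reC /imC; case: (u x) (f x) (z) => r s [r' s'] [a b] E.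
    have := congr1 (@complex.Re R) E; have := congr1 (@complex.Im R) E.
    by rewrite /= => E2 E1; split; lra.
  have -> : h1 x = derive1 (reC (cderive u)) x.
    rewrite /h1 !patchE (mem_set lx) (f1f lx) Ax /zi.
    by move: (derive1 (reC (cderive u)) x) e1 => d /eqP; rewrite -subr_eq0 => /eqP E1; lra.
  have -> : h2 x = derive1 (imC (cderive u)) x.
    rewrite /h2 !patchE (mem_set lx) (f2f lx) Ax /zi.
    by move: (derive1 (imC (cderive u)) x) e2 => d /eqP; rewrite -subr_eq0 => /eqP E1; lra.
  by rewrite !derive1E; split; apply: DeriveDef; [exact: d1| |exact: d2|].
have [P1 pP1 eP1] : exists2 P, primitive P h1 & forall x, link l x -> derive1 (reC u) x = P x.
  apply: extend_primitive => //.
    by move=> c c0 cl; apply: (abs_continuous_Re (u := cderive u)); exact: acdu.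
  by apply: filterS dre; [exact: (ae_filter_ringOfSetsType mu)|move=> x H /H[]].
have [P2 pP2 eP2] : exists2 P, primitive P h2 & forall x, link l x -> derive1 (imC u) x = P x.
  apply: extend_primitive => //.
    by move=> c c0 cl; apply: (abs_continuous_Im (u := cderive u)); exact: acdu.
  by apply: filterS dre; [exact: (ae_filter_ringOfSetsType mu)|move=> x H /H[]].
have [U1 pU1 eU1] : exists2 P, primitive P P1 & forall x, link l x -> reC u x = P x.
  apply: extend_primitive => //; first exact: primitive_locint pP1.
  apply: aeW => x lx; have [d1 _] := du x lx; apply: DeriveDef => //.
  by rewrite -derive1E eP1.
have [U2 pU2 eU2] : exists2 P, primitive P P2 & forall x, link l x -> imC u x = P x.
  apply: extend_primitive => //; first exact: primitive_locint pP2.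
  apply: aeW => x lx; have [_ d1] := du x lx; apply: DeriveDef => //.
  by rewrite -derive1E eP2.
exists (Jet U1 U2 P1 P2); last by move=> x lx; split => /=; [exact: eU1|exact: eU2|exact: eP1|exact: eP2].
split => //=.
- apply: eq_primitive pP1 _ => x; rewrite /h1 !patchE.
  have [lx|lx] := pselect (link l x); first by rewrite (mem_set lx) (Bz lx) (eU1 _ lx) (eU2 _ lx) /zi; ring.
  by rewrite (memNset lx) (_ : point = 0)// (f10 lx) (A0 lx) (B0 lx); ring.
- apply: eq_primitive pP2 _ => x; rewrite /h2 !patchE.
  have [lx|lx] := pselect (link l x); first by rewrite (mem_set lx) (Bz lx) (eU1 _ lx) (eU2 _ lx) /zi; ring.
  by rewrite (memNset lx) (_ : point = 0)// (f20 lx) (A0 lx) (B0 lx); ring.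
Qed.

Definition jet_fun (U : jet R) : R -> R[i] := fun x => (re0 U x +i* im0 U x)%C.

Lemma jet_fun_represents U : jet_sol A B f1 f2 U ->
  represents l U (jet_fun U) /\ forall x, link l x -> cderivable (jet_fun U) x.
Proof.
move=> sU; have [p1 p2 _ _] := sU; have [_ _ c1 c2] := contp_jet sU.
split=> x [x0 _]; have D1 := primitive_derive p1 c1 x0; have D2 := primitive_derive p2 c2 x0.
  split => //; rewrite derive1E; exact: derive_val.
split; exact: ex_derive.
Qed.

Lemma solution_of_jet U : jet_sol A B f1 f2 U ->
  schrodinger_eq l v (jet_fun U) (fun x => f x + z * jet_fun U x).
Proof.
move=> sU; have [rU dU] := jet_fun_represents sU.
have [p1 p2 p3 p4] := sU.
have dE (k : R -> R) (P : R -> R) x (y : R) : (forall x, link l x -> k x = P x) -> link l x ->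
    is_derive x (1 : R) P y -> is_derive x (1 : R) k y.
  move=> kP lx; apply: near_eq_is_derive.
  have : \forall t \near x, link l t by apply: open_nbhs_nbhs; split => //; exact: open_link.
  by apply: filterS => t /kP.
split => //.
- move=> c c0 cl; apply: (ac_oo_complex (primitive_ac c p1) (primitive_ac c p2)).
  by move=> x xc.
- move=> c c0 cl; apply: (ac_oo_complex (primitive_ac c p3) (primitive_ac c p4)).
  move=> x xc; have [_ _ h3 h4] := rU x (@upto_link _ l c x (conj c0 cl) xc).
  by split.
- have := primitive_ae_derive p4; have := primitive_ae_derive p3; move: Av.
  apply: filterS3; first exact: (ae_filter_ringOfSetsType mu).
  move=> x Ax D3 D4 lx; have x0 : 0 < x by case: lx.
  have r3 : is_derive x (1 : R) (derive1 (reC (jet_fun U))) (A x * re0 U x + B x * im0 U x - f1 x).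
    apply: dE (D3 x0) => // t lt; by case: (rU t lt).
  have r4 : is_derive x (1 : R) (derive1 (imC (jet_fun U))) (A x * im0 U x - B x * re0 U x - f2 x).
    apply: dE (D4 x0) => // t lt; by case: (rU t lt).
  split; first by split; exact: ex_derive.
  rewrite [cderive (cderive _) x](_ : _ =
    ((A x * re0 U x + B x * im0 U x - f1 x) +i* (A x * im0 U x - B x * re0 U x - f2 x))%C); last first.
    by rewrite /cderive; congr (_ +i* _)%C; rewrite derive1E; exact: derive_val.
  rewrite Ax// Bz// f1f// f2f// /jet_fun /reC /imC; case: (f x) => r s; case: (z) => a b /=.
  by apply/eqP; rewrite eq_complex /=; apply/andP; split; apply/eqP; ring.
Qed.

End Equation.

End Representation.

(** * Scaled potentials *)

Section Scaling.
Variable R : realType.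
Implicit Types (f g : R -> R) (b c e x : R).
Local Notation mu := (@lebesgue_measure R).

(** The image of Lebesgue measure under x / e, multiplied by 1 / e, has the right value on half-open
    intervals and therefore is Lebesgue measure. *)
Lemma ge0_integral_scale e (G : R -> \bar R) b : 0 < e ->
  measurable_fun `[0, b / e] G -> (forall x, 0 <= G x)%E ->
  (\int[mu]_(x in `[0%R, b]) G (x / e)%R =
   e%:E * \int[mu]_(y in `[0%R, (b / e)%R]) G y)%E.
Proof.
move=> e0 mG G0; have ei0 : 0 <= e^-1 by rewrite invr_ge0 ltW.
have mphi : measurable_fun setT (fun x : R => x / e : measurableTypeR R).
  by apply: measurable_funM.
pose P := @measure_function_pushforward__canonical__measure_function_Measure
  _ _ _ _ R mu (fun x : R => x / e : measurableTypeR R) mphi.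
pose nu := mscale (NngNum ei0) P.
have nuE (A : set R) : measurable A -> mu A = nu A.
  apply: lebesgue_measure_unique => _ [[p q]] _ <-.
  change (mu (`]p, q]%classic : set R) = nu (`]p, q]%classic : set R)).
  have PE : (fun x : R => x / e : measurableTypeR R) @^-1` `]p, q] = `]p * e, q * e]%classic.
    by apply/seteqP; split => x /=; rewrite !in_itv/= ltr_pdivlMr// ler_pdivrMr.
  have -> : nu `]p, q]%classic = ((e^-1)%:E * mu `](p * e)%R, (q * e)%R]%classic)%E by rewrite -PE.
  rewrite /= !lebesgue_measure_itv/= !lte_fin ltr_pM2r//; case: ifP => _; last by rewrite mule0.
  by rewrite -!EFinD -EFinM; congr _%:E; field; rewrite gt_eqF.
have -> : (\int[mu]_(y in `[0%R, (b / e)%R]) G y = \int[nu]_(y in `[0%R, (b / e)%R]) G y)%E.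
  by apply: eq_measure_integral => A mA _; first [exact: nuE | exact: esym (nuE _ mA)].
rewrite ge0_integral_mscale//= muleA -EFinM mulfV ?gt_eqF// mul1e.
rewrite ge0_integral_pushforward//=.
have -> // : (fun x : R => x / e) @^-1` `[0, b / e] = `[0, b]%classic.
apply/seteqP; split => x /=; rewrite !in_itv/= => /andP[h1 h2].
  by rewrite -(ler_pM2r (_ : 0 < e^-1)) ?invr_gt0// mul0r h1 -(ler_pM2r (_ : 0 < e^-1)) ?invr_gt0.
by rewrite ler_pM2r ?invr_gt0// divr_ge0// ltW.
Qed.

Lemma locint_scale e g : 0 < e -> locint g -> locint (fun x => g (x / e)).
Proof.
move=> e0 lg b.
have mg : measurable_fun `[0, b / e] (EFin \o g) by exact: (measurable_int mu (lg _)).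
apply/integrableP; split; last first.
  rewrite (@ge0_integral_scale e (fun x => `|(g x)%:E|%E))//; last exact: measurableT_comp.
  have /integrableP[_] := lg (b / e).
  rewrite -ge0_fin_numE; last exact: integral_ge0.
  by move=> fin; rewrite -(fineK fin) -EFinM ltry.
have mphi : measurable_fun `[0, b] (fun x : R => x / e).
  by apply: measurable_funM => //; exact: measurable_funTS.
have sub : (fun x : R => x / e) @` `[0, b] `<=` `[0, b / e].
  move=> _ [x /= + <-]; rewrite !in_itv/= => /andP[x0 xb].
  by rewrite divr_ge0 ?(ltW e0)//= ler_pM2r ?invr_gt0.
exact: (measurable_comp (measurable_itv _) sub mg mphi).
Qed.

Lemma int0_scale e g b : 0 < e -> locint g ->
  int0 (fun x => e^-1 * g (x / e)) b = int0 g (b / e).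
Proof.
move=> e0 lg; rewrite int0Z; last exact: locint_scale.
have nneg h : locint h -> (forall x, 0 <= h x) ->
    e^-1 * int0 (fun x => h (x / e)) b = int0 h (b / e).
  move=> lh h0; apply: EFin_inj; rewrite EFinM !int0E//; last exact: locint_scale.
  rewrite (@ge0_integral_scale e (EFin \o h))//.
  - by rewrite muleA -EFinM mulVf ?gt_eqF// mul1e.
  - exact: (measurable_int mu (lh _)).
(* The signed case follows from two nonnegative ones, g being half of p - q. *)
pose p x := `|g x| + g x; pose q x := `|g x| - g x.
have lp : locint p by apply: locintD => //; exact: locint_norm.
have lq : locint q by apply: locintB => //; exact: locint_norm.
have p0 x : 0 <= p x by rewrite /p; have := ler_norm (- g x); rewrite normrN; lra.
have q0 x : 0 <= q x by rewrite /q; have := ler_norm (g x); lra.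
have gE : g = (fun x => 1 / 2 * p x - 1 / 2 * q x) by apply/funext => x; rewrite /p /q; field.
rewrite {1 2}gE (int0B _ (locintZ _ (locint_scale e0 lp)) (locintZ _ (locint_scale e0 lq))).
rewrite (int0B _ (locintZ _ lp) (locintZ _ lq)) (int0Z _ _ lp) (int0Z _ _ lq).
rewrite (int0Z _ _ (locint_scale e0 lp)) (int0Z _ _ (locint_scale e0 lq)).
rewrite -(nneg p)// -(nneg q)//; ring.
Qed.

End Scaling.

(** * Where the mass of a scaled potential sits *)

Section ScaledPotential.
Variable R : realType.
Local Notation mu := (@lebesgue_measure R).
Variables (l : \bar R) (W : R -> R).
Hypotheses (l0 : (0 < l)%E) (W_int : mu.-integrable (link l) (EFin \o W)).
Implicit Types (b c e x : R).

Local Notation g := (W \_ (link l)).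

Definition total_mass : R := \int[mu]_x `|g x|.

Lemma locint_loc (h : R -> R) : locint h -> loc_integrable l h.
Proof.
move=> lh c c0 cl; have := lh c; apply: integrableS => //.
by apply: subset_itv; rewrite bnd_simp.
Qed.

Let lg : locint g.
Proof. exact: locint_link (integrable_loc l0 W_int). Qed.

Let lng : locint (fun x => `|g x|).
Proof. exact: locint_norm. Qed.

Let ig : mu.-integrable setT (EFin \o g).
Proof.
rewrite -restrict_EFin; apply/integrable_restrict => //; first exact: measurable_link.
by rewrite setTI.
Qed.

Let ing : mu.-integrable setT (EFin \o (fun x => `|g x|)).
Proof. exact: integrable_norm. Qed.

Let total_massE : (total_mass%:E = \int[mu]_x (`|g x|)%:E)%E.
Proof. by rewrite fineK//; apply: integrable_fin_num ing. Qed.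

Let total_mass_link : (total_mass%:E = \int[mu]_(x in link l) (`|g x|)%:E)%E.
Proof.
rewrite total_massE [RHS]integral_mkcond; apply: eq_integral => x _.
by rewrite !patchE; case: ifP => //; rewrite normr0.
Qed.

Lemma int0_norm_le c : int0 (fun x => `|g x|) c <= total_mass.
Proof.
rewrite -lee_fin int0E// total_massE; apply: ge0_subset_integral => //.
by apply: (measurable_int mu ing).
Qed.

Lemma int0_norm_mono x y : 0 <= x <= y ->
  int0 (fun x => `|g x|) x <= int0 (fun x => `|g x|) y.
Proof. by move=> xy; apply: int0_nd. Qed.

(** Otherwise all integrals up to a finite c would stay below the total mass minus d, and so would
    their monotone limit. *)
Lemma int0_norm_cvg (d : R) : 0 < d -> exists2 c0, 0 < c0 &
  forall c, c0 <= c -> total_mass - d <= int0 (fun x => `|g x|) c.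
Proof.
move=> d0; apply: contrapT => H.
have le c : 0 < c -> int0 (fun x => `|g x|) c <= total_mass - d.
  move=> c0; rewrite leNgt; apply/negP => h; apply: H; exists c => // c' cc'.
  by apply: (le_trans (ltW h)); apply: int0_norm_mono; rewrite (ltW c0).
have := link_integral_le l0 lng (fun x => normr_ge0 (g x)) (fun b ub => le b ub.1).
by rewrite -total_mass_link lee_fin; lra.
Qed.

(** Both sides are integrals over the complement of [0, c], of W and of its absolute value. *)
Lemma int0_sub_total c :
  `|int0 g c - \int[mu]_(x in link l) W x| <= total_mass - int0 (fun x => `|g x|) c.
Proof.
have mC : measurable (~` `[0, c] : set R) by exact: measurableC.
have split h : mu.-integrable setT (EFin \o h) ->
    \int[mu]_x h x = int0 h c + \int[mu]_(x in ~` `[0, c]) h x.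
  move=> ih; rewrite -(setUv `[0, c]) Rintegral_setU//.
    by rewrite setUv.
  by rewrite disj_set2E setICr.
rewrite [\int[mu]_(x in link l) W x]Rintegral_mkcond (split _ ig) /total_mass (split _ ing).
rewrite opprD addrA subrr sub0r normrN [X in _ <= X - _]addrC addrK.
apply: le_normr_Rintegral => //.
by apply: (@integrableS _ _ R mu setT).
Qed.

Lemma locint_scaled e : 0 < e -> locint (scaled l W e).
Proof. by move=> e0; apply: locintZ; exact: locint_scale. Qed.

Let ws e := scaled l W e \_ (link l).

Lemma locint_scaled_link e : 0 < e -> locint (ws e).
Proof. by move=> e0; apply: locint_link => //; apply: locint_loc; exact: locint_scaled. Qed.

Let wsE e b x : upto l b -> 0 < x < b -> ws e x = scaled l W e x.
Proof. by move=> ub xb; rewrite /ws patchE mem_set//; exact: upto_link xb. Qed.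

Let int0_ws e b : 0 < e -> upto l b -> int0 (ws e) b = int0 g (b / e).
Proof.
move=> e0 ub; rewrite -int0_scale//; apply: eq_int0.
- by move=> x xb; rewrite (wsE _ ub).
- exact: locint_scaled_link.
- exact: locint_scaled.
Qed.

Let int0_norm_ws e b : 0 < e -> upto l b ->
  int0 (fun x => `|ws e x|) b = int0 (fun x => `|g x|) (b / e).
Proof.
move=> e0 ub; rewrite -int0_scale//; apply: eq_int0.
- move=> x xb; rewrite (wsE _ ub)// /scaled normrM ger0_norm//.
  by rewrite invr_ge0 ltW.
- exact/locint_norm/locint_scaled_link.
- exact: (locintZ _ (locint_scale e0 lng)).
Qed.

Lemma scaled_norm_le e b : 0 < e -> upto l b ->
  int0 (fun x => `|ws e x|) b <= total_mass.
Proof. by move=> e0 ub; rewrite int0_norm_ws//; exact: int0_norm_le. Qed.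

Lemma locint_tail (h : R -> R) (r : R) : locint h ->
  locint (fun x => if x <= r then 0 else `|h x|).
Proof.
move=> lh c.
have -> : EFin \o (fun x => if x <= r then 0 else `|h x|) =
    (EFin \o (fun x => `|h x|)) \_ `]r, +oo[.
  by apply/funext => x /=; rewrite patchE mem_setE in_itv/= andbT leNgt; case: (r < x).
apply/integrable_restrict => //.
apply: (@integrableS _ _ R mu `[0, c]) => //; first exact: measurableI.
exact: locint_norm.
Qed.

(** In the unscaled variable the tail begins at r / e, which moves to infinity as e tends to 0. *)
Lemma scaled_tail_le e b (r : R) : 0 < e -> 0 < r -> upto l b ->
  int0 (fun x => if x <= r then 0 else `|ws e x|) b <=
    total_mass - int0 (fun x => `|g x|) (r / e).
Proof.
move=> e0 r0 ub.
have lw := locint_scaled_link e0.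
have lt := locint_tail r lw.
have z c : c <= r -> int0 (fun x => if x <= r then 0 else `|ws e x|) c = 0.
  move=> cr; transitivity (int0 (cst 0) c : R); last by rewrite /int0 Rintegral_cst// mul0r.
  apply: eq_int0 => //; last exact: locint_cst.
  by move=> x /andP[_ xc]; rewrite (le_trans (ltW xc) cr).
have [br|rb] := leP b r.
  by rewrite z// subr_ge0; exact: int0_norm_le.
have ur : upto l r.
  by split => //; apply: le_trans ub.2; rewrite lee_fin ltW.
rewrite -int0_norm_ws// -[leLHS]subr0 -[X in _ - X <= _](z r)//.
have rr : 0 <= r <= b by rewrite !ltW.
rewrite (int0_subE lt rr).
have -> : \int[mu]_(t in `]r, b]) (if t <= r then 0 else `|ws e t|) = \int[mu]_(t in `]r, b]) `|ws e t|.
  apply: eq_Rintegral => t; rewrite inE/= in_itv/= => /andP[rt _].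
  by rewrite leNgt rt.
rewrite -(int0_subE (locint_norm lw) rr) lerD2r.
exact: scaled_norm_le.
Qed.

(** On a finite link of length b the unscaled variable runs up to b / e >= b, so no mass is lost;
    this is where e <= 1 enters. On an infinite link it runs up to n / e, at least r / e. *)
Lemma scaled_total e n (r : R) : 0 < e <= 1 -> 0 < r -> r <= n ->
  `|int0 (ws e) (cutb l n) - \int[mu]_(x in link l) W x| <=
    total_mass - int0 (fun x => `|g x|) (r / e).
Proof.
move=> /andP[e0 e1] r0 rn.
have n0 : 0 < n by exact: lt_le_trans rn.
have uc : upto l (cutb l n).
  by case: l l0 => [b|_|//]; rewrite /cutb; [rewrite lte_fin|rewrite /upto leey].
rewrite int0_ws//; apply: (le_trans (int0_sub_total _)).
rewrite lerD2l lerN2.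
have [[b lE]|lE] : (exists b : R, l = b%:E) \/ l = +oo%E.
- by case: l l0 => [b|_|//]; [left; exists b|right].
- have b0 : 0 < b by move: l0; rewrite lE lte_fin.
  apply: (le_trans (int0_norm_le _)).
  apply: (@le_trans _ _ (int0 (fun x => `|g x|) b)).
    by rewrite -lee_fin int0_oo// total_mass_link -link_fin -lE.
  apply: int0_norm_mono; rewrite (ltW b0)/= /cutb lE ler_pdivlMr//.
  by rewrite ler_piMr// ltW.
- apply: int0_norm_mono; rewrite /cutb lE divr_ge0 ?(ltW r0) ?(ltW e0)//=.
  by rewrite ler_pM2r ?invr_gt0.
Qed.

End ScaledPotential.

(** * Vertex values, boundary values and norms read off from jets *)

Section GraphFunctions.
Variable R : realType.
Implicit Types (F : R -> R) (b c x : R) (l : \bar R) (u : R -> R[i]) (U : jet R).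
Local Notation mu := (@lebesgue_measure R).
Local Notation normc := (@ComplexField.Normc.normc R).

Lemma complex_sum (I : Type) (r : seq I) (p q : I -> R) :
  \sum_(j <- r) (p j +i* q j)%C = ((\sum_(j <- r) p j) +i* (\sum_(j <- r) q j))%C.
Proof.
elim: r => [|j r IH]; first by rewrite !big_nil.
by rewrite !big_cons IH.
Qed.

Lemma ex_upto l : (0 < l)%E -> exists b, upto l b.
Proof.
case: l => [b|_|//]; first by rewrite lte_fin => b0; exists b.
by exists 1; split; rewrite ?leey.
Qed.

Lemma lim_at_right0 l (f : R -> R) F : (0 < l)%E -> contp F ->
  (forall x, link l x -> f x = F x) -> lim (f @ 0^'+) = F 0.
Proof.
move=> l0 cF fF; apply/cvg_lim; first exact: Rhausdorff.
apply: cvg_trans (contp_cvg0 cF); apply: near_eq_cvg.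
have [b [b0 bl]] := ex_upto l0.
near=> x; apply/esym/fF; apply: (@upto_link _ l b) => //.
by apply/andP; split; near: x; [exact: nbhs_right_gt|exact: nbhs_right_lt].
Unshelve. all: by end_near. Qed.

Lemma lim_at_left b (f : R -> R) F : 0 < b -> contp F ->
  (forall x, link b%:E x -> f x = F x) -> lim (f @ b^'-) = F b.
Proof.
move=> b0 cF fF; apply/cvg_lim; first exact: Rhausdorff.
have cb : F x @[x --> b^'-] --> F b.
  by apply: cvg_at_left_filter; exact: contp_continuous.
apply: cvg_trans cb; apply: near_eq_cvg.
near=> x; apply/esym/fF; split.
  by near: x; exact: nbhs_left_gt.
by rewrite lte_fin; near: x; exact: nbhs_left_lt.
Unshelve. all: by end_near. Qed.

(** Only values are compared, not derivatives, so that the difference of two represented functions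
    is covered directly. *)
Lemma sqnormL2_le_values l u U (X : R) : (0 < l)%E -> locint (normsq U) ->
  (forall x, link l x -> reC u x = re0 U x /\ imC u x = im0 U x) ->
  (forall b, upto l b -> int0 (normsq U) b <= X) -> (sqnormL2 (link l) u <= X%:E)%E.
Proof.
move=> l0 ln uU H.
apply: le_trans (link_integral_le l0 ln (normsq_ge0 U) H).
rewrite le_eqVlt; apply/orP; left; apply/eqP.
apply: eq_integral => x; rewrite inE => /uU[h1 h2].
by rewrite normc_sq -/(reC u x) -/(imC u x) h1 h2.
Qed.

Section OneLink.
Variables (l : \bar R) (u : R -> R[i]) (U : jet R) (A B f1 f2 : R -> R).
Hypotheses (l0 : (0 < l)%E) (sU : jet_sol A B f1 f2 U) (rU : represents l U u).

Lemma clim0_represents : clim 0^'+ u = (re0 U 0 +i* im0 U 0)%C.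
Proof.
have [c1 c2 _ _] := contp_jet sU; rewrite /clim.
by congr (_ +i* _)%C; apply: (lim_at_right0 l0) => // x /rU[].
Qed.

Lemma clim0_derive_represents : clim 0^'+ (cderive u) = (re1 U 0 +i* im1 U 0)%C.
Proof.
have [_ _ c1 c2] := contp_jet sU; rewrite /clim.
by congr (_ +i* _)%C; apply: (lim_at_right0 l0) => // x /rU[].
Qed.

Lemma boundary_represents b (om : R) : l = b%:E ->
  clim b^'- u * (cos om)%:C%C + clim b^'- (cderive u) * (sin om)%:C%C =
  (bc_re om U b +i* bc_im om U b)%C.
Proof.
move=> lb; have b0 : 0 < b by move: l0; rewrite lb lte_fin.
have [c1 c2 c3 c4] := contp_jet sU.
have -> : clim b^'- u = (re0 U b +i* im0 U b)%C.
  by rewrite /clim; congr (_ +i* _)%C; apply: lim_at_left => // x; rewrite -lb => /rU[].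
have -> : clim b^'- (cderive u) = (re1 U b +i* im1 U b)%C.
  by rewrite /clim; congr (_ +i* _)%C; apply: lim_at_left => // x; rewrite -lb => /rU[].
by apply/eqP; rewrite eq_complex /= /bc_re /bc_im; apply/andP; split; apply/eqP; ring.
Qed.

Lemma sqnormL2_represents :
  sqnormL2 (link l) u = (\int[mu]_(x in link l) (normsq U x)%:E)%E.
Proof.
apply: eq_integral => x; rewrite inE => /rU[h1 h2 _ _].
by rewrite normc_sq -/(reC u x) -/(imC u x) h1 h2.
Qed.

Lemma measurable_represents : measurable_fun (link l) (reC u) /\ measurable_fun (link l) (imC u).
Proof.
have mF (f : R -> R) F : contp F -> (forall x, link l x -> f x = F x) -> measurable_fun (link l) f.
  move=> cF fF; apply: open_continuous_measurable_fun; first exact: open_link.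
  move=> x; rewrite inE => lx; have [x0 _] := lx.
  have cx := contp_continuous cF x0; rewrite /continuous_at (fF _ lx).
  apply: cvg_trans cx; apply: near_eq_cvg.
  have : \forall t \near x, link l t by apply: open_nbhs_nbhs; split => //; exact: open_link.
  by apply: filterS => t /fF.
have [c1 c2 _ _] := contp_jet sU.
by split; [apply: (mF _ _ c1)|apply: (mF _ _ c2)] => x /rU[].
Qed.

Lemma int0_le_sqnormL2 b : upto l b -> ((int0 (normsq U) b)%:E <= sqnormL2 (link l) u)%E.
Proof.
move=> ub; rewrite sqnormL2_represents.
have ln := contp_locint (contp_normsq sU).
apply: (int0_le_link l0 ub ln) => // [|x _]; last exact: normsq_ge0.
have [m1 m2] := measurable_represents.
have mh : measurable_fun (link l) (fun x => reC u x ^+ 2 + imC u x ^+ 2).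
  by apply: measurable_funD; exact: measurable_funX.
by apply: eq_measurable_fun mh => x; rewrite inE => /rU[h1 h2 _ _]; rewrite h1 h2.
Qed.

Lemma sqnormL2_le (X : R) : (forall b, upto l b -> int0 (normsq U) b <= X) ->
  (sqnormL2 (link l) u <= X%:E)%E.
Proof.
apply: sqnormL2_le_values => //; first exact: contp_locint (contp_normsq sU).
by move=> x /rU[].
Qed.

Lemma L2_represents (X : R) : (forall b, upto l b -> int0 (normsq U) b <= X) -> L2 (link l) u.
Proof.
move=> H; have [m1 m2] := measurable_represents; split => //.
by apply: le_lt_trans (sqnormL2_le H) _; rewrite ltry.
Qed.

End OneLink.

Lemma L2_addZ l (f u : R -> R[i]) (z : R[i]) : (0 < l)%E -> L2 (link l) f -> L2 (link l) u ->
  L2 (link l) (fun x => f x + z * u x).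
Proof.
move=> l0 [f1 f2 ff] [u1 u2 uu].
have mL := measurable_link l0.
pose a := complex.Re z; pose b := complex.Im z.
have rE x : reC (fun x => f x + z * u x) x = reC f x + (a * reC u x - b * imC u x).
  by rewrite /reC /imC /a /b; case: (f x) (u x) (z) => ? ? [? ?] [? ?].
have iE x : imC (fun x => f x + z * u x) x = imC f x + (a * imC u x + b * reC u x).
  by rewrite /reC /imC /a /b; case: (f x) (u x) (z) => ? ? [? ?] [? ?].
have m1 : measurable_fun (link l) (fun x => reC f x + (a * reC u x - b * imC u x)).
  by apply: measurable_funD => //; apply: measurable_funB; exact: measurable_funM.
have m2 : measurable_fun (link l) (fun x => imC f x + (a * imC u x + b * reC u x)).
  by apply: measurable_funD => //; apply: measurable_funD; exact: measurable_funM.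
split.
- by apply: eq_measurable_fun m1 => x _; rewrite -rE.
- by apply: eq_measurable_fun m2 => x _; rewrite -iE.
pose K := a ^+ 2 + b ^+ 2.
have mn (h : R -> R[i]) : measurable_fun (link l) (reC h) -> measurable_fun (link l) (imC h) ->
    measurable_fun (link l) (fun x => (normc (h x) ^+ 2)%:E).
  move=> h1 h2; apply/measurable_EFinP.
  have mh : measurable_fun (link l) (fun x => reC h x ^+ 2 + imC h x ^+ 2).
    by apply: measurable_funD; exact: measurable_funX.
  by apply: eq_measurable_fun mh => x _; rewrite normc_sq.
have mf := mn f f1 f2; have mu' := mn u u1 u2.
apply: (@le_lt_trans _ _ (2%:E * sqnormL2 (link l) f + (2 * K)%:E * sqnormL2 (link l) u)%E).
  rewrite /sqnormL2 -!ge0_integralZl//; last 2 first.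
  - by rewrite lee_fin mulr_ge0// addr_ge0 ?sqr_ge0.
  - by move=> x _; rewrite lee_fin sqr_ge0.
  rewrite -ge0_integralD//.
  - apply: ge0_le_integral => //.
    + by move=> x _; rewrite lee_fin sqr_ge0.
    + apply: mn; [by apply: eq_measurable_fun m1 => x _; rewrite -rE|by apply: eq_measurable_fun m2 => x _; rewrite -iE].
    + by apply: emeasurable_funD; exact: measurable_funeM.
    + move=> x _; rewrite -!EFinM -EFinD lee_fin !normc_sq.
      rewrite -[complex.Re (f x + z * u x)]/(reC (fun x => f x + z * u x) x).
      rewrite -[complex.Im (f x + z * u x)]/(imC (fun x => f x + z * u x) x) rE iE.
      rewrite -/(reC f x) -/(imC f x) -/(reC u x) -/(imC u x) /K.
      move: (reC f x) (imC f x) (reC u x) (imC u x) => p q r s.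
      rewrite -subr_ge0.
      rewrite (_ : _ - _ = (p - (a * r - b * s)) ^+ 2 + (q - (a * s + b * r)) ^+ 2); last by ring.
      by rewrite addr_ge0 ?sqr_ge0.
  - by move=> x _; rewrite mule_ge0// lee_fin sqr_ge0.
  - exact: measurable_funeM.
  - by move=> x _; rewrite mule_ge0// lee_fin ?sqr_ge0// mulr_ge0// addr_ge0 ?sqr_ge0.
  - exact: measurable_funeM.
  by move=> x _; rewrite lee_fin sqr_ge0.
apply: lte_add_pinfty; apply: lte_mul_pinfty => //; rewrite ?lee_fin//.
by rewrite mulr_ge0// addr_ge0 ?sqr_ge0.
Qed.

(** The points b' are chosen independently, so near-optimal ones can be taken on all links at once,
    with a loss of e / (N + 1) each. Varying a single one, the others fixed, shows each supremum to
    be finite. This turns bounds at finite ends into bounds on the norm in the Hilbert space. *)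
Lemma sum_sup (N : nat) (P : 'I_N -> R -> Prop) (F : 'I_N -> R -> R) (Q : R) :
  (forall j, exists b, P j b) ->
  (forall b' : 'I_N -> R, (forall j, P j (b' j)) -> \sum_(j < N) F j (b' j) <= Q) ->
  exists Xs : 'I_N -> R, (forall j b, P j b -> F j b <= Xs j) /\ \sum_(j < N) Xs j <= Q.
Proof.
move=> /choice[bs Pb0] H.
have sF j : has_sup [set F j b | b in P j].
  split; first by exists (F j (bs j)); exists (bs j).
  exists (Q - \sum_(i < N | i != j) F i (bs i)) => _ [b Pb <-].
  have := H (fun i => if i == j then b else bs i).
  rewrite (bigD1 j)//= eqxx (eq_bigr (fun i => F i (bs i))); last first.
    by move=> i /negbTE ->.
  rewrite lerBrDr; apply => i; case: eqP => // -> //.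
exists (fun j => sup [set F j b | b in P j]); split.
  by move=> j b Pb; apply: (ub_le_sup (sF j).2); exists b.
apply/ler_addgt0Pr => e e0.
have e1 : 0 < e / N.+1%:R by rewrite divr_gt0.
have /choice[b' Hb'] : forall j, exists b, P j b /\ sup [set F j b | b in P j] <= F j b + e / N.+1%:R.
  move=> j; have [_ [b Pb <-] h] := sup_adherent e1 (sF j).
  by exists b; split => //; rewrite -lerBlDr ltW.
have := H b' (fun j => (Hb' j).1).
have : \sum_(j < N) sup [set F j b | b in P j] <= \sum_(j < N) (F j (b' j) + e / N.+1%:R).
  by apply: ler_sum => j _; case: (Hb' j).
rewrite big_split/= sumr_const card_ord.
have : (e / N.+1%:R) *+ N <= e.
  rewrite -mulr_natr -mulrA ler_piMr ?(ltW e0)// mulrC ler_pdivrMr// mul1r ler_nat.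
  exact: leqnSn.
move=> h1 h2 h3; apply: (le_trans h2).
by rewrite -[leLHS]/(_ + _) lerD.
Qed.

End GraphFunctions.

(** * Star graph Hamiltonians *)

Section Hamiltonian.
Variable R : realType.
Local Notation mu := (@lebesgue_measure R).
Local Notation normc := (@ComplexField.Normc.normc R).

(* Truncating the potential on a null set makes its lower bound pointwise. *)
Lemma loc_integrable_below l (v : R -> R) : (0 < l)%E -> loc_integrable l v ->
  ess_bounded_below l v -> exists K : R -> R, exists m : R,
  [/\ locint K, 0 <= m, forall x, - m <= K x
    & {ae mu, forall x, link l x -> K x = v x}].
Proof.
move=> l0 /(locint_link l0) lv [m mv].
exists (fun x => 1 / 2 * ((v \_ (link l)) x + m + `|(v \_ (link l)) x - m|)), `|m|; split => //.
- apply: locintZ; apply: locintD; first by apply: locintD => //; exact: locint_cst.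
  by apply: locint_norm; apply: locintB => //; exact: locint_cst.
- move=> x; move: ((v \_ (link l)) x) => y.
  have := ler_norm (m - y); rewrite distrC.
  have := ler_norm (- m); rewrite normrN; lra.
- apply: filterS mv; first exact: (ae_filter_ringOfSetsType mu).
  move=> x mx lx; rewrite patchE mem_set// ger0_norm ?subr_ge0 ?mx//.
  by field.
Qed.

Section Link.
Variables (N : nat) (l : 'I_N -> \bar R).
Hypothesis l0 : forall j, (0 < l j)%E.

Lemma hnorm_le (f : graph_fun R N) (r : R) : 0 <= r ->
  (hnorm l f <= r%:E)%E <-> (\sum_(j < N) sqnormL2 (link (l j)) (f j) <= (r ^+ 2)%:E)%E.
Proof.
move=> r0; have E : sqrte ((r ^+ 2)%:E) = r%:E by rewrite /= sqrtr_sqr ger0_norm.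
by rewrite /hnorm -E lee_sqrt// lee_fin sqr_ge0.
Qed.

Lemma sqnormL2_ge0 D (u : R -> R[i]) : (0 <= sqnormL2 D u)%E.
Proof. by apply: integral_ge0 => x _; rewrite lee_fin sqr_ge0. Qed.

Lemma sqnormL2_fin (f : graph_fun R N) j : inH l f ->
  sqnormL2 (link (l j)) (f j) = (fine (sqnormL2 (link (l j)) (f j)))%:E.
Proof.
move=> /(_ j)[_ _ fin]; rewrite fineK// ge0_fin_numE//; exact: sqnormL2_ge0.
Qed.

End Link.

Variables (N : nat) (l : 'I_N -> \bar R) (om : 'I_N -> R) (V K : 'I_N -> R -> R).
Variables (m : R) (z : R[i]).
Hypotheses (N0 : (0 < N)%N) (l0 : forall j, (0 < l j)%E)
  (lK : forall j, locint (K j)) (m0 : 0 <= m) (Km : forall j x, - m <= K j x)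
  (KV : forall j, {ae mu, forall x, link (l j) x -> K j x = V j x})
  (z0 : complex.Im z != 0).

Implicit Types (w : 'I_N -> R -> R) (f psi : graph_fun R N) (U : 'I_N -> jet R).

(** On the link [As - i Bs] is K - z, the coefficient of the first-order system; outside it is
    zero. *)
Let As j : R -> R := (fun x => K j x - complex.Re z) \_ (link (l j)).
Let Bs j : R -> R := (cst (complex.Im z)) \_ (link (l j)).
Let ws w j : R -> R := w j \_ (link (l j)).
Let fre f j : R -> R := reC (f j) \_ (link (l j)).
Let fim f j : R -> R := imC (f j) \_ (link (l j)).

Let lA j : locint (As j).
Proof.
apply: locint_link => //; apply: locint_loc; apply: locintB => //; exact: locint_cst.
Qed.

Let lB j : locint (Bs j).
Proof. by apply: locint_link => //; apply: locint_loc; exact: locint_cst. Qed.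

Let Bl j x : 0 < x -> (x%:E < l j)%E -> Bs j x = complex.Im z.
Proof. by move=> x0 xl; rewrite /Bs patchE mem_set. Qed.

Let Aw w j x : 0 < x -> (x%:E < l j)%E ->
  - (m + `|complex.Re z|) - `|ws w j x| <= As j x + ws w j x.
Proof.
move=> x0 xl; rewrite /As patchE mem_set//.
have := Km j x; have := ler_norm (- ws w j x); rewrite normrN.
have := ler_norm (complex.Re z); lra.
Qed.

Definition jet_data alpha w f psi U :=
  [/\ forall j, jet_sol (fun x => As j x + ws w j x) (Bs j) (fre f j) (fim f j) (U j),
      graph_bc l om U, graph_vertex alpha U,
      forall j, represents (l j) (U j) (psi j) & l2_bounded l U].

(** Both families of the theorem have this form: vertex parameter 0 with the scaled potentials, and
    vertex parameter alpha with w = 0. *)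
Let hamiltonian alpha w := star_hamiltonian l om alpha (fun j x => V j x + w j x).

Let off_link j (h : R -> R) x : ~ link (l j) x -> (h \_ (link (l j))) x = 0.
Proof. by move=> lx; rewrite patchE memNset. Qed.

Let Av w j : {ae mu, forall x, link (l j) x ->
  As j x + ws w j x = V j x + w j x - complex.Re z}.
Proof.
apply: filterS (KV j); first exact: (ae_filter_ringOfSetsType mu).
by move=> x Kx lx; rewrite /As /ws !patchE mem_set// Kx//; ring.
Qed.

Let loc_Aw w j : loc_integrable (l j) (w j) ->
  loc_integrable (l j) (fun x => As j x + ws w j x).
Proof. by move=> lw; apply: locint_loc; apply: locintD => //; exact: locint_link. Qed.

Lemma boundary_jets psi U :
  (forall j, exists A B g1 g2 : R -> R, jet_sol A B g1 g2 (U j)) ->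
  (forall j, represents (l j) (U j) (psi j)) ->
  boundary_condition l om psi <-> graph_bc l om U.
Proof.
move=> sU rU; split=> H j b lj; have [A [B [g1 [g2 sUj]]]] := sU j.
  have := H j b lj; rewrite (boundary_represents (l0 j) sUj (rU j) (om j) lj).
  by move=> /eqP; rewrite eq_complex /= => /andP[/eqP h1 /eqP h2].
rewrite (boundary_represents (l0 j) sUj (rU j) (om j) lj).
by have [-> ->] := H j b lj.
Qed.

Lemma vertex_jets alpha psi U :
  (forall j, exists A B g1 g2 : R -> R, jet_sol A B g1 g2 (U j)) ->
  (forall j, represents (l j) (U j) (psi j)) ->
  vertex_condition alpha psi <-> graph_vertex alpha U.
Proof.
move=> sU rU.
have c0 j : clim 0^'+ (psi j) = (re0 (U j) 0 +i* im0 (U j) 0)%C.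
  by have [A [B [g1 [g2 sUj]]]] := sU j; exact: clim0_represents (l0 j) sUj (rU j).
have c1 : \sum_(j < N) clim 0^'+ (cderive (psi j)) =
    ((\sum_(j < N) re1 (U j) 0) +i* (\sum_(j < N) im1 (U j) 0))%C.
  rewrite -complex_sum; apply: eq_bigr => j _.
  by have [A [B [g1 [g2 sUj]]]] := sU j; exact: clim0_derive_represents (l0 j) sUj (rU j).
split.
  move=> [[p q] [vc vs]]; exists p, q; split.
  - by move=> j; have := vc j; rewrite c0 => -[-> ->].
  - by move: vs; rewrite c1 => /eqP; rewrite eq_complex /= => /andP[/eqP -> _]; ring.
  - by move: vs; rewrite c1 => /eqP; rewrite eq_complex /= => /andP[_ /eqP ->]; ring.
move=> [p [q [vc v1 v2]]]; exists (p +i* q)%C; split.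
  by move=> j; rewrite c0; have [-> ->] := vc j.
by rewrite c1 v1 v2; apply/eqP; rewrite eq_complex /=; apply/andP; split; apply/eqP; ring.
Qed.

Lemma resolvent_jets alpha w f psi : (forall j, loc_integrable (l j) (w j)) ->
  inH l f -> resolvent (hamiltonian alpha w) z f psi ->
  exists U, jet_data alpha w f psi U.
Proof.
move=> lw Hf [Hpsi _ eqn bc vx].
have /choice[U HU] : forall j, exists u, jet_sol (fun x => As j x + ws w j x) (Bs j) (fre f j) (fim f j) u /\
    represents (l j) u (psi j).
  move=> j; have [l1 l2 _ _] := L2_link (l0 j) (Hf j).
  have [u su ru] : exists2 u, jet_sol (fun x => As j x + ws w j x) (Bs j) (fre f j) (fim f j) u &
      represents (l j) u (psi j); last by exists u.
    apply: (jet_of_solution (l0 j) (loc_Aw (lw j)) l1 l2 _ _ _ _ (Av w j) _ _ _ (eqn j)) => x lx.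
    - by rewrite /As /ws !off_link// addr0.
    - exact: off_link.
    - exact: off_link.
    - exact: off_link.
    - by case: lx => x0 xl; exact: Bl.
    - by rewrite /fre patchE mem_set.
    - by rewrite /fim patchE mem_set.
have sU j : exists A B g1 g2 : R -> R, jet_sol A B g1 g2 (U j) by do 4 eexists; exact: (HU j).1.
have rU j := (HU j).2.
exists U; split => //; first by move=> j; exact: (HU j).1.
- exact/(boundary_jets sU rU).
- exact/(vertex_jets _ sU rU).
exists (\sum_(j < N) fine (sqnormL2 (link (l j)) (psi j))) => j b ub.
apply: (@le_trans _ _ (fine (sqnormL2 (link (l j)) (psi j)))).
  by rewrite -lee_fin -sqnormL2_fin//; apply: int0_le_sqnormL2 ub => //; exact: (HU j).1.
rewrite (bigD1 j)//= lerDl sumr_ge0// => i _; apply: fine_ge0; exact: sqnormL2_ge0.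
Qed.

Lemma jets_resolvent alpha w f U : (forall j, loc_integrable (l j) (w j)) -> inH l f ->
  (forall j, jet_sol (fun x => As j x + ws w j x) (Bs j) (fre f j) (fim f j) (U j)) ->
  graph_bc l om U -> graph_vertex alpha U -> l2_bounded l U ->
  resolvent (hamiltonian alpha w) z f (fun j => jet_fun (U j)).
Proof.
move=> lw Hf sU bc vx [X HX].
have rU j : represents (l j) (U j) (jet_fun (U j)).
  by have [] := jet_fun_represents (l j) (sU j).
have sU' j : exists A B g1 g2 : R -> R, jet_sol A B g1 g2 (U j) by do 4 eexists; exact: sU.
have HU : inH l (fun j => jet_fun (U j)).
  by move=> j; apply: (L2_represents (l0 j) (sU j) (rU j)) => b; exact: HX.
split => //.
- by move=> j; apply: L2_addZ.
- move=> j.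
  apply: (@solution_of_jet R (l j) (fun x => V j x + w j x) (f j) z
    (fun x => As j x + ws w j x) (Bs j) (fre f j) (fim f j) (l0 j) (Av w j)
    (fun x lx => Bl lx.1 lx.2) _ _ (U j) (sU j)).
  + by move=> x lx; rewrite /fre patchE mem_set.
  + by move=> x lx; rewrite /fim patchE mem_set.
- exact/(boundary_jets sU' rU).
- exact/(vertex_jets _ sU' rU).
Qed.

Lemma hnorm_fin f : inH l f ->
  hnorm l f = (Num.sqrt (\sum_(j < N) fine (sqnormL2 (link (l j)) (f j))))%:E.
Proof.
by move=> Hf; rewrite /hnorm (eq_bigr _ (fun j _ => sqnormL2_fin j Hf)) sumEFin.
Qed.

(** * Non-real numbers belong to the resolvent set *)

Section Perturbation.
Variables (w : 'I_N -> R -> R) (Wn : R).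
Hypotheses (lw : forall j, loc_integrable (l j) (w j)) (Wn0 : 0 <= Wn)
  (wW : forall j b, upto (l j) b -> int0 (fun x => `|ws w j x|) b <= Wn).

Let lws j : locint (ws w j).
Proof. exact: locint_link. Qed.

Let lnws j : locint (fun x => `|ws w j x|).
Proof. exact: locint_norm. Qed.

Let mz0 : 0 <= m + `|complex.Re z|.
Proof. by rewrite addr_ge0. Qed.

Let f_int f j b : inH l f -> upto (l j) b ->
  int0 (fun x => fre f j x ^+ 2 + fim f j x ^+ 2) b <= fine (sqnormL2 (link (l j)) (f j)).
Proof.
move=> Hf ub; have [_ _ _ h] := L2_link (l0 j) (Hf j).
by rewrite -lee_fin -sqnormL2_fin//; exact: h.
Qed.

Lemma jet_data_L2 alpha f psi U : inH l f -> jet_data alpha w f psi U ->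
  forall b' : 'I_N -> R, (forall j, upto (l j) (b' j)) ->
  \sum_(j < N) int0 (normsq (U j)) (b' j) <=
  complex.Im z ^- 2 * \sum_(j < N) fine (sqnormL2 (link (l j)) (f j)).
Proof.
move=> Hf [sU bc vx _ bU] b' ub'.
apply: (graph_L2 N0 l0 (ws := fun j x => `|ws w j x|) (m := m + `|complex.Re z|)
  lnws _ wW mz0 Wn0 _ Bl z0 sU bc vx bU _ _ _ _ ub') => //.
- by move=> j x; exact: Aw.
- by move=> j; have [] := L2_link (l0 j) (Hf j).
- by move=> j; have [] := L2_link (l0 j) (Hf j).
- by move=> j; have [] := L2_link (l0 j) (Hf j).
- by move=> j b; exact: f_int.
Qed.

Lemma hamiltonian_resolvent_set alpha : resolvent_set l (hamiltonian alpha w) z.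
Proof.
split.
  move=> f Hf.
  have [U [sU bc vx bU]] : exists U, [/\ forall j,
      jet_sol (fun x => As j x + ws w j x) (Bs j) (fre f j) (fim f j) (U j),
      graph_bc l om U, graph_vertex alpha U & l2_bounded l U].
    apply: (graph_solution om N0 l0 (ws := fun j x => `|ws w j x|) alpha (beta := complex.Im z)
      (m := m + `|complex.Re z|) (Wn := Wn) _ lB lnws _ wW mz0 Wn0 _ Bl z0) => //.
    + by move=> j; apply: locintD.
    + by move=> j x; exact: Aw.
    + by move=> j; have [] := L2_link (l0 j) (Hf j).
    + by move=> j; have [] := L2_link (l0 j) (Hf j).
    + by move=> j; have [] := L2_link (l0 j) (Hf j).
    + exists (\sum_(j < N) fine (sqnormL2 (link (l j)) (f j))) => j b ub.
      apply: le_trans (f_int Hf ub) _; rewrite (bigD1 j)//= lerDl.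
      by apply: sumr_ge0 => i _; apply: fine_ge0; exact: sqnormL2_ge0.
  exists (fun j => jet_fun (U j)); exact: jets_resolvent.
exists `|complex.Im z|^-1 => f psi Hf rf.
have [U dU] := resolvent_jets lw Hf rf.
have [sU _ _ rU _] := dU.
have [Xs [HX sX]] := @sum_sup R N (fun j => upto (l j)) (fun j => int0 (normsq (U j))) _ (fun j => ex_upto (l0 j)) (jet_data_L2 Hf dU).
have S0 : 0 <= \sum_(j < N) fine (sqnormL2 (link (l j)) (f j)).
  by apply: sumr_ge0 => j _; apply: fine_ge0; exact: sqnormL2_ge0.
rewrite (hnorm_fin Hf) -EFinM; apply/hnorm_le; first by rewrite mulr_ge0// ?invr_ge0 ?sqrtr_ge0.
rewrite exprMn sqr_sqrtr// exprVn real_normK ?num_real//.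
apply: (@le_trans _ _ (\sum_(j < N) (Xs j)%:E)); last by rewrite sumEFin lee_fin.
apply: lee_sum => j _; exact: (sqnormL2_le (l0 j) (sU j) (rU j) (HX j)).
Qed.

End Perturbation.

(** For |f| <= 1 the resolvent bound gives |psi|^2 <= (Im z)^-2, which serves as the [X] of
    [graph_H1]. One constant then covers the limit operator and all the approximating ones. *)
Lemma jet_data_bounds Wn a : 0 <= Wn -> 0 <= a -> exists2 C, 0 <= C & forall alpha w f psi U,
  `|alpha| <= a -> (forall j, loc_integrable (l j) (w j)) ->
  (forall j b, upto (l j) b -> int0 (fun x => `|ws w j x|) b <= Wn) ->
  inH l f -> (hnorm l f <= 1)%E -> jet_data alpha w f psi U ->
  forall j b, upto (l j) b -> [/\ int0 (normsq (U j)) b <= C, int0 (dnormsq (U j)) b <= C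
    & forall x, 0 <= x <= b -> normsq (U j) x <= C].
Proof.
move=> Wn0 a0.
have mz0 : 0 <= m + `|complex.Re z| by rewrite addr_ge0.
have X0 : 0 <= complex.Im z ^- 2 by rewrite invr_ge0 sqr_ge0.
have [C HC] := graph_H1 om N0 l0 1 mz0 Wn0 X0 a0.
exists (`|C| + complex.Im z ^- 2); first by rewrite addr_ge0.
move=> alpha w f psi U aa lw wW Hf f1 dU; have [sU bc vx _ _] := dU.
have F1 : \sum_(j < N) fine (sqnormL2 (link (l j)) (f j)) <= 1.
  have /hnorm_le := f1; rewrite (eq_bigr _ (fun j _ => sqnormL2_fin j Hf)) sumEFin lee_fin expr1n.
  by apply.
have g0 j : 0 <= fine (sqnormL2 (link (l j)) (f j)) by apply: fine_ge0; exact: sqnormL2_ge0.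
have n0 j b : upto (l j) b -> 0 <= int0 (normsq (U j)) b.
  move=> _; apply: (int0_ge0 (contp_locint (contp_normsq (sU j)))) => x _; exact: normsq_ge0.
have HX j b : upto (l j) b -> int0 (normsq (U j)) b <= complex.Im z ^- 2.
  move=> ub; have /choice[b0 ub0] := fun i => ex_upto (l0 i).
  have := @jet_data_L2 w Wn lw Wn0 wW alpha f psi U Hf dU (fun i => if i == j then b else b0 i).
  rewrite (bigD1 j)//= eqxx => h.
  have {h} := h _; rewrite -lerBrDr => h.
  apply: le_trans (h _) _ => {h} [i|]; first by case: eqP => [->|].
  rewrite -[leRHS]mulr1 lerBlDr; apply: ler_wpDr; last exact: ler_wpM2l.
  by apply: sumr_ge0 => i /negbTE ij; rewrite ij; exact: n0.
have H := HC alpha (fun j x => As j x + ws w j x) Bs (fre f) (fim f) (fun j x => `|ws w j x|) U aa sU bc vx.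
move=> j b ub.
have [||||||H1 H2] := H _ _ _ _ _ _ HX j.
- by move=> i; apply: locint_norm; exact: locint_link.
- by [].
- exact: wW.
- by move=> i x; exact: Aw.
- by move=> i; have [] := L2_link (l0 i) (Hf i).
- move=> i c uc; have [_ _ _ h] := L2_link (l0 i) (Hf i).
  have := h c uc; rewrite (sqnormL2_fin i Hf) lee_fin => /le_trans; apply.
  by apply: le_trans F1; rewrite (bigD1 i)//= lerDl sumr_ge0.
split.
- by apply: le_trans (HX j b ub) _; rewrite lerDr.
- by apply: le_trans (H1 b ub) _; apply: ler_wpDr => //; exact: ler_norm.
- by move=> x xb; apply: le_trans (H2 b ub x xb) _; apply: ler_wpDr => //; exact: ler_norm.
Qed.

(** * Convergence of the resolvents *)

Section Scaling.
Variable W : 'I_N -> R -> R.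
Hypothesis W_int : forall j, mu.-integrable (link (l j)) (EFin \o W j).

Let als j := \int[mu]_(x in link (l j)) W j x.
Let alpha := \sum_(j < N) als j.
Let tm := \sum_(j < N) total_mass (l j) (W j).
Let sc e j := scaled (l j) (W j) e.

Let tm_ge0 j : 0 <= total_mass (l j) (W j).
Proof. by apply: Rintegral_ge0 => x _. Qed.

Let tm0 : 0 <= tm. Proof. exact: sumr_ge0. Qed.

Let le_tm j : total_mass (l j) (W j) <= tm.
Proof. by rewrite /tm (bigD1 j)//= lerDl sumr_ge0. Qed.

Let sc_loc e j : 0 < e -> loc_integrable (l j) (sc e j).
Proof. by move=> e0; apply: locint_loc; exact: locint_scaled. Qed.

Let sc_le e j b : 0 < e -> upto (l j) b -> int0 (fun x => `|ws (sc e) j x|) b <= tm.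
Proof. by move=> e0 ub; apply: le_trans (le_tm j); exact: scaled_norm_le. Qed.

Let zero_loc j : loc_integrable (l j) (fun=> 0).
Proof. by apply: locint_loc; exact: locint_cst. Qed.

Let zero_link j x : ws (fun _ _ => 0) j x = 0.
Proof. by rewrite /ws patchE; case: ifP. Qed.

Let zero_le j b : upto (l j) b -> int0 (fun x => `|ws (fun _ _ => 0) j x|) b <= tm.
Proof.
move=> _; rewrite (_ : (fun x => _) = cst 0).
  by rewrite /int0 Rintegral_cst// mul0r.
by apply/funext => x; rewrite zero_link normr0.
Qed.

Lemma scaled_resolvent_set e : 0 < e -> resolvent_set l (hamiltonian 0 (sc e)) z.
Proof.
move=> e0; apply: (hamiltonian_resolvent_set (Wn := tm)) => // j; first exact: sc_loc.
by move=> b; exact: sc_le.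
Qed.

Lemma limit_resolvent_set : resolvent_set l (hamiltonian alpha (fun _ _ => 0)) z.
Proof. exact: (hamiltonian_resolvent_set (Wn := tm)). Qed.

(** The threshold [e0] is found before f, phi and psi, which makes the convergence one in operator
    norm. *)
Lemma resolvent_difference d : 0 < d -> exists2 e0, 0 < e0 & forall e, 0 < e -> e < e0 ->
  forall f phi psi, inH l f -> (hnorm l f <= 1)%E ->
  resolvent (hamiltonian 0 (sc e)) z f phi ->
  resolvent (hamiltonian alpha (fun _ _ => 0)) z f psi ->
  (hnorm l (fun j x => (phi j x - psi j x)%R) <= d%:E)%E.
Proof.
move=> d0.
have [C C0 HC] := jet_data_bounds tm0 (normr_ge0 alpha).
pose D := N%:R * (5 * C * tm + 15 / 2 * C).
have D0 : 0 <= D by rewrite mulr_ge0// addr_ge0// !mulr_ge0//; lra.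
have beta0 : 0 < `|complex.Im z| by rewrite normr_gt0.
(* With rho = tau = t the bound of [graph_difference] is D t / |Im z|, to be at most d^2; D + 1
   replaces D since D may be 0. *)
pose t := d ^+ 2 * `|complex.Im z| / (D + 1).
have D1 : 0 < D + 1 by lra.
have t0 : 0 < t by rewrite !mulr_gt0 ?exprn_gt0 ?invr_gt0.
have tD : `|complex.Im z|^-1 * (N%:R * (5 * C * t * tm + 15 / 2 * C * t)) <= d ^+ 2.
  have -> : N%:R * (5 * C * t * tm + 15 / 2 * C * t) = D * t by rewrite /D; ring.
  rewrite ler_pdivrMl//.
  have : (D + 1) * t = d ^+ 2 * `|complex.Im z|.
    by rewrite /t mulrCA divff ?mulr1// gt_eqF.
  move=> h; rewrite [leRHS]mulrC -h mulrDl mul1r; lra.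
have /choice[c0 Hc0] : forall j, exists c0, 0 < c0 /\ forall c, c0 <= c ->
    total_mass (l j) (W j) - t <= int0 (fun x => `|(W j \_ (link (l j))) x|) c.
  by move=> j; have [c0 ? ?] := int0_norm_cvg (l0 j) (W_int j) t0; exists c0.
pose c1 := \sum_(j < N) c0 j + 1.
have sc0 : 0 <= \sum_(j < N) c0 j by apply: sumr_ge0 => j _; apply: ltW; case: (Hc0 j).
have c1_gt0 : 0 < c1 by rewrite /c1; lra.
have le_c1 j : c0 j <= c1.
  rewrite /c1 (bigD1 j)//= -addrA lerDl addr_ge0// sumr_ge0// => i _; apply: ltW; by case: (Hc0 i).
have r0 : 0 < t ^+ 2 by rewrite exprn_gt0.
(* For e below t^2 / c1 the unscaled cut t^2 / e lies beyond [c1], where each W has mass at most t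
   left; the bound 1 is for [scaled_total]. *)
exists (Num.min 1 (t ^+ 2 / c1)); first by rewrite lt_min ltr01 divr_gt0.
move=> e e0; rewrite lt_min => /andP[e1 ec] f phi psi Hf f1 rphi rpsi.
have small j : total_mass (l j) (W j) - int0 (fun x => `|(W j \_ (link (l j))) x|) (t ^+ 2 / e) <= t.
  rewrite lerBlDr -lerBlDl; apply: (Hc0 j).2; apply: le_trans (le_c1 j) _.
  by rewrite ler_pdivlMr// mulrC -ler_pdivlMr// ltW.
have lsc j := @sc_loc e j e0.
have [U dU] := resolvent_jets lsc Hf rphi.
have [Z dZ] := resolvent_jets zero_loc Hf rpsi.
have a0 : `|0 : R| <= `|alpha| by rewrite normr0.
have HU := HC 0 (sc e) f phi U a0 lsc (fun j b => @sc_le e j b e0) Hf f1 dU.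
have HZ := HC alpha _ f psi Z (lexx _) zero_loc zero_le Hf f1 dZ.
have [sU bU vU rU _] := dU; have [sZ bZ vZ rZ _] := dZ.
have sZ' j : jet_sol (As j) (Bs j) (fre f j) (fim f j) (Z j).
  have := sZ j; rewrite (_ : (fun x => _) = As j)//.
  by apply/funext => x; rewrite zero_link addr0.
have ls j : locint (ws (sc e) j) by exact: locint_link.
have H := graph_difference N0 l0 (rho := t) (Wn := tm) (tau := t) (n0 := t ^+ 2) sU sZ' bU bZ vU vZ ls
  Bl z0 HU HZ t0 (fun j b => @sc_le e j b e0) (fun j => locint_tail (t ^+ 2) (ls j)) _ _.
have [||Xs [HX sX]] := @sum_sup R N (fun j => upto (l j)) (fun j => int0 (normsq (jet_sub (U j) (Z j)))) _
  (fun j => ex_upto (l0 j)) (H _ _).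
- by move=> j b ub; apply: le_trans (small j); exact: scaled_tail_le.
- move=> j n nt _; apply: le_trans (small j); apply: scaled_total => //.
  by rewrite e0 ltW.
apply/hnorm_le; first exact: ltW.
apply: (@le_trans _ _ (\sum_(j < N) (Xs j)%:E)); last first.
  by rewrite sumEFin lee_fin; apply: le_trans sX tD.
apply: lee_sum => j _; apply: (sqnormL2_le_values (U := jet_sub (U j) (Z j))) => //; last exact: HX.
  by apply: contp_locint; apply: contp_normsq (jet_sol_sub (sU j) (sZ' j)).
move=> x lx; have [h1 h2 _ _] := rU j x lx; have [h3 h4 _ _] := rZ j x lx.
by move: h1 h2 h3 h4; rewrite /reC /imC /=; case: (phi j x) (psi j x) => ? ? [? ?] /= -> -> -> ->.
Qed.

Lemma opnorm_diff_cvg :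
  opnorm_diff l (resolvent (hamiltonian 0 (sc e)) z)
    (resolvent (hamiltonian alpha (fun _ _ => 0)) z) @[e --> 0^'+] --> (0 : \bar R)%E.
Proof.
set G := fun e : R => _.
(* The supremum of an empty set would be -oo; the source 0, to which both resolvents apply, provides
   an element. *)
have G0 e : 0 < e -> (0 <= G e)%E.
  move=> e0; have H0 : inH l (fun _ _ => 0).
    move=> j; have mL := measurable_link (l0 j).
    split; [exact: measurable_cst|exact: measurable_cst|].
    rewrite /sqnormL2 (eq_integral (cst 0%E)) ?integral0 ?ltry// => x _.
    by rewrite normc_sq /= expr0n addr0.
  have [[sphi _] [spsi _]] := (scaled_resolvent_set e0, limit_resolvent_set).
  have [phi rphi] := sphi _ H0; have [psi rpsi] := spsi _ H0.
  apply: (@le_trans _ _ (hnorm l (fun j x => phi j x - psi j x))).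
    by rewrite /hnorm; case: (\sum_(j < N) _)%E => //= r; rewrite lee_fin sqrtr_ge0.
  apply: ereal_sup_ubound; exists (fun _ _ => 0), phi, psi; split => //.
  apply/(hnorm_le _ _ ler01); rewrite big1 ?lee_fin ?expr1n//= => j _.
  rewrite /sqnormL2 (eq_integral (cst 0%E)) ?integral0// => x _.
  by rewrite normc_sq /= expr0n addr0.
have Gd d : 0 < d -> \forall e \near 0^'+, (0 <= G e <= d%:E)%E.
  move=> /resolvent_difference[e0 e0_gt0 H].
  near=> e; have e_gt0 : 0 < e by near: e; exact: nbhs_right_gt.
  rewrite G0//=; apply: ub_ereal_sup => _ [f [phi [psi [Hf f1 rphi rpsi ->]]]].
  by apply: (H e _ _ f) => //; near: e; exact: nbhs_right_lt.
apply/fine_cvgP; split.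
  apply: filterS (Gd 1 ltr01) => e /andP[h1 h2].
  by rewrite ge0_fin_numE//; apply: le_lt_trans h2 (ltry _).
apply/cvgrPdist_le => d d0; apply: filterS (Gd d d0) => e /andP[h1 h2] /=.
rewrite sub0r normrN ger0_norm ?fine_ge0// -lee_fin fineK//.
by rewrite ge0_fin_numE//; apply: le_lt_trans h2 (ltry _).
Unshelve. all: by end_near. Qed.

End Scaling.
End Hamiltonian.

Theorem theorem6 (R : realType) (N : nat) (l : 'I_N -> \bar R)
    (omega : 'I_N -> R) (V W : 'I_N -> R -> R)
    (N_ge2 : (2 <= N)%N)
    (l_gt0 : forall j, (0 < l j)%E)
    (V_loc : forall j, loc_integrable (l j) (V j))
    (V_below : forall j, ess_bounded_below (l j) (V j))
    (V_limit_point : forall j, l j = +oo%E -> limit_point_case (V j))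
    (W_int : forall j,
       (@lebesgue_measure R).-integrable (link (l j)) (EFin \o W j)) :
  norm_resolvent_cvg l
    (fun eps : R =>
       star_hamiltonian l omega 0 (fun j x => V j x + scaled (l j) (W j) eps x))
    (star_hamiltonian l omega
       (\sum_(j < N) \int[@lebesgue_measure R]_(x in link (l j)) W j x) V).
Proof.
have N0 : (0 < N)%N by apply: leq_trans N_ge2.
have /choice[K] := fun j => loc_integrable_below (l_gt0 j) (V_loc j) (V_below j).
move=> /choice[m HK].
pose M := \sum_(j < N) m j.
have m_ge0 j : 0 <= m j by case: (HK j).
have M0 : 0 <= M by exact: sumr_ge0.
have lK j : locint (K j) by case: (HK j).
have KM j x : - M <= K j x.
  have [_ _ h _] := HK j; apply: le_trans (h x).
  by rewrite lerN2 /M (bigD1 j)//= lerDl sumr_ge0.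
have KV j := let: And4 _ _ _ h := HK j in h.
have VE : V = (fun j x => V j x + 0) by apply/funext => j; apply/funext => x; rewrite addr0.
move=> z z0; rewrite [X in star_hamiltonian _ _ (\sum_(j < N) _) X]VE; split.
- by move=> e; exact: (scaled_resolvent_set omega N0 l_gt0 lK M0 KM KV z0 W_int).
- exact: (limit_resolvent_set omega N0 l_gt0 lK M0 KM KV z0).
- exact: (opnorm_diff_cvg omega N0 l_gt0 lK M0 KM KV z0 W_int).
Qed.
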